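(* Let $T>0$ and let $\Phi:\mathbb{R}^d\to[0,+\infty)$ be an $N_\infty$ function whose complementary function $\Phi^\star$ satisfies the $\Delta_2$-condition. Let $F:[0,T]\times\mathbb{R}^d\to\mathbb{R}$ be differentiable with respect to $x$ for a.e. $t\in[0,T]$ and satisfy: (i) $F$ and $\nabla_xF$ are Carathéodory functions, i.e. measurable in $t\in[0,T]$ for every $x\in\mathbb{R}^d$ and continuous in $x\in\mathbb{R}^d$ for a.e. $t\in[0,T]$; (ii) there exist $a\in C(\mathbb{R}^d,[0,+\infty))$ and $0\le b\in L^1([0,T],\mathbb{R})$ such that $|F(t,x)|+|\nabla_xF(t,x)|\le a(x)b(t)$ for a.e. $t\in[0,T]$ and every $x\in\mathbb{R}^d$; (iii) there exist an $N_\infty$ function $\Phi_0:\mathbb{R}^d\to[0,+\infty)$ such that for every $k>0$ there is $C(k)>0$ with $\Phi_0(x)\le C(k)+\Phi(kx)$ for all $x\in\mathbb{R}^d$, and a function $\delta\in L^1([0,T],\mathbb{R})$ with $\delta\ge 1$, such that $$\Phi^\star\!\left(\frac{\nabla_xF(t,x)}{\delta(t)}\right)\le \Phi_0(x)+1\quad\text{for a.e. } t\in[0,T]\text{ and every }x\in\mathbb{R}^d;$$ (iv) with the same $\Phi_0$ as in (iii), $$\lim_{|x|\to\infty}\frac{\int_0^TF(t,x)\,dt}{\Phi_0(2x)}=+\infty.$$ Let $M$ be a weak$^\star$ closed linear subspace of $L^\Phi([0,T],\mathbb{R}^d)$ and let $V\subset C([0,T],\mathbb{R}^d)$ be closed in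 the norm topology of $C([0,T],\mathbb{R}^d)$ (uniform convergence). Let $$H=\{u\in W^1L^\Phi([0,T],\mathbb{R}^d) : u\in V\text{ and }u'\in M\},$$ and assume $H\neq\emptyset$. Then the functional $$I(u)=\int_0^T\Phi(u'(t))+F(t,u(t))\,dt$$ attains a minimum on $H$.
   Context: $|\cdot|$ is the Euclidean norm on $\mathbb{R}^d$. An $N_\infty$ function is a differentiable convex function $\Phi:\mathbb{R}^d\to[0,+\infty)$ with $\Phi(0)=0$, $\Phi(y)>0$ for $y\ne0$, $\Phi(-y)=\Phi(y)$, and $\lim_{|y|\to\infty}\Phi(y)/|y|=+\infty$. Complementary function: $\Phi^\star(\zeta)=\sup_{y\in\mathbb{R}^d}\,(y\cdot\zeta-\Phi(y))$. A function $\Psi:\mathbb{R}^d\to[0,+\infty)$ satisfies the $\Delta_2$-condition if there is $C>0$ with $\Psi(2x)\le C\Psi(x)+1$ for all $x\in\mathbb{R}^d$. Orlicz space: $L^\Phi=L^\Phi([0,T],\mathbb{R}^d)$ is the set of measurable $u:[0,T]\to\mathbb{R}^d$ such that $\int_0^T\Phi(\lambda u)\,dt<\infty$ for some $\lambda>0$, with the Luxemburg norm $\|u\|_{L^\Phi}=\inf\{\lambda>0:\int_0^T\Phi(u/\lambda)\,dt\le1\}$. $E^\Phi$ is the closure of $L^\infty([0,T],\mathbb{R}^d)$ in $L^\Phi$; $L^{\Phi^\star}$ and $E^{\Phi^\star}$ are defined in the same way from $\Phi^\star$. One has $L^\Phi=[E^{\Phi^\star}]^\star$ via the pairing $\langle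 v,u\rangle=\int_0^Tv\cdot u\,dt$, and the weak$^\star$ topology on $L^\Phi$ is the one induced by $E^{\Phi^\star}$ through this duality. $W^1L^\Phi([0,T],\mathbb{R}^d)$ is the set of absolutely continuous $u:[0,T]\to\mathbb{R}^d$ with $u'\in L^\Phi$, normed by $\|u\|_{W^1L^\Phi}=\|u\|_{L^\Phi}+\|u'\|_{L^\Phi}$. The functional $I$ takes values in $(-\infty,+\infty]$. *)

(* Defs.v *)
From HB Require Import structures.
From mathcomp Require Import all_boot all_order all_algebra.
From mathcomp Require Import all_classical all_reals all_analysis.

Set Implicit Arguments.
Unset Strict Implicit.
Unset Printing Implicit Defensive.

Import Order.TTheory GRing.Theory Num.Theory.
Import numFieldNormedType.Exports.

Local Open Scope classical_set_scope.
Local Open Scope ring_scope.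

(* Functions on [0, T] are encoded as total functions on R of which only the
   restriction to [0, T] is used.  Measurability and integration are in the
   sense of Lebesgue, i.e. with respect to the completed measure on the
   Caratheodory sigma-algebra, of which the carrier is again R. *)
Definition lebT (R : realType) :=
  caratheodory_type ((wlength (idfun : R -> R))^*)%mu.

Definition leb (R : realType) : {measure set (lebT R) -> \bar R} :=
  @completed_lebesgue_measure R.
Arguments leb R : clear implicits.

Section euclidean.
Context {R : realType} {d : nat}.
Implicit Types (x y : 'rV[R]_d) (Psi : 'rV[R]_d -> R).

Definition dotp x y : R := \sum_(i < d) x ord0 i * y ord0 i.

(* The library norm `|x| on row vectors is the sup norm. *)
Definition enorm x : R := Num.sqrt (dotp x x).

Definition grad Psi x : 'rV[R]_d := \row_(i < d) 'D_(delta_mx ord0 i) Psi x.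

(* Psi x --> +oo as |x| --> +oo *)
Definition cvg_infty_pinfty Psi :=
  forall A : R, exists r : R, forall x, r < enorm x -> A < Psi x.

Definition is_Ninfty Psi :=
  [/\ forall y, differentiable Psi y,
      @convex_function R 'rV[R]_d setT Psi,
      Psi 0 = 0 /\ forall y, y != 0 -> 0 < Psi y,
      forall y, Psi (- y) = Psi y
    & cvg_infty_pinfty (fun y => Psi y / enorm y)].

(* The supremum is finite when Psi y / |y| --> +oo; sup is the real-valued one. *)
Definition conjugate Psi (zeta : 'rV[R]_d) : R :=
  sup [set dotp y zeta - Psi y | y in [set: 'rV[R]_d]].

Definition Delta2 Psi :=
  exists2 C : R, 0 < C & forall x, Psi (2 *: x) <= C * Psi x + 1.

End euclidean.

Section orlicz.
Context {R : realType} {d : nat}.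
Variable T : R.
Implicit Types (u v w : R -> 'rV[R]_d) (Psi : 'rV[R]_d -> R).

Definition ae_0T (P : R -> Prop) :=
  {ae leb R, forall t : R, t \in `[0, T] -> P t}.

Definition meas_0T (f : R -> R) :=
  measurable_fun (`[0, T]%classic : set (lebT R)) f.

Definition vmeas_0T u := forall i, meas_0T (fun t => u t ord0 i).

Definition Lone (f : R -> R) := (leb R).-integrable `[0, T] (EFin \o f).

Definition modular Psi u : \bar R :=
  (\int[leb R]_(t in `[0%R, T]) (Psi (u t))%:E)%E.

Definition orlicz Psi : set (R -> 'rV[R]_d) :=
  [set u | vmeas_0T u /\
    exists2 lambda : R, 0 < lambda
      & (modular Psi (fun t => lambda *: u t) < +oo)%E].

Definition luxemburg Psi u : R :=
  inf [set lambda : R | 0 < lambda /\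
    (modular Psi (fun t => lambda^-1 *: u t) <= 1)%E].

Definition Linfty : set (R -> 'rV[R]_d) :=
  [set u | vmeas_0T u /\ exists C : R, ae_0T (fun t => enorm (u t) <= C)].

Definition orlicz_heart Psi : set (R -> 'rV[R]_d) :=
  [set u | orlicz Psi u /\ forall e : R, 0 < e ->
    exists2 w, Linfty w & luxemburg Psi (fun t => u t - w t) < e].

Definition pairing v u : R :=
  Rintegral (leb R) `[0, T]%classic (fun t => dotp (v t) (u t)).

(* The coarsest topology making u |-> <v, u> continuous for each v in the
   closure of L^infty in L^(Psi^star).  It is carried by all functions R -> R^d
   and is only used through its trace on L^Psi. *)
Definition weak_star Psi : topologicalType :=
  initial_topology
    (fun u => (fun v : set_type (orlicz_heart (conjugate Psi)) =>
       pairing (set_val v) u) : prod_topology (fun=> R)).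

Definition linear_subspace (M : set (R -> 'rV[R]_d)) :=
  M (fun=> 0) /\
  forall (c : R) u w, M u -> M w -> M (fun t => c *: u t + w t).

(* Closedness for the trace topology forces M to be stable under equality
   almost everywhere on [0, T], so that M is a set of classes. *)
Definition weak_star_closed_subspace Psi (M : set (R -> 'rV[R]_d)) :=
  [/\ M `<=` orlicz Psi, linear_subspace M
    & closed (M : set (subspace (orlicz Psi : set (weak_star Psi))))].

Definition C0T : set (R -> 'rV[R]_d) :=
  [set u | {within `[0, T], continuous u}].

(* Closedness forces V to depend only on restrictions to [0, T]. *)
Definition closed_in_C0T (V : set (R -> 'rV[R]_d)) :=
  V `<=` C0T /\
  closed (V : set (subspace (C0T : set {uniform` `[0, T] -> 'rV[R]_d}))).

Definition abs_continuous u :=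
  forall e : R, 0 < e -> exists2 eta : R, 0 < eta &
    forall (n : nat) (a b : 'I_n -> R),
      (forall i, [/\ 0 <= a i, a i <= b i & b i <= T]) ->
      trivIset [set: 'I_n] (fun i => `]a i, b i[%classic) ->
      \sum_(i < n) (b i - a i) < eta ->
      \sum_(i < n) enorm (u (b i) - u (a i)) < e.

Definition W1L Psi : set (R -> 'rV[R]_d) :=
  [set u | abs_continuous u /\ orlicz Psi (derive1 u)].

Definition caratheodory_fun (G : R -> 'rV[R]_d -> R) :=
  (forall x, meas_0T (fun t => G t x)) /\ ae_0T (fun t => continuous (G t)).

Definition vcaratheodory_fun (G : R -> 'rV[R]_d -> 'rV[R]_d) :=
  (forall x, vmeas_0T (fun t => G t x)) /\ ae_0T (fun t => continuous (G t)).

Definition action (Phi : 'rV[R]_d -> R) (F : R -> 'rV[R]_d -> R) u : \bar R :=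
  (\int[leb R]_(t in `[0%R, T]) (Phi (derive1 u t) + F t (u t))%:E)%E.

End orlicz.

(* Main.v *)
(** The functional is coercive: writing F(t, u t) - F(t, u 0) along the segment
    from u 0 to u t, Young's inequality with weight delta, hypothesis (iii) and
    the Delta2-condition on Phi* (which gives lam Phi(y / lam) <= e Phi y + D
    for some lam and D) absorb the difference into half of the modular of u' plus
    a multiple of Phi0(2 u 0), which (iv) controls.

    Everything else rests on the sums
    S(u) = sum_i |I_i| Phi(Delta_i u / |I_i|) over disjoint intervals I_i.
    Jensen's inequality gives S(u) <= \int Phi(u'), and a bound S <= c is stable
    under pointwise limits.  Conversely S(u) <= c forces u to be absolutely
    continuous, since Phi is superlinear, and \int Phi(u') <= c, by Fatou's
    lemma applied to the difference quotients of u on finer and finer meshes.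
    Hence a minimizing sequence is equicontinuous, a subsequence converges
    uniformly, and the limit satisfies the lower semicontinuity inequality.
    Its derivative stays in M because the pairing with g in E^{Phi*} passes to
    the limit: g is approximated by bounded functions, and these by step
    functions, on which the pairing only involves values of u. *)

Require Import Defs.
From HB Require Import structures.
From mathcomp Require Import all_boot all_order all_algebra.
From mathcomp Require Import all_classical all_reals all_analysis.
From mathcomp Require Import measurable_realfun.
From mathcomp Require Import ring lra.

Import Order.TTheory GRing.Theory Num.Theory.
Import numFieldNormedType.Exports.

Local Open Scope classical_set_scope.
Local Open Scope ring_scope.

Set Implicit Arguments.
Unset Strict Implicit.
Unset Printing Implicit Defensive.

(** * Absolutely continuous functions are primitives *)

Section interval_families.
Context {R : realType}.
Implicit Types (f : R -> R) (p q : R * R) (L : seq (R * R)).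

(** The Delta2-condition bears on the conjugate only: the modular of u' may be infinite on H, and a
    bound on the Luxemburg norm of u' does not bound it. Hence neither that norm nor compactness of
    balls of L^Phi is used; all estimates are carried by a bound c on the modular, or equivalently
    on S. The base point in the coercivity estimate is u 0, because Jensen's inequality on [0, t]
    bounds Phi((u t - u 0) / T) by m / T for every t, m being the modular. As delta is only
    integrable, what Young's inequality costs is multiplied by the integral of delta, which may be
    large. The Delta2-condition makes the coefficient of m as small as this requires, and the free
    parameter k in the growth condition does the same for Phi0 of the increment. Convexity splits
    Phi0(x + y) at a midpoint, whence the argument 2x in (iv). Densities are obtained for Borel
    sets, by applying Radon-Nikodym to Stieltjes measures, whereas the statement uses the completed
    measure; Borel representatives and completeness link the two. *)

Definition nonoverlap p q : bool := (p.2 <= q.1) || (q.2 <= p.1).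

Definition inside (T : R) p : bool := [&& 0 <= p.1, p.1 <= p.2 & p.2 <= T].

Definition total_length L : R := \sum_(p <- L) (p.2 - p.1).

Definition total_increment f L : R := \sum_(p <- L) `|f p.2 - f p.1|.

(** Lists, unlike families over ['I_n], are easily concatenated and refined. The non-strict
    conclusion survives the supremum that defines a total variation. *)
Definition ac_fun (T : R) f := forall e : R, 0 < e -> exists2 eta : R, 0 < eta &
  forall L, pairwise nonoverlap L -> all (inside T) L ->
    total_length L < eta -> total_increment f L <= e.

Lemma nonoverlap_itvP p q : nonoverlap p q ->
  `]p.1, p.2[%classic `&` `]q.1, q.2[%classic = set0.
Proof.
move=> pq; apply/seteqP; split => // x [] /=; rewrite !in_itv/= => /andP[x1 x2] /andP[x3 x4].
by case/orP: pq => h; lra.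
Qed.

Lemma trivIset_nth_itv L : pairwise nonoverlap L ->
  trivIset [set: 'I_(size L)]
    (fun i : 'I_(size L) => `](nth (0, 0) L i).1, (nth (0, 0) L i).2[%classic).
Proof.
move=> /(pairwiseP (0, 0)) pL; apply/trivIsetP => i j _ _ ij.
have := ij; rewrite -val_eqE /= neq_lt => /orP[]h.
  by apply: nonoverlap_itvP; apply: pL => //; rewrite inE.
by rewrite setIC; apply: nonoverlap_itvP; apply: pL => //; rewrite inE.
Qed.

Lemma ac_fun_coord d (T : R) (u : R -> 'rV[R]_d) (i : 'I_d) :
  abs_continuous T u -> ac_fun T (fun t => u t ord0 i).
Proof.
move=> acu e e0; have [eta eta0 H] := acu e e0; exists eta => // L pL iL lL.
have iL' (k : 'I_(size L)) := allP iL _ (mem_nth (0, 0) (ltn_ord k)).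
have := H (size L) (fun i => (nth (0, 0) L i).1) (fun i => (nth (0, 0) L i).2).
move=> /(_ (fun k => let: conj a bc := andP (iL' k) in let: conj b c := andP bc in And3 a b c)).
move=> /(_ (trivIset_nth_itv pL)).
move: lL; rewrite /total_length (big_nth (0, 0)) big_mkord => lL /(_ lL).
rewrite /total_increment (big_nth (0, 0)) big_mkord => /ltW; apply: le_trans.
apply: ler_sum => k _; rewrite /enorm /dotp -sqrtr_sqr ler_wsqrtr//.
rewrite (bigD1 i)//= !mxE -expr2 lerDl; apply: sumr_ge0 => j _.
by rewrite -expr2 sqr_ge0.
Qed.

Fixpoint steps (a : R) (s : seq R) : seq (R * R) :=
  if s is b :: s' then (a, b) :: steps b s' else [::].

Lemma steps_incr f a s : variation a (last a s) f s = total_increment f (steps a s).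
Proof.
rewrite /variation /total_increment.
move: (last a s) => b.
elim: s a => [|x s ih] a /=; first by rewrite big_nil big_geq.
by rewrite big_cons -ih big_nat_recl//= addrC.
Qed.

Lemma steps_length a s : total_length (steps a s) = last a s - a.
Proof.
rewrite /total_length.
elim: s a => [|x s ih] a /=; first by rewrite big_nil subrr.
by rewrite big_cons ih/=; lra.
Qed.

Lemma steps_mem a s p : path <%R a s -> p \in steps a s ->
  [&& a <= p.1, p.1 <= p.2 & p.2 <= last a s].
Proof.
elim: s a => //= x s ih a /andP[ax xs]; rewrite inE => /predU1P[->/=|pm].
  rewrite lexx (ltW ax)/=; have := @itv_partition_le _ _ x (last x s) s.
  by apply; split.
by have /and3P[h1 -> ->] := ih _ xs pm; rewrite !andbT (le_trans _ h1)// ltW.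
Qed.

Lemma steps_nonoverlap a s : path <%R a s -> pairwise nonoverlap (steps a s).
Proof.
elim: s a => //= x s ih a /andP[ax xs]; rewrite ih// andbT.
apply/allP => p pm; have /and3P[h1 _ _] := steps_mem xs pm.
by rewrite /nonoverlap/= h1.
Qed.

Local Notation TV := total_variation.

(* Each interval of the first list is subdivided in turn, so that its total
   variation replaces the increment, without increasing the total length. *)
Lemma ac_total_variation_aux T f e eta :
  (forall L, pairwise nonoverlap L -> all (inside T) L ->
    total_length L < eta -> total_increment f L <= e) ->
  forall L1 L2, pairwise nonoverlap (L1 ++ L2) -> all (inside T) (L1 ++ L2) ->
    total_length (L1 ++ L2) < eta ->
    (\sum_(p <- L1) TV p.1 p.2 f + (total_increment f L2)%:E <= e%:E)%E.
Proof.
move=> H; elim => [|p L1 ih] L2.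
  rewrite !cat0s => h1 h2 h3; rewrite big_nil add0e lee_fin; exact: H.
rewrite cat_cons /= => /andP[pp h1] /andP[ip h2] h3.
have /and3P[p1 p2 p3] := ip.
have key s : itv_partition p.1 p.2 s ->
  (\sum_(p <- L1) TV p.1 p.2 f + ((variation p.1 p.2 f s)%:E + (total_increment f L2)%:E) <= e%:E)%E.
  move=> [ps /eqP ls].
  have -> : variation p.1 p.2 f s = total_increment f (steps p.1 s).
    by rewrite -steps_incr ls.
  rewrite -EFinD.
  have -> : total_increment f (steps p.1 s) + total_increment f L2 =
    total_increment f (steps p.1 s ++ L2) by rewrite /total_increment big_cat.
  have sub q : q \in steps p.1 s -> [&& p.1 <= q.1, q.1 <= q.2 & q.2 <= p.2].
    by move=> /(steps_mem ps); rewrite ls.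
  apply: ih.
  - move: h1; rewrite !pairwise_cat => /and3P[a1 a2 a3].
    move: pp; rewrite all_cat => /andP[pp1 pp2].
    rewrite a2 a3 steps_nonoverlap//= !andbT allrel_catr a1 andbT; apply/andP; split.
      apply/allrelP => x y xL yL; have /and3P[y1 y2 y3] := sub _ yL.
      by have := allP pp1 _ xL; rewrite /nonoverlap => /orP[]h; apply/orP; lra.
    apply/allrelP => x y xL yL; have /and3P[y1 y2 y3] := sub _ xL.
    by have := allP pp2 _ yL; rewrite /nonoverlap => /orP[]h; apply/orP; lra.
  - move: h2; rewrite !all_cat => /andP[-> ->]; rewrite andbT/=.
    apply/allP => q /sub /and3P[q1 q2 q3]; rewrite /inside.
    by apply/and3P; split => //; lra.
  - move: h3; rewrite /total_length !big_cat/= big_cons big_cat/=.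
    have := steps_length p.1 s; rewrite /total_length ls => ->; lra.
have ptv q : q \in L1 -> (0 <= TV q.1 q.2 f)%E.
  move=> qL; apply: total_variation_ge0.
  by have := allP h2 q; rewrite mem_cat qL => /(_ isT) /and3P[].
have s0 : (0 <= \sum_(p <- L1) TV p.1 p.2 f)%E.
  by rewrite big_seq; apply: sume_ge0.
have i0 : 0 <= total_increment f L2 by apply: sumr_ge0.
(* Finiteness allows the sum to change sides, so that the supremum over the partitions of [p] can be
   taken. *)
have sfin : (\sum_(p <- L1) TV p.1 p.2 f)%E \is a fin_num.
  rewrite ge0_fin_numE// (le_lt_trans _ (ltry e))//.
  have [p12|p12] := ltP p.1 p.2.
    apply: le_trans (key [:: p.2] (itv_partition1 p12)).
    by rewrite leeDl// adde_ge0// lee_fin ?variation_ge0.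
  (* Partitions are strictly increasing, so a degenerate interval only has the empty one. *)
  have pe : p.1 = p.2 by apply/eqP; rewrite eq_le p2 p12.
  have : itv_partition p.1 p.2 [::] by split => //=; apply/eqP.
  move=> /key; apply: le_trans.
  by rewrite leeDl// adde_ge0// lee_fin ?variation_ge0.
rewrite big_cons (addeC (TV _ _ _)) -addeA -leeBrDl//.
rewrite -leeBrDr//.
apply: ge_ereal_sup => _ [_ [s ps <-] <-].
by rewrite leeBrDr// leeBrDl// key.
Qed.

Lemma ac_total_variation {T f} : ac_fun T f -> forall e : R, 0 < e ->
  exists2 eta : R, 0 < eta &
  forall L, pairwise nonoverlap L -> all (inside T) L ->
    total_length L < eta -> (\sum_(p <- L) TV p.1 p.2 f <= e%:E)%E.
Proof.
move=> acf e /acf [eta eta0 H]; exists eta => // L h1 h2 h3.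
have := ac_total_variation_aux H (L1 := L) (L2 := [::]).
by rewrite cats0 /total_increment big_nil adde0; exact.
Qed.

End interval_families.

(** * Densities and derivatives of real absolutely continuous functions *)

Section ac_fun_theory.
Context {R : realType}.
Implicit Types (f g : R -> R) (T : R).

Local Notation TV := total_variation.

Lemma ac_funB T f g : ac_fun T f -> ac_fun T g -> ac_fun T (f \- g).
Proof.
move=> acf acg e e0; have e20 : 0 < e / 2 by lra.
have [h1 h10 H1] := acf _ e20; have [h2 h20 H2] := acg _ e20.
exists (Num.min h1 h2); first by rewrite lt_min h10.
move=> L pL iL; rewrite lt_min => /andP[l1 l2].
rewrite [e]splitr; apply: le_trans (lerD (H1 L pL iL l1) (H2 L pL iL l2)).
rewrite /total_increment -big_split/=; apply: ler_sum => p _.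
rewrite [X in `|X|](_ : _ = (f p.2 - f p.1) - (g p.2 - g p.1)); last by ring.
exact: ler_normB.
Qed.

(** On each of [n.+1] equal pieces shorter than the [eta] of the value 1, the variation is at most
    1, and variations add up. *)
Lemma ac_fun_tv_fin T f : 0 < T -> ac_fun T f -> TV 0 T f \is a fin_num.
Proof.
move=> T0 acf; have [eta eta0 H] := ac_total_variation acf ltr01.
have [n Tn] : exists n : nat, T / n.+1%:R < eta.
  exists (Num.bound (T / eta)); rewrite ltr_pdivrMr// -ltr_pdivrMl// mulrC.
  apply: (lt_le_trans (archi_boundP _)); first by rewrite divr_ge0// ltW.
  by rewrite ler_nat.
pose x k := T * (k%:R / n.+1%:R).
have x0 k : 0 <= x k by rewrite mulr_ge0// ?divr_ge0// ltW.
have xS k : x k <= x k.+1.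
  by rewrite ler_pM2l// ler_pM2r ?invr_gt0// ler_nat.
have xT k : (k <= n.+1)%N -> x k <= T.
  by move=> kn; rewrite -[leRHS]mulr1 ler_pM2l// ler_pdivrMr// mul1r ler_nat.
have xn : x n.+1 = T by rewrite /x divff ?mulr1// pnatr_eq0.
suff : forall k, (k <= n.+1)%N -> TV 0 (x k) f \is a fin_num.
  by move=> /(_ n.+1 (leqnn _)); rewrite xn.
elim => [_|k ih kn]; first by rewrite /x mul0r mulr0 total_variationxx.
rewrite (total_variationD f (x0 k) (xS k)) fin_numD ih ?(ltnW kn)//=.
rewrite ge0_fin_numE ?total_variation_ge0// (le_lt_trans _ (ltry 1))//.
have := H [:: (x k, x k.+1)]; rewrite /total_length !big_seq1/= => -> //.
  by rewrite /inside/= x0 xS xT.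
rewrite /x -mulrBr -mulrBl -natrB// subSnn mul1r//.
Qed.

(** The increment of the variation function over an interval is the variation over that interval,
    which [ac_total_variation] already bounds. *)
Lemma ac_fun_tv T f : 0 < T -> ac_fun T f -> ac_fun T (fun t => fine (TV 0 t f)).
Proof.
move=> T0 acf; have TVT := ac_fun_tv_fin T0 acf.
move=> e /(ac_total_variation acf)[eta eta0 H].
exists eta => // L h1 h2 h3; rewrite -lee_fin; apply: le_trans (H L h1 h2 h3).
rewrite /total_increment -sumEFin [leLHS]big_seq [leRHS]big_seq.
apply: lee_sum => p /(allP h2) /and3P[p1 p2 p3].
have p20 := le_trans p1 p2; have p1T := le_trans p2 p3.
have fin2 : TV 0 p.2 f \is a fin_num.
  by move: TVT; rewrite (total_variationD f p20 p3) fin_numD => /andP[].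
have := fin2; rewrite (total_variationD f p1 p2) fin_numD => /andP[f1 f2].
rewrite fineD// addrAC subrr add0r ger0_norm ?fineK// fine_ge0//.
exact: total_variation_ge0.
Qed.

Definition clamp T (x : R) : R := Num.min (Num.max x 0) T.

Lemma clamp_id T x : 0 <= x -> x <= T -> clamp T x = x.
Proof. by move=> x0 xT; rewrite /clamp max_l// min_l. Qed.

Lemma clamp_ge0 T x : 0 <= T -> 0 <= clamp T x.
Proof. by move=> T0; rewrite /clamp le_min T0 le_max lexx orbT. Qed.

Lemma clamp_le T x : clamp T x <= T.
Proof. by rewrite /clamp ge_min lexx orbT. Qed.

Lemma clamp_nd T : {homo clamp T : x y / x <= y}.
Proof.
move=> x y xy; rewrite /clamp le_min ge_min [X in _ && X]ge_min lexx orbT andbT.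
by apply/orP; left; rewrite ge_max !le_max xy lexx orbT.
Qed.

Lemma clamp_dist T x y : x <= y -> clamp T y - clamp T x <= y - x.
Proof. by move=> xy; rewrite /clamp /Num.min /Num.max; do 4! case: ifPn => //; rewrite -?leNgt => *; lra. Qed.

(* The values of [f] outside [0, T] are discarded through [clamp], so that the
   intervals of the list need not be contained in [0, T]. *)
Lemma ac_fun_clamp T f : 0 <= T -> ac_fun T f -> forall e : R, 0 < e ->
  exists2 eta : R, 0 < eta &
  forall L, pairwise nonoverlap L -> all (fun p => p.1 <= p.2) L ->
    total_length L < eta -> total_increment (f \o clamp T) L <= e.
Proof.
move=> T0 acf e /acf[eta eta0 H]; exists eta => // L h1 h2 h3.
pose L' := [seq (clamp T p.1, clamp T p.2) | p <- L].
have := H L'; rewrite /total_increment /total_length !big_map; apply.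
- rewrite pairwise_map; apply: sub_pairwise h1 => p q /=.
  by rewrite /nonoverlap/= => /orP[]h; apply/orP; [left|right]; apply: clamp_nd.
- rewrite all_map; apply: sub_all h2 => p p12 /=.
  by rewrite /inside/= clamp_ge0//= clamp_nd//= clamp_le.
- apply: le_lt_trans h3; rewrite /total_length big_seq [leRHS]big_seq.
  by apply: ler_sum => p /(allP h2) p12; exact: clamp_dist.
Qed.

Local Notation leb0 := (@lebesgue_measure R).

Lemma stieltjes_itvoc (F : cumulative R R) (a b : R) : a <= b ->
  lebesgue_stieltjes_measure F `]a, b]%classic = (F b - F a)%:E.
Proof.
move=> ab; rewrite /lebesgue_stieltjes_measure/= /measure_extension/=.
rewrite measurable_mu_extE//=; last exact: is_ocitv.
by rewrite wlength_itv_bnd.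
Qed.

Lemma open_lt_mem (I : set R) x : open I -> I x -> exists2 y, I y & y < x.
Proof.
rewrite openE => oI /oI [e /= e0 He]; exists (x - e / 2); last by lra.
by apply: He => /=; rewrite opprB addrC subrK ger0_norm; lra.
Qed.

Lemma open_gt_mem (I : set R) x : open I -> I x -> exists2 y, I y & x < y.
Proof.
rewrite openE => oI /oI [e /= e0 He]; exists (x + e / 2); last by lra.
by apply: He => /=; rewrite opprD addrA subrr sub0r normrN ger0_norm; lra.
Qed.

(** Finite measure excludes unbounded intervals, and openness excludes the end points of the
    hull. *)
Lemma open_itv_bounded (I : set R) : open I -> is_interval I -> I !=set0 ->
  (leb0 I < +oo)%E -> exists p : R * R, p.1 < p.2 /\ I = `]p.1, p.2[%classic.
Proof.
move=> oI iI I0 muI.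
have IE : I = [set` Rhull I] by apply/esym/RhullK; rewrite inE.
case: I0 => x0 Ix0.
move: muI; rewrite [in leb0 I]IE lebesgue_measure_itv.
case: (Rhull I) IE => [[ba a|ba] [bb b|bb]] IE /=.
- have ab : a <= x0 <= b.
    move: Ix0; rewrite IE /= in_itv /=.
    by case: ba {IE}; case: bb => /= /andP[h1 h2]; lra.
  have mI y : a < y < b -> I y.
    move=> /andP[ay yb]; rewrite IE/= in_itv/=.
    by case: ba {IE}; case: bb => /=; lra.
  have [y Iy yx0] := open_lt_mem oI Ix0; have [z Iz x0z] := open_gt_mem oI Ix0.
  have sub w : I w -> a <= w <= b.
    rewrite IE /= in_itv /=.
    by case: ba {IE}; case: bb => /= /andP[h1 h2]; lra.
  have /andP[ay _] := sub _ Iy; have /andP[_ zb] := sub _ Iz.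
  move=> _; exists (a, b); split => /=; first by lra.
  apply/seteqP; split => w /=; rewrite in_itv/=; last exact: mI.
  move=> Iw; have [v /sub Iv vw] := open_lt_mem oI Iw.
  by have [v' /sub Iv' vw'] := open_gt_mem oI Iw; lra.
- by case: bb IE => IE; move: Ix0; rewrite IE/= in_itv/= ?andbF// ltry.
- by case: ba IE => IE; move: Ix0; rewrite IE/= in_itv/= ?andbF// ltNyr.
- by case: ba IE; case: bb => IE; move: Ix0; rewrite IE/= in_itv/= ?andbF.
Qed.

Lemma itv_disjoint_nonoverlap (p q : R * R) : p.1 < p.2 -> q.1 < q.2 ->
  `]p.1, p.2[%classic `&` `]q.1, q.2[%classic = set0 -> nonoverlap p q.
Proof.
move=> p12 q12 pq; rewrite /nonoverlap; apply/negP => /negP.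
rewrite negb_or -!ltNge => /andP[h1 h2].
suff : set0 ((Num.max p.1 q.1 + Num.min p.2 q.2) / 2) by [].
rewrite -pq; split => /=; rewrite in_itv/=; apply/andP;
  by rewrite /Num.max /Num.min; case: ifPn; case: ifPn; rewrite -?leNgt; lra.
Qed.

(** A null set lies in an open set of measure less than [eta]. Finitely many of the components of
    the latter form a nonoverlapping family of total length less than [eta], so their Stieltjes
    masses add up to at most [e], and this bound passes to the series. *)
Lemma null_dominates_stieltjes (F : cumulative R R) :
  (forall e : R, 0 < e -> exists2 eta : R, 0 < eta &
    forall L, pairwise nonoverlap L -> all (fun p => p.1 <= p.2) L ->
      total_length L < eta -> total_increment F L <= e) ->
  forall N, measurable N -> leb0 N = 0%E -> lebesgue_stieltjes_measure F N = 0%E.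
Proof.
move=> acF N mN N0; apply/eqP; rewrite eq_le measure_ge0 andbT.
apply/lee_addgt0Pr => e e0; rewrite add0e.
have [eta eta0 H] := acF _ e0.
have Noo : (leb0 N < +oo)%E by rewrite N0 ltry.
have [U [oU NU muUN]] := lebesgue_regularity_outer mN Noo eta0.
have mU : measurable (U : set (measurableTypeR R)) by exact: open_measurable.
have muU : (leb0 U < eta%:E)%E.
  rewrite -(setDUK NU); apply: le_lt_trans (measureU2 _ mN _) _.
    exact: measurableD.
  by rewrite [X in (X + _)%E]N0 add0e.
apply: (@le_trans _ _ (lebesgue_stieltjes_measure F U)).
  by apply: le_measure; rewrite ?inE.
have UE := open_disjoint_itv_bigcup oU.
have tI := @open_disjoint_itv_trivIset _ _ oU.
have oI := @open_disjoint_itv_open _ _ oU.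
have iI := @open_disjoint_itv_is_interval _ _ oU.
set I := open_disjoint_itv oU in UE tI oI iI.
have mI k : measurable (I k : set (measurableTypeR R)) by exact: open_measurable.
have /choice[p Hp] : forall k, exists p : R * R, I k !=set0 ->
    p.1 < p.2 /\ I k = `]p.1, p.2[%classic.
  move=> k; have [Ik|nIk] := pselect (I k !=set0); last by exists (0, 0).
  have [|p Hp] := open_itv_bounded (oI k) (iI k) Ik; last by exists p.
  apply: (@le_lt_trans _ _ (leb0 U)); last by rewrite (lt_trans muU)// ltry.
  by apply: le_measure; rewrite ?inE//= UE; exact: bigcup_sup.
have seriesU (m : {measure set (measurableTypeR R) -> \bar R}) :
    (m U = \sum_(0 <= k <oo) m (I k))%E.
  by rewrite [in LHS]UE measure_bigcup//; apply: eq_eseriesl => k; rewrite in_setT.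
rewrite seriesU; apply: lime_le; first by apply: is_cvg_nneseries => *; exact: measure_ge0.
apply: nearW => n.
(* The enumeration of the components may contain empty sets, which have no end points to put in the
   list. *)
pose P k := `[< I k !=set0 >].
pose L := [seq p k | k <- index_iota 0 n & P k].
have Lm q : q \in L -> exists k, [/\ q = p k, q.1 < q.2 & I k = `]q.1, q.2[%classic].
  by case/mapP => k; rewrite mem_filter => /andP[/asboolP/Hp[? ?] _] ->; exists k.
have HL : total_increment F L <= e.
  apply: H.
  - rewrite pairwise_map; apply: (@sub_in_pairwise _ P ltn).
    + move=> i j /asboolP Ii /asboolP Ij ij /=.
      have [[p1 IE1] [p2 IE2]] := (Hp _ Ii, Hp _ Ij).
      apply: itv_disjoint_nonoverlap => //; rewrite -IE1 -IE2.
      by move/trivIsetP : tI; apply => //; rewrite neq_ltn; apply/orP; left.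
    + exact: filter_all.
    + by apply: pairwise_filter; rewrite -sorted_pairwise ?iota_ltn_sorted//; exact: ltn_trans.
  - by apply/allP => q /Lm[k [_ /ltW]].
  - rewrite -lte_fin; apply: le_lt_trans muU; rewrite seriesU.
    apply: le_trans (nneseries_lim_ge n _) => [|k _ _]; last exact: measure_ge0.
    rewrite /total_length big_map big_filter -sumEFin [leRHS](bigID P)/=.
    rewrite -[leLHS]adde0; apply: leeD; last by apply: sume_ge0 => *; exact: measure_ge0.
    apply: lee_sum => k /asboolP/Hp [p12 ->].
    by rewrite lebesgue_measure_itv/= lte_fin p12.
rewrite (bigID P)/= [X in (_ + X <= _)%E]big1 ?adde0; last first.
  by move=> k /asboolP/set0P/negP; rewrite negbK => /eqP ->; rewrite measure0.
apply: (@le_trans _ _ (total_increment F L)%:E); last by rewrite lee_fin.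
rewrite /total_increment big_map big_filter -sumEFin.
apply: lee_sum => k /asboolP/Hp [p12 ->].
(* The component is enlarged to a half-open interval, whose Stieltjes mass is exactly the increment
   of [F]. *)
apply: (@le_trans _ _ (lebesgue_stieltjes_measure F `](p k).1, (p k).2]%classic)).
  by apply: le_measure; rewrite ?inE//; apply: subset_itv_oo_oc.
by rewrite (stieltjes_itvoc _ (ltW p12)) lee_fin ler_norm.
Qed.

(** The density is the Radon-Nikodym derivative of the Stieltjes measure of [f \o clamp T],
    restricted to []0, T]] so that it is finite. *)
Lemma nd_ac_density T f : 0 < T -> {in `[0, T] &, {homo f : x y / x <= y}} ->
  ac_fun T f ->
  exists2 g : R -> R, leb0.-integrable setT (EFin \o g) &
    forall t, 0 <= t <= T -> ((f t - f 0)%:E = \int[leb0]_(x in `]0%R, t]) (g x)%:E)%E.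
Proof.
move=> T0 ndf acf; have T0' := ltW T0.
pose F := f \o clamp T.
have ndF : nondecreasing F.
  move=> x y xy; apply: ndf; rewrite ?in_itv/= ?clamp_ge0 ?clamp_le//.
  exact: clamp_nd.
have acF := ac_fun_clamp T0' acf.
have rcF : right_continuous F.
  move=> x; apply/(@cvgrPdist_le _ R^o) => e /acF[eta eta0 H].
  near=> y; have xy : x < y by near: y; exact: nbhs_right_gt.
  have := H [:: (x, y)]; rewrite /total_increment /total_length !big_seq1/= distrC.
  apply => //; first by rewrite (ltW xy).
  by rewrite ltrBlDl; near: y; apply: nbhs_right_lt; rewrite ltrDl.
pose Fmix := isCumulative.Build R _ R F ndF rcF.
pose cF : cumulative R R := HB.pack F Fmix.
have domF := @null_dominates_stieltjes cF acF.
pose nu0 := lebesgue_stieltjes_measure cF.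
have mD : measurable (`]0, T]%classic : set (measurableTypeR R)) by exact: measurable_itv.
have Doo : (nu0 `]0%R, T]%classic < +oo)%E by rewrite /nu0 stieltjes_itvoc// ltry.
pose nu := charge_of_finite_measure (mfrestr mD Doo).
have numu : nu `<< leb0.
  move=> N N0 A mA AN; have mAD : measurable (A `&` `]0, T]%classic) by exact: measurableI.
  by apply: domF => //; apply: N0 => // x [/AN].
have RNfin x : Radon_Nikodym nu leb0 x \is a fin_num by exact: Radon_Nikodym_fin_num.
exists (fine \o Radon_Nikodym nu leb0).
  rewrite [X in _.-integrable _ X](_ : _ = Radon_Nikodym nu leb0); first exact: Radon_Nikodym_integrable.
  by apply/funext => x /=; rewrite fineK.
move=> t /andP[t0 tT].
under eq_integral do rewrite /= fineK//.
have mt : measurable (`]0, t]%classic : set (measurableTypeR R)) by exact: measurable_itv.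
rewrite -Radon_Nikodym_integral//.
rewrite /nu /charge_of_finite_measure /= /mfrestr /mrestr setIidl; last first.
  by move=> x /=; rewrite !in_itv/= => /andP[-> /le_trans->].
by rewrite /nu0 stieltjes_itvoc//= /F/= !clamp_id.
Unshelve. all: by end_near. Qed.

(** Jordan decomposition: with [V] the variation function, [f = V - (V - f)], and both terms are
    nondecreasing and absolutely continuous. *)
Lemma ac_density T f : 0 < T -> ac_fun T f ->
  exists2 g : R -> R, leb0.-integrable setT (EFin \o g) &
    forall t, 0 <= t <= T -> ((f t - f 0)%:E = \int[leb0]_(x in `]0%R, t]) (g x)%:E)%E.
Proof.
move=> T0 acf; have T0' := ltW T0.
pose V t := fine (TV 0 t f).
have fint t : 0 <= t <= T -> TV 0 t f \is a fin_num.
  move=> /andP[t0 tT]; have := ac_fun_tv_fin T0 acf.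
  by rewrite (total_variationD f t0 tT) fin_numD => /andP[].
have acV : ac_fun T V := ac_fun_tv T0 acf.
have VB x y : 0 <= x -> x <= y -> y <= T -> `|f y - f x| <= V y - V x.
  move=> x0 xy yT; rewrite -lee_fin; apply: le_trans (total_variation_ge f xy) _.
  have : TV 0 y f \is a fin_num by apply: fint; rewrite yT (le_trans x0).
  rewrite /V (total_variationD f x0 xy) fin_numD => /andP[f1 f2].
  by rewrite fineD// addrAC subrr add0r fineK.
have [|g1 ig1 Hg1] := @nd_ac_density T V T0 _ acV.
  move=> x y; rewrite !in_itv/= => /andP[x0 _] /andP[_ yT] xy.
  by rewrite -subr_ge0; apply: le_trans (VB _ _ x0 xy yT).
have [|g2 ig2 Hg2] := @nd_ac_density T (V \- f) T0 _ (ac_funB acV acf).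
  move=> x y; rewrite !in_itv/= => /andP[x0 _] /andP[_ yT] xy.
  by have := VB _ _ x0 xy yT; move/ler_normlW; lra.
exists (g1 \- g2).
  by rewrite [X in _.-integrable _ X](_ : _ = (EFin \o g1) \- (EFin \o g2))%E//; exact: integrableB.
move=> t tT; have mt : measurable (`]0, t]%classic : set (measurableTypeR R)) by exact: measurable_itv.
under eq_integral do rewrite EFinB.
rewrite integralB//; [|exact: integrableS ig1|exact: integrableS ig2].
by rewrite -Hg1// -Hg2// -EFinB/=; congr EFin; ring.
Qed.

Lemma ac_derivable T f : 0 < T -> ac_fun T f ->
  exists g : R -> R, [/\ leb0.-integrable setT (EFin \o g),
    forall t, 0 <= t <= T -> ((f t - f 0)%:E = \int[leb0]_(x in `]0%R, t]) (g x)%:E)%E &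
    {ae leb0, forall t, 0 < t < T -> derivable f t 1 /\ derive1 f t = g t}].
Proof.
move=> T0 acf; have [g ig Hg] := ac_density T0 acf; exists g; split => //.
have igS y : leb0.-integrable [set` Interval (BRight 0) (BRight y)] (EFin \o g).
  by apply: integrableS ig.
have locg : locally_integrable setT g.
  by apply: open_integrable_locally => //; exact: openT.
have := FTC1 igS locg; apply: filterS; first exact: (ae_filter_ringOfSetsType leb0).
move=> t H /andP[t0 tT].
have [d1 d2] := H t0.
set G := fun x : R => _ in d1 d2.
(* [f] is known to be a primitive on [[0, T]] only, so the two functions agree around [t] when [t]
   is interior. *)
have Gf : \near t, (G \+ cst (f 0)) t = f t.
  near=> s; have s0 : 0 < s by near: s; exact: lt_nbhsr.
  have sT : s < T by near: s; exact: lt_nbhsl.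
  by rewrite /G /= /Rintegral -Hg ?(ltW s0) ?ltW//= subrK.
have dG : is_derive t 1 (G \+ cst (f 0)) (g t + 0).
  have dG0 : is_derive t 1 G (g t) by apply: DeriveDef; [exact: d1|rewrite -derive1E; exact: d2].
  exact: (@is_deriveD _ _ _ G (cst (f 0)) t 1 (g t) 0 dG0 (is_derive_cst _ _ _)).
have [df dfE] := near_eq_is_derive Gf dG.
by split => //; rewrite derive1E dfE addr0.
Unshelve. all: by end_near. Qed.

End ac_fun_theory.

(** * Transfer between Lebesgue measure on Borel sets and its completion *)

Instance leb_ae_filter (R : realType) : Filter (nbhs (almost_everywhere (leb R))).
Proof. exact: ae_filter_ringOfSetsType. Qed.

Section completed_measure.
Context {R : realType}.
Implicit Types (f g : R -> R) (T : R).

Local Notation leb0 := (@lebesgue_measure R).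
Local Notation mu := (leb R).

Lemma borel_lebT (A : set R) : measurable (A : set (measurableTypeR R)) ->
  measurable (A : set (lebT R)).
Proof. exact: sub_caratheodory. Qed.

Lemma itv_lebT (i : interval R) : measurable ([set` i] : set (lebT R)).
Proof. by apply: borel_lebT; exact: measurable_itv. Qed.

(** Lebesgue measure on Borel sets is the image of its completion under the identity, so a change of
    variables compares the two integrals. *)
Let idm : lebT R -> measurableTypeR R := idfun.

Let measurable_idm : measurable_fun setT idm.
Proof. by move=> _ Y mY; rewrite setTI; exact: borel_lebT. Qed.

Lemma leb_itv (i : interval R) : mu [set` i] = leb0 [set` i].
Proof. by []. Qed.

Lemma leb_itvcc (a b : R) : a <= b -> mu `[a, b]%classic = (b - a)%:E.
Proof.
move=> ab; rewrite leb_itv lebesgue_measure_itv/= lte_fin.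
by case: ltP => // ba; rewrite [X in (X - _)%:E](_ : b = a) ?subrr//; apply/eqP; rewrite eq_le ba.
Qed.

Lemma leb_negligible (N : set R) : leb0.-negligible N -> mu.-negligible N.
Proof. by move=> [A [mA A0 NA]]; exists A; split => //; exact: borel_lebT. Qed.

Lemma leb_ae (P : R -> Prop) : {ae leb0, forall t, P t} -> {ae mu, forall t, P t}.
Proof. exact: leb_negligible. Qed.

Lemma measurable_fun_lebT d (Y : measurableType d) (D : set R) (f : R -> Y) :
  measurable (D : set (measurableTypeR R)) ->
  measurable_fun (D : set (measurableTypeR R)) f -> measurable_fun (D : set (lebT R)) f.
Proof. by move=> mD mf _ B mB; apply: borel_lebT; exact: mf. Qed.

Lemma ge0_integral_leb (D : set R) (f : R -> \bar R) :
  measurable (D : set (measurableTypeR R)) ->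
  measurable_fun (D : set (measurableTypeR R)) f ->
  (forall x, D x -> (0 <= f x)%E) ->
  (\int[mu]_(x in D) f x = \int[leb0]_(x in D) f x)%E.
Proof.
move=> mD mf f0; apply/esym.
apply: (@ge0_integral_pushforward _ _ _ _ _ _ measurable_idm mu D f mD mf) => y.
by rewrite inE; exact: f0.
Qed.

Lemma integral_leb (D : set R) (f : R -> \bar R) :
  measurable (D : set (measurableTypeR R)) ->
  measurable_fun (D : set (measurableTypeR R)) f ->
  (\int[mu]_(x in D) f x = \int[leb0]_(x in D) f x)%E.
Proof.
move=> mD mf; rewrite integralE [RHS]integralE.
by rewrite !ge0_integral_leb//; [exact: measurable_funeneg|exact: measurable_funepos].
Qed.

Lemma integrable_leb (D : set R) (f : R -> \bar R) :
  measurable (D : set (measurableTypeR R)) ->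
  leb0.-integrable D f -> mu.-integrable D f.
Proof.
move=> mD /integrableP[mf foo]; apply/integrableP; split.
  exact: measurable_fun_lebT.
by rewrite ge0_integral_leb//; exact: measurableT_comp.
Qed.

(** The Caratheodory sigma-algebra is the completion of the Borel one: its sets are Borel up to a
    subset of a Borel null set. *)
Lemma lebT_measurableE (E : set R) : measurable (E : set (lebT R)) ->
  exists2 A : set R, measurable (A : set (measurableTypeR R)) &
    exists2 N : set R, measurable (N : set (measurableTypeR R)) /\ leb0 N = 0%E &
      E `\` N = A `\` N.
Proof.
have -> : (measurable : set (set (lebT R))) =
    (completed_algebra_gen leb0).-sigma.-measurable.
  exact: esym (@completed_caratheodory_measurable R).
rewrite g_sigma_completed_algebra_genE => -[A mA [N [B [mB B0 NB]]]] <-.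
exists A => //; exists B => //; apply/seteqP; split => x /= [].
  by case=> // Nx Bx; exfalso; exact/Bx/NB.
by move=> Ax Bx; split => //; left.
Qed.

(** Each set [f > q] with [q] rational is Borel outside a null set. Off the union [M] of these
    countably many null sets [f] is Borel, and it is set to 0 on [M]. *)
Lemma borel_representative (f : R -> R) (D : set R) :
  measurable (D : set (measurableTypeR R)) ->
  measurable_fun (D : set (lebT R)) f ->
  exists2 g : R -> R, measurable_fun (setT : set (measurableTypeR R)) g &
    {ae mu, forall t, D t -> f t = g t}.
Proof.
move=> mD mf.
pose E (q : rat) := D `&` f @^-1` `]ratr q, +oo[%classic.
have mE q : measurable (E q : set (lebT R)).
  by apply: mf => //; exact: borel_lebT.
have /choice[A HA] q : exists A : set R, measurable (A : set (measurableTypeR R)) /\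
    exists2 N : set R, measurable (N : set (measurableTypeR R)) /\ leb0 N = 0%E &
      E q `\` N = A `\` N.
  by have [A ? ?] := lebT_measurableE (mE q); exists A.
have /choice[N HN] q : exists N : set R, [/\ measurable (N : set (measurableTypeR R)), leb0 N = 0%E &
      E q `\` N = A q `\` N].
  by have [_ [N [] ]] := HA q; exists N.
(* The codes that denote no rational fall back on 0, which only repeats one null set. *)
pose M := \bigcup_(n : nat) N (odflt 0 (unpickle n)).
have mM : measurable (M : set (measurableTypeR R)).
  by apply: bigcupT_measurable => n; have [] := HN (odflt 0 (unpickle n)).
have M0 : leb0.-negligible M.
  apply: negligible_bigcup => n; have [? ? _] := HN (odflt 0 (unpickle n)).
  by exists (N (odflt 0 (unpickle n))); split.
have NM q : N q `<=` M.
  by move=> x Nx; exists (pickle q); [by []|rewrite pickleK; exact: Nx].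
have mDM : measurable (D `\` M : set (measurableTypeR R)) by exact: measurableD.
have mfDM : measurable_fun (D `\` M : set (measurableTypeR R)) f.
  apply: (measurability _ (RGenOInfty.measurableE R)) => // _ [_ [c ->] <-].
  (* The set [f > c] is the union of the sets [f > q] over the rationals [q >= c]. *)
  rewrite (_ : _ `&` _ = \bigcup_q (if (c <= ratr q) then A q `\` M else set0)); last first.
    apply/seteqP; split => [x [[Dx Mx]]|x [q _]] /=.
      rewrite in_itv/= andbT => cfx; have [q] := rat_in_itvoo cfx.
      rewrite in_itv/= => /andP[cq qf]; exists q => //; rewrite (ltW cq).
      have [_ _ EAN] := HN q; have Nx : ~ N q x by move=> /NM.
      have : (E q `\` N q) x by split => //; split => //=; rewrite in_itv/= qf.
      by rewrite EAN => -[].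
    case: ifPn => // cq [Ax Mx]; have [_ _ EAN] := HN q.
    have : (A q `\` N q) x by split => // /NM.
    rewrite -EAN => -[[Dx /=]]; rewrite in_itv/= andbT => qf _.
    by split => //; rewrite in_itv/= andbT (le_lt_trans cq).
  apply: bigcupT_measurable_rat => q; case: ifPn => // _.
  by apply: measurableD => //; have [] := HA q.
exists (f \_ (D `\` M)).
  by apply/(measurable_restrictT f mDM).
have := leb_negligible M0; apply: negligibleS => t /= nP.
apply: contrapT => Mt; apply: nP => Dt.
by rewrite patchE mem_set.
Qed.

(** This rests on completeness; it fails for the Borel sigma-algebra. *)
Lemma lebT_ae_measurable (D : set R) (f g : R -> R) :
  {ae mu, forall t, D t -> f t = g t} -> measurable_fun (D : set (lebT R)) f ->
  measurable_fun (D : set (lebT R)) g.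
Proof.
move=> fg mf; apply/measurable_EFinP.
apply: (@ae_measurable_fun _ _ _ mu completed_lebesgue_measure_is_complete _ (EFin \o f)).
  by apply: filterS fg => t /[apply] /= ->.
exact/measurable_EFinP.
Qed.

End completed_measure.

(** * The fundamental theorem of calculus for the completed measure *)

Section ac_fundamental_theorem.
Context {R : realType}.
Implicit Types (f g w : R -> R) (T : R).

Local Notation leb0 := (@lebesgue_measure R).
Local Notation mu := (leb R).

Lemma ae_itvoo_cc T (P : R -> Prop) : {ae mu, forall t, 0 < t < T -> P t} ->
  {ae mu, forall t, t \in `[0, T] -> P t}.
Proof.
move=> aeP; have : {ae mu, forall t : R, t != 0 /\ t != T}.
  apply: leb_negligible.
  have neg1 (x : R) : leb0.-negligible [set x].
    by exists [set x]; split => //; exact: lebesgue_measure_set1.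
  apply: negligibleS (negligibleU (neg1 0) (neg1 T)) => t /= /not_andP[]/negP/negPn/eqP ->.
    by left.
  by right.
apply: filterS2 aeP => t H [t0 tT]; rewrite in_itv/= => /andP[t0' tT'].
by apply: H; rewrite !lt_neqAle t0' tT' tT eq_sym t0.
Qed.

Lemma ac_derivable_leb T f : 0 < T -> ac_fun T f ->
  [/\ ae_0T T (fun t => derivable f t 1), Lone T (derive1 f) &
    forall s t, 0 <= s -> s <= t -> t <= T ->
      ((f t - f s)%:E = \int[mu]_(x in `[s, t]) (derive1 f x)%:E)%E].
Proof.
move=> T0 acf; have [g [ig Hg dg]] := ac_derivable T0 acf.
have {dg}aedg := ae_itvoo_cc (leb_ae dg).
have dfg : {ae mu, forall t, `[0, T]%classic t -> g t = derive1 f t}.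
  by apply: filterS aedg => t H /H [].
have mg : measurable_fun (setT : set (measurableTypeR R)) g.
  by apply/measurable_EFinP; exact: measurable_int ig.
have mdf : measurable_fun (`[0, T]%classic : set (lebT R)) (derive1 f).
  apply: (lebT_ae_measurable dfg); apply: measurable_fun_lebT => //.
  exact: measurable_funTS.
have intE s t : 0 <= s -> t <= T ->
    (\int[mu]_(x in `[s, t]) (derive1 f x)%:E = \int[leb0]_(x in `[s, t]) (g x)%:E)%E.
  move=> s0 tT; rewrite -integral_leb//=; last first.
    by apply/measurable_EFinP; exact: measurable_funTS.
  have st : `[s, t]%classic `<=` `[0, T]%classic by apply: subset_itvScc.
  apply: ae_eq_integral.
  - exact: itv_lebT.
  - by apply/measurable_EFinP; apply: measurable_funS mdf => //; exact: itv_lebT.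
  - by apply/measurable_EFinP; apply: measurable_fun_lebT => //; exact: measurable_funTS.
  - by apply: filterS dfg => x H /st/H ->.
split.
- by apply: filterS aedg => t H /H [].
- apply/integrableP; split; first exact/measurable_EFinP.
  have : mu.-integrable `[0, T] (EFin \o g).
    by apply: integrable_leb => //; exact: integrableS ig.
  move=> /integrableP[_]; congr (_ < _)%E; apply: ae_eq_integral.
  - exact: itv_lebT.
  - apply: measurableT_comp => //; apply/measurable_EFinP; apply: measurable_fun_lebT => //; exact: measurable_funTS.
  - by apply: measurableT_comp => //; apply/measurable_EFinP.
  - by apply: filterS dfg => x H /H /= ->.
- move=> s t s0 st tT; rewrite intE//.
  have igS (D : set R) : measurable (D : set (measurableTypeR R)) -> leb0.-integrable D (EFin \o g).
    by move=> mD; apply: integrableS ig.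
  have fE x : 0 <= x -> x <= T -> f x - f 0 = (\int[leb0]_(y in `]0%R, x]) g y)%R.
    by move=> x0 xT; rewrite /Rintegral -Hg ?x0.
  have -> : f t - f s = (f t - f 0) - (f s - f 0) by ring.
  rewrite !fE ?(le_trans s0)// ?(le_trans st)//.
  rewrite Rintegral_itvB ?bnd_simp//; last exact: igS.
  rewrite Rintegral_itv_obnd_cbnd; last exact: igS.
  rewrite /Rintegral fineK//; apply: integrable_fin_num => //; exact: igS.
Qed.

(** It serves to approximate bounded functions by step functions: the difference quotients of [W]
    are bounded by [C] and converge to [w] almost everywhere. *)
Lemma bounded_primitive T w (C : R) : 0 < T -> 0 <= C -> meas_0T T w ->
  ae_0T T (fun t => `|w t| <= C) ->
  exists W : R -> R,
    (forall s t, 0 <= s -> s <= t -> t <= T -> `|W t - W s| <= C * (t - s)) /\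
    ae_0T T (fun t => derivable W t 1 /\ derive1 W t = w t).
Proof.
move=> T0 C0 mw wC.
have mI : measurable (`[0, T]%classic : set (measurableTypeR R)) by exact: measurable_itv.
have [g mg wg] := borel_representative mI mw.
pose g1 t := if `|g t| <= C then g t else 0.
have g1C t : `|g1 t| <= C by rewrite /g1; case: ifPn => // _; rewrite normr0.
have mg1 : measurable_fun (setT : set (measurableTypeR R)) g1.
  apply: measurable_fun_ifT => //; apply: measurable_fun_ler => //.
  exact: measurableT_comp.
pose h := g1 \_ `[0, T].
have mh : measurable_fun (setT : set (measurableTypeR R)) h.
  by apply/(measurable_restrictT _ mI); exact: measurable_funTS.
have hC t : `|h t| <= C by rewrite /h patchE; case: ifPn => // _; rewrite normr0.
have ih : leb0.-integrable setT (EFin \o h).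
  have -> : EFin \o h = (EFin \o g1) \_ `[0, T].
    by apply/funext => t; rewrite /h /= !patchE; case: ifPn.
  apply/(integrable_mkcond _ mI); apply: measurable_bounded_integrable => //.
  - by rewrite [ltLHS]lebesgue_measure_itv/=; case: ifPn; rewrite ?ltry.
  - exact: measurable_funTS.
  - by exists C; split; rewrite ?num_real// => M CM t _ /=; rewrite (le_trans (g1C t))// ltW.
have ihS (D : set R) : measurable (D : set (measurableTypeR R)) -> leb0.-integrable D (EFin \o h).
  by move=> mD; apply: integrableS ih.
pose W t := (\int[leb0]_(x in `]0%R, t]) h x)%R.
exists W; split.
  move=> s t s0 st tT; rewrite /W Rintegral_itvB ?bnd_simp//; last exact: ihS.
  apply: le_trans (le_normr_Rintegral _ _) _ => //; first exact: ihS.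
  apply: (@le_trans _ _ (\int[leb0]_(x in `]s, t]) C)%R).
    apply: le_Rintegral => //.
    - by have /integrable_norm := ihS `]s, t]%classic (measurable_itv _).
    - apply: measurable_bounded_integrable => //.
      + by rewrite [ltLHS]lebesgue_measure_itv/=; case: ifPn; rewrite ?ltry.
      + by exists C; split; rewrite ?num_real// => M CM x _ /=; rewrite ger0_norm// ltW.
  rewrite Rintegral_cst// [X in fine X]lebesgue_measure_itv/= lte_fin; case: ltP => //= ts.
  by rewrite mulr0 mulr_ge0// subr_ge0.
have locg : locally_integrable setT h.
  by apply: open_integrable_locally => //; exact: openT.
have ihI y : leb0.-integrable [set` Interval (BRight 0) (BRight y)] (EFin \o h) by exact: ihS.
have /leb_ae FT := FTC1 ihI locg.
apply: ae_itvoo_cc.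
apply: filterS3 FT wg wC => t H1 H2 H3 /andP[t0 tT].
have tI : t \in `[0, T] by rewrite in_itv/= !ltW.
have [d1 d2] := H1 t0; split => //; rewrite [LHS]d2.
by rewrite /h patchE mem_set// /g1 -H2// H3.
Qed.

End ac_fundamental_theorem.

(** * Convex functions and their conjugates *)

Section euclidean_vectors.
Context {R : realType} {d : nat}.
Implicit Types (x y z : 'rV[R]_d) (c : R).

Lemma dotpC x y : dotp x y = dotp y x.
Proof. by apply: eq_bigr => i _; rewrite mulrC. Qed.

Lemma dotpDl x y z : dotp (x + y) z = dotp x z + dotp y z.
Proof. by rewrite /dotp -big_split; apply: eq_bigr => i _; rewrite mxE mulrDl. Qed.

Lemma dotpZl c x y : dotp (c *: x) y = c * dotp x y.
Proof. by rewrite /dotp mulr_sumr; apply: eq_bigr => i _; rewrite mxE mulrA. Qed.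

Lemma dotpNl x y : dotp (- x) y = - dotp x y.
Proof. by rewrite -scaleN1r dotpZl mulN1r. Qed.

Lemma dotpBl x y z : dotp (x - y) z = dotp x z - dotp y z.
Proof. by rewrite dotpDl dotpNl. Qed.

Lemma dotp0l y : dotp 0 y = 0.
Proof. by rewrite -(scale0r 0) dotpZl mul0r. Qed.

Lemma dotpZr c x y : dotp x (c *: y) = c * dotp x y.
Proof. by rewrite dotpC dotpZl dotpC. Qed.

Lemma dotpNr x y : dotp x (- y) = - dotp x y.
Proof. by rewrite dotpC dotpNl dotpC. Qed.

Lemma enorm_ge0 x : 0 <= enorm x.
Proof. exact: sqrtr_ge0. Qed.

Lemma enorm0 : enorm (0 : 'rV[R]_d) = 0.
Proof. by rewrite /enorm dotp0l sqrtr0. Qed.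

Lemma enormZ c x : enorm (c *: x) = `|c| * enorm x.
Proof.
by rewrite /enorm dotpZl dotpC dotpZl mulrA sqrtrM ?sqr_ge0// -expr2 sqrtr_sqr.
Qed.

Lemma coord_le_enorm x i : `|x ord0 i| <= enorm x.
Proof.
rewrite /enorm /dotp -sqrtr_sqr ler_wsqrtr// (bigD1 i)//= -expr2 lerDl.
by apply: sumr_ge0 => j _; rewrite -expr2 sqr_ge0.
Qed.

Lemma sum_coord_le_enorm x : \sum_(i < d) `|x ord0 i| <= d%:R * enorm x.
Proof.
apply: le_trans (ler_sum _ (fun i _ => coord_le_enorm x i)) _.
by rewrite sumr_const card_ord mulr_natl.
Qed.

Lemma coord_le_norm x i : `|x ord0 i| <= `|x|.
Proof.
rewrite [leRHS]mx_normrE.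
exact: (@le_bigmax _ _ _ 0 (fun ij : 'I_1 * 'I_d => `|x ij.1 ij.2|) (ord0, i)).
Qed.

Lemma norm_le_coord x c : 0 <= c -> (forall i, `|x ord0 i| <= c) -> `|x| <= c.
Proof.
by move=> c0 xc; rewrite [leLHS]mx_normrE; apply/bigmax_leP; split => //= -[i j] _; rewrite ord1.
Qed.

Lemma norm_le_enorm x : `|x| <= enorm x.
Proof. by apply: norm_le_coord (enorm_ge0 x) (coord_le_enorm x). Qed.

Lemma enorm_le_sum_coord x : enorm x <= \sum_(i < d) `|x ord0 i|.
Proof.
have s0 : 0 <= \sum_(i < d) `|x ord0 i| by apply: sumr_ge0.
rewrite -[leRHS]ger0_norm// -sqrtr_sqr ler_wsqrtr// expr2 mulr_suml.
apply: ler_sum => i _; apply: le_trans (ler_norm _) _.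
by rewrite normrM ler_wpM2l// (bigD1 i)//= lerDl sumr_ge0.
Qed.

Lemma enorm_le_norm x : enorm x <= d%:R * `|x|.
Proof.
apply: le_trans (enorm_le_sum_coord x) _.
apply: le_trans (ler_sum _ (fun i _ => coord_le_norm x i)) _.
by rewrite sumr_const card_ord mulr_natl.
Qed.

Lemma dotp_le (B : R) x y : 0 <= B -> (forall i, `|y ord0 i| <= B) ->
  dotp x y <= B * d%:R * enorm x.
Proof.
move=> B0 yB; rewrite -mulrA; apply: le_trans (_ : \sum_(i < d) `|x ord0 i| * B <= _).
  apply: ler_sum => i _; apply: le_trans (ler_norm _) _; rewrite normrM.
  exact: ler_wpM2l.
by rewrite -mulr_suml mulrC ler_wpM2l// sum_coord_le_enorm.
Qed.

Lemma derive_dotp_grad (f : 'rV[R]_d -> R) x v : differentiable f x ->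
  'D_v f x = dotp v (grad f x).
Proof.
move=> df; rewrite deriveE// [v in LHS]row_sum_delta linear_sum.
by apply: eq_bigr => i _; rewrite linearZ/= mxE -deriveE.
Qed.

Lemma is_derive_line (f : 'rV[R]_d -> R) x v (s : R) : differentiable f (x + s *: v) ->
  is_derive s 1 (fun s : R => f (x + s *: v)) (dotp v (grad f (x + s *: v))).
Proof.
move=> df; rewrite -derive_dotp_grad//.
have E : (fun h : R => h^-1 *: (f (h *: v + (x + s *: v)) - f (x + s *: v))) =
         (fun h : R => h^-1 *: (f (x + (h *: (1 : R) + s) *: v) - f (x + s *: v))).
  by apply/funext => h; rewrite scalerDl [h *: 1]mulr1 addrCA.
have := @diff_derivable _ _ _ f _ v df; rewrite /derivable /derive E => dfv.
by apply: DeriveDef; rewrite /derivable /derive.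
Qed.

End euclidean_vectors.

(** * Convexity, superlinear growth and Young's inequality *)

Section convex_conjugate.
Context {R : realType} {d : nat} {Psi : 'rV[R]_d -> R}.
Hypothesis NPsi : is_Ninfty Psi.
Implicit Types (x y z zeta : 'rV[R]_d).

Lemma Ninfty_differentiable y : differentiable Psi y.
Proof. by case: NPsi. Qed.

Lemma Ninfty_continuous : continuous Psi.
Proof. by move=> y; apply: differentiable_continuous; exact: Ninfty_differentiable. Qed.

Lemma Ninfty0 : Psi 0 = 0.
Proof. by case: NPsi => _ _ []. Qed.

Lemma NinftyN y : Psi (- y) = Psi y.
Proof. by case: NPsi. Qed.

Lemma Ninfty_ge0 y : 0 <= Psi y.
Proof.
have [->|y0] := eqVneq y 0; first by rewrite Ninfty0.
by apply: ltW; case: NPsi => _ _ [_ +] _ _; exact.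
Qed.

Lemma Ninfty_convex (t : R) x y : 0 <= t <= 1 ->
  Psi (t *: x + (1 - t) *: y) <= t * Psi x + (1 - t) * Psi y.
Proof.
move=> /andP[t0 t1]; case: NPsi => _ cvx _ _ _.
have t01 : Itv.spec (@Itv.num_sem R) (Itv.Real `[0%Z, 1%Z]) t.
  by rewrite /= /Itv.num_sem/= num_real in_itv/= t0.
have := cvx (Itv.mk t01) x y; rewrite !in_setT => /(_ isT isT); exact.
Qed.

Lemma Ninfty_scale (t : R) x : 0 <= t <= 1 -> Psi (t *: x) <= t * Psi x.
Proof.
by move=> /(Ninfty_convex x 0); rewrite scaler0 addr0 Ninfty0 mulr0 addr0.
Qed.

Lemma Ninfty_half x y : Psi (x + y) <= 2^-1 * Psi (2 *: x) + 2^-1 * Psi (2 *: y).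
Proof.
have h : 0 <= (2^-1 : R) <= 1 by lra.
have := Ninfty_convex (2 *: x) (2 *: y) h.
rewrite !scalerA mulVf ?pnatr_eq0// scale1r.
by rewrite [1 - _](_ : _ = 2^-1); [rewrite mulVf ?pnatr_eq0// scale1r|field].
Qed.

(** The gradient works: by convexity the quotient of [Psi] at step [h <= 1] from [x] towards [y] is
    at most [Psi y - Psi x], and it tends to the directional derivative. *)
Lemma Ninfty_subgradient x : exists zeta, forall y, Psi x + dotp (y - x) zeta <= Psi y.
Proof.
exists (grad Psi x) => y.
have [] := @is_derive_line _ _ Psi x (y - x) 0 (Ninfty_differentiable _).
rewrite scale0r addr0 => dv /esym; rewrite -lerBrDl => ->.
have := dv; rewrite /derivable => /cvg_dnbhs_at_right cv.
apply: (cvgr_to_le cv); near=> h.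
have h0 : 0 < h by near: h; exact: nbhs_right_gt.
have h1 : h <= 1 by near: h; exact: nbhs_right_le.
have h01 : 0 <= h <= 1 by rewrite ltW.
rewrite /= [h *: 1]mulr1 addr0 scale0r addr0 [_ *: _]mulrC ler_pdivrMr//.
have := Ninfty_convex y x h01.
rewrite (_ : h *: y + (1 - h) *: x = x + h *: (y - x)); first lra.
by rewrite scalerBr scalerBl scale1r addrCA addrA.
Unshelve. all: by end_near. Qed.

(* At y = 0 the quotient Psi y / |y| is 0 / 0 = 0, whence the case distinction
   being on the radius only. *)
Lemma Ninfty_superlinear (e : R) : 0 < e ->
  exists2 K, 0 <= K & forall y, enorm y <= K + e * Psi y.
Proof.
move=> e0; case: NPsi => _ _ _ _ /(_ e^-1)[r Hr].
exists (Num.max r 0); first by rewrite le_max lexx orbT.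
move=> y; have [ry|ry] := ltP (Num.max r 0) (enorm y).
  move: ry; rewrite gt_max => /andP[/Hr h y0].
  have : enorm y <= e * Psi y by move: h; rewrite ltr_pdivlMr// ltr_pdivrMl// => /ltW.
  by move=> /le_trans; apply; rewrite lerDr le_max lexx orbT.
by apply: le_trans ry _; rewrite lerDl mulr_ge0 ?Ninfty_ge0// ltW.
Qed.

(** It makes the supremum in the conjugate finite, and bounded uniformly for bounded [z]. *)
Lemma dotp_le_Ninfty (B : R) : 0 <= B -> exists2 K, 0 <= K &
  forall y z, (forall i, `|z ord0 i| <= B) -> dotp y z <= K + Psi y.
Proof.
(* The added 1 keeps the factor positive when [B] or [d] is 0. *)
move=> B0; have P0 : 0 < B * d%:R + 1 by rewrite ltr_wpDl// mulr_ge0.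
have e0 : 0 < (B * d%:R + 1)^-1 by rewrite invr_gt0.
have [K K0 HK] := Ninfty_superlinear e0.
exists ((B * d%:R + 1) * K); first by rewrite mulr_ge0// ltW.
move=> y z /(dotp_le y B0) /le_trans; apply.
apply: (@le_trans _ _ ((B * d%:R + 1) * enorm y)).
  by rewrite ler_wpM2r ?enorm_ge0// lerDl.
by rewrite -ler_pdivlMl// mulrDr mulrA mulVf ?mul1r ?gt_eqF.
Qed.

Lemma conjugate_has_sup zeta : has_sup [set dotp y zeta - Psi y | y in [set: 'rV[R]_d]].
Proof.
split; first by exists (dotp 0 zeta - Psi 0); exists 0.
have [K K0 HK] := dotp_le_Ninfty (enorm_ge0 zeta).
exists K => _ [y _ <-]; rewrite lerBlDr; apply: HK => i; exact: coord_le_enorm.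
Qed.

Lemma Young y zeta : dotp y zeta <= Psi y + conjugate Psi zeta.
Proof.
rewrite addrC -lerBlDr; apply: ub_le_sup; last by exists y.
by have [] := conjugate_has_sup zeta.
Qed.

Lemma conjugate_le zeta (c : R) : (forall y, dotp y zeta - Psi y <= c) -> conjugate Psi zeta <= c.
Proof.
move=> H; apply: ge_sup; first by have [] := conjugate_has_sup zeta.
by move=> _ [y _ <-].
Qed.

Lemma conjugate_ge0 zeta : 0 <= conjugate Psi zeta.
Proof. by have := Young 0 zeta; rewrite dotp0l Ninfty0 add0r. Qed.

Lemma conjugateN zeta : conjugate Psi (- zeta) = conjugate Psi zeta.
Proof.
suff H z : conjugate Psi (- z) <= conjugate Psi z.
  by apply/eqP; rewrite eq_le H -[X in conjugate _ X <= _](opprK zeta) H.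
apply: conjugate_le => y; rewrite lerBlDl dotpNr -dotpNl.
by rewrite -(NinftyN y); exact: Young.
Qed.

Lemma norm_Young y zeta : `|dotp y zeta| <= Psi y + conjugate Psi zeta.
Proof.
rewrite ler_norml Young andbT lerNl -dotpNl -(NinftyN y); exact: Young.
Qed.

Lemma conjugate_scale (t : R) z : 0 <= t <= 1 ->
  conjugate Psi (t *: z) <= t * conjugate Psi z.
Proof.
move=> /andP[t0 t1]; apply: conjugate_le => y; rewrite dotpZr lerBlDl.
apply: (@le_trans _ _ (t * (Psi y + conjugate Psi z))); first by rewrite ler_wpM2l// Young.
by rewrite mulrDr lerD2r ler_piMl// Ninfty_ge0.
Qed.

Lemma conjugate_half x y :
  conjugate Psi (x + y) <= 2^-1 * conjugate Psi (2 *: x) + 2^-1 * conjugate Psi (2 *: y).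
Proof.
apply: conjugate_le => z; rewrite dotpC dotpDl.
have := Young z (2 *: x); have := Young z (2 *: y).
rewrite !dotpZr !(dotpC z); lra.
Qed.

Lemma conjugate_bounded (B : R) : 0 <= B ->
  exists2 K, 0 <= K & forall z, (forall i, `|z ord0 i| <= B) -> conjugate Psi z <= K.
Proof.
move=> /dotp_le_Ninfty[K K0 HK]; exists K => // z zB; apply: conjugate_le => y.
by rewrite lerBlDr; exact: HK.
Qed.

(* Young's inequality at (y, 2^n zeta), where zeta is a subgradient at y / lam,
   beats the equality case of Young's inequality at (y / lam, zeta). *)
Lemma Delta2_conjugate_contract (e : R) : Delta2 (conjugate Psi) -> 0 < e ->
  exists2 lam : R, 0 < lam & exists2 D : R, 0 <= D &
    forall y, lam * Psi (lam^-1 *: y) <= e * Psi y + D.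
Proof.
move=> [C C0 HC] e0.
pose C1 := Num.max C 1.
have C11 : 1 <= C1 by rewrite le_max lexx orbT.
have HC1 x : conjugate Psi (2 *: x) <= C1 * conjugate Psi x + 1.
  apply: le_trans (HC x) _; rewrite lerD2r ler_wpM2r ?conjugate_ge0//.
  by rewrite le_max lexx.
have iter n : exists2 D : R, 0 <= D &
    forall x, conjugate Psi (2 ^+ n *: x) <= C1 ^+ n * conjugate Psi x + D.
  elim: n => [|n [D D0 HD]]; first by exists 0 => // x; rewrite !expr0 scale1r mul1r addr0.
  exists (C1 * D + 1); first by rewrite addr_ge0// mulr_ge0// (le_trans ler01).
  move=> x; rewrite exprS -scalerA; apply: le_trans (HC1 _) _.
  rewrite addrA lerD2r exprS -mulrA -mulrDr ler_wpM2l//; exact: le_trans C11.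
(* Scaling [zeta] by 2^n costs the factor C1^n on the conjugate; this will be [lam], and division by
   2^n leaves at most [e] in front of [Psi y]. *)
have [n ne] : exists n : nat, (2 ^+ n)^-1 <= e.
  exists (Num.bound e^-1); rewrite -[leRHS]invrK lef_pV2 ?posrE ?invr_gt0 ?exprn_gt0//.
  apply: ltW; apply: lt_trans (archi_boundP _) _; first by rewrite invr_ge0 ltW.
  by rewrite -natrX ltr_nat ltn_expl.
have [D D0 HD] := iter n.
have lam1 : 1 <= C1 ^+ n by rewrite exprn_ege1.
have lam0 : 0 < C1 ^+ n by apply: lt_le_trans lam1.
exists (C1 ^+ n) => //; exists D => // y.
move: (C1 ^+ n) lam1 lam0 HD => lam lam1 lam0 HD.
have [zeta Hz] := Ninfty_subgradient (lam^-1 *: y).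
have E1 : conjugate Psi zeta <= dotp (lam^-1 *: y) zeta - Psi (lam^-1 *: y).
  by apply: conjugate_le => z; have := Hz z; rewrite dotpBl; lra.
have {E1} E1 : lam * Psi (lam^-1 *: y) <= dotp y zeta - lam * conjugate Psi zeta.
  have := ler_wpM2l (ltW lam0) E1.
  by rewrite dotpZl mulrBr mulVKf ?gt_eqF// lerBrDl -lerBrDr.
have E2 : 2 ^+ n * dotp y zeta <= Psi y + (lam * conjugate Psi zeta + D).
  by rewrite -dotpZr; apply: le_trans (Young _ _) _; rewrite lerD2l.
have {E2} E2 : dotp y zeta <= (2 ^+ n)^-1 * (Psi y + (lam * conjugate Psi zeta + D)).
  by rewrite ler_pdivlMl ?exprn_gt0.
(* Since 2^-n is at most 1, the conjugate term of [E2] is absorbed by the term of opposite sign in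
   [E1]. *)
have p1 : (2 ^+ n)^-1 <= (1 : R) by rewrite invf_le1 ?exprn_gt0// exprn_ege1// ler1n.
have p0 : 0 <= ((2 ^+ n)^-1 : R) by rewrite invr_ge0 exprn_ge0.
apply: le_trans E1 _; rewrite lerBlDr; apply: le_trans E2 _.
rewrite mulrDr -addrA lerD// ?ler_wpM2r ?Ninfty_ge0//.
rewrite [leRHS]addrC ler_piMl// addr_ge0// mulr_ge0// ?conjugate_ge0// ltW//.
Qed.

End convex_conjugate.

(** * Difference quotients and modulars *)

Section vector_measurability.
Context {R : realType} {d : nat}.
Implicit Types (v : R -> 'rV[R]_d) (T : R) (U : set 'rV[R]_d).

Local Notation mu := (leb R).

Lemma bigcup_countType_measurable d' (Y : sigmaRingType d') (I : countType) (F : I -> set Y) :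
  (forall i, measurable (F i)) -> measurable (\bigcup_i F i).
Proof.
move=> mF.
rewrite (_ : \bigcup_i F i = \bigcup_(n : nat) (if unpickle n is Some i then F i else set0)).
  by apply: bigcup_measurable => n _; case: unpickle.
apply/seteqP; split => x [].
  by move=> i _ Fx; exists (pickle i) => //; rewrite pickleK.
by move=> n _; case: unpickle => // i Fx; exists i.
Qed.

(** An open set is a union of boxes with rational centre and radius, of which there are countably
    many; the preimage of a box is measurable coordinate by coordinate. *)
Lemma vmeas_open T v U : vmeas_0T T v -> open U ->
  measurable (`[0, T]%classic `&` v @^-1` U : set (lebT R)).
Proof.
move=> mv oU.
pose box (q : 'rV[rat]_d * rat) := [set x : 'rV[R]_d | forall i, `|ratr (q.1 ord0 i) - x ord0 i| < ratr q.2].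
rewrite (_ : _ `&` _ = \bigcup_(q in [set q | box q `<=` U]) (`[0, T]%classic `&` v @^-1` box q)); last first.
  apply/seteqP; split => [t [tT Ut]|t [q /= qU [tT /qU]]]; last by split.
  move: oU; rewrite openE => /(_ _ Ut) /nbhs_ballP[e /= e0 He].
  have e20 : 0 < e / 2 by lra.
  have [r] := rat_in_itvoo e20; rewrite in_itv/= => /andP[r0 re].
  have /choice[q Hq] (i : 'I_d) : exists q : rat, v t ord0 i - ratr r < ratr q < v t ord0 i + ratr r.
    have vr : v t ord0 i - ratr r < v t ord0 i + ratr r by lra.
    by have [q] := rat_in_itvoo vr; rewrite in_itv/=; exists q.
  exists (\row_i q i, r) => /=; last first.
    by split => //= i; rewrite mxE ltr_distl; have := Hq i; lra.
  move=> x /= Hx; apply: He; split=> // i j; rewrite ord1 /ball/=.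
  have := Hx j; rewrite mxE; have := Hq j.
  by rewrite !ltr_distl => /andP[? ?] /andP[? ?]; apply/andP; split; lra.
rewrite bigcup_mkcond; apply: bigcup_countType_measurable => q.
case: ifPn => // _.
(* The factor [[0, T]] also stands outside because for [d = 0] the intersection over the coordinates
   is the whole line. *)
rewrite (_ : _ `&` _ = `[0, T]%classic `&`
   \big[setI/setT]_(i < d) (`[0, T]%classic `&` (fun t => v t ord0 i) @^-1`
      `](ratr (q.1 ord0 i) - ratr q.2), (ratr (q.1 ord0 i) + ratr q.2)[%classic)).
  apply: measurableI; first exact: itv_lebT.
  apply: bigsetI_measurable => i _; apply: mv; first exact: itv_lebT.
  exact: measurable_itv.
rewrite -bigcap_seq; apply/seteqP; split => t /= [tT H]; split => // i /=.
  by move=> _; split=> //=; have := H i; rewrite in_itv/= distrC ltr_distl.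
have := H i; rewrite /= mem_index_enum => /(_ isT) []; rewrite /= in_itv/=.
by rewrite distrC ltr_distl.
Qed.

Lemma vmeas_lower_semicontinuous T v (G : 'rV[R]_d -> R) : vmeas_0T T v ->
  (forall c, open [set x | c < G x]) -> meas_0T T (G \o v).
Proof.
move=> mv oG; apply: (measurability _ (RGenOInfty.measurableE R)) => // _ [_ [c ->] <-].
rewrite (_ : _ `&` _ = `[0, T]%classic `&` v @^-1` [set x | c < G x]); first exact: vmeas_open.
by apply/seteqP; split => t /= []; rewrite !in_itv/= ?andbT.
Qed.

Lemma vmeas_continuous T v (G : 'rV[R]_d -> R) : vmeas_0T T v -> continuous G ->
  meas_0T T (G \o v).
Proof.
move=> mv cG; apply: vmeas_lower_semicontinuous => // c.
by apply: open_comp (@open_gt _ c) => x _; exact: cG.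
Qed.

Lemma vmeasZ T v (c : R) : vmeas_0T T v -> vmeas_0T T (fun t => c *: v t).
Proof.
move=> mv i; rewrite (_ : (fun t => _) = (fun t => c * v t ord0 i)); last first.
  by apply/funext => t; rewrite mxE.
by apply: measurable_funM; [exact: measurable_cst|exact: mv].
Qed.

Lemma vmeasB T v w : vmeas_0T T v -> vmeas_0T T w -> vmeas_0T T (fun t => v t - w t).
Proof.
move=> mv mw i; rewrite (_ : (fun t => _) = (fun t => v t ord0 i - w t ord0 i)); last first.
  by apply/funext => t; rewrite !mxE.
by apply: measurable_funB; [exact: mv|exact: mw].
Qed.

Lemma vmeas_dotp T v w : vmeas_0T T v -> vmeas_0T T w -> meas_0T T (fun t => dotp (v t) (w t)).
Proof.
move=> mv mw; apply: measurable_sum => i.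
by apply: measurable_funM; [exact: mv|exact: mw].
Qed.

Lemma dotp_continuous (y : 'rV[R]_d) : continuous (dotp y).
Proof.
rewrite /dotp; apply: continuous_big => [|i _]; first exact: add_continuous.
move=> x; apply: (@cvgM _ _ (nbhs x)); first exact: cvg_cst.
exact: coord_continuous.
Qed.

(** As a supremum of affine functions the conjugate is lower semicontinuous: its strict superlevel
    sets are unions of open half-spaces. *)
Lemma vmeas_conjugate T v (Psi : 'rV[R]_d -> R) : is_Ninfty Psi -> vmeas_0T T v ->
  meas_0T T (conjugate Psi \o v).
Proof.
move=> NPsi mv; apply: vmeas_lower_semicontinuous => // c.
rewrite (_ : [set x | _] = \bigcup_(y in setT) [set x | c + Psi y < dotp y x]).
  apply: bigcup_open => y _; apply: (open_comp _ (@open_gt _ (c + Psi y))) => x _.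
  exact: dotp_continuous.
apply/seteqP; split => [x /= cx|x [y _ /=]].
  have [_ [y _ <-] h] := sup_gt (conjugate_has_sup NPsi x).1 cx.
  by exists y => //=; rewrite -ltrBrDr.
by move=> h; have := Young NPsi y x; lra.
Qed.

Lemma Rintegral_dotp (D : set R) v z : measurable (D : set (lebT R)) ->
  (forall i, mu.-integrable D (fun t => (v t ord0 i)%:E)) ->
  mu.-integrable D (fun t => (dotp (v t) z)%:E) /\
  Rintegral mu D (fun t => dotp (v t) z) = dotp (\row_i Rintegral mu D (fun t => v t ord0 i)) z.
Proof.
move=> mD iv.
have E : (fun t => (dotp (v t) z)%:E) = (fun t => \sum_(i < d) (z ord0 i)%:E * (v t ord0 i)%:E)%E.
  by apply/funext => t; rewrite /dotp -sumEFin; apply: eq_bigr => i _; rewrite -EFinM mulrC.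
have iz i : mu.-integrable D (fun t => (z ord0 i)%:E * (v t ord0 i)%:E)%E by exact: integrableZl.
split; first by rewrite E; apply: integrable_sum.
rewrite /Rintegral E integral_sum//.
rewrite (eq_bigr (fun i => (z ord0 i * Rintegral mu D (fun t => v t ord0 i))%:E)).
  by rewrite sumEFin /= /dotp; apply: eq_bigr => i _; rewrite mxE mulrC.
move=> i _; rewrite integralZl// EFinM /Rintegral fineK//.
exact: integrable_fin_num.
Qed.

End vector_measurability.

(** * Uniform meshes of the interval *)

Section cells.
Context {R : realType}.
Implicit Types (T s t : R) (f : R -> R).

Local Notation mu := (leb R).

Lemma integral_itv_bndc s t f : s <= t -> measurable_fun (`[s, t]%classic : set (lebT R)) f ->
  (\int[mu]_(x in `[s, t]) (f x)%:E = \int[mu]_(x in `[s, t[) (f x)%:E)%E.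
Proof.
move=> st mf; have m1 : measurable ([set t] : set (lebT R)).
  by apply: borel_lebT; exact: measurable_set1.
have E : `[s, t]%classic = `[s, t[%classic `|` [set t].
  apply/seteqP; split => x /=; rewrite !in_itv/=.
    by move=> /andP[sx]; rewrite le_eqVlt => /predU1P[->|xt]; [right|left; rewrite sx].
  by move=> [/andP[-> /ltW//]|->]; rewrite st lexx.
have mco : measurable (`[s, t[%classic : set (lebT R)) by exact: itv_lebT.
rewrite E integral_setU_EFin//.
- rewrite [X in (_ + X)%E]null_set_integral ?adde0; [by []|exact: m1| |].
  + apply/measurable_EFinP; apply: measurable_funS mf; first exact: itv_lebT.
    by move=> x /= ->; rewrite in_itv/= st lexx.
  + exact: lebesgue_measure_set1.
- by rewrite -E.
- apply/disj_setPS => x [] /=; rewrite in_itv/= => /andP[_ xt] xt'.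
  by move: xt; rewrite xt' ltxx.
Qed.

Lemma integral_itv_oo s t f : s <= t -> measurable_fun (`[s, t]%classic : set (lebT R)) f ->
  (\int[mu]_(x in `[s, t]) (f x)%:E = \int[mu]_(x in `]s, t[) (f x)%:E)%E.
Proof.
move=> st mf; rewrite integral_itv_bndc//.
have [ts|st'] := leP t s.
  by rewrite (set_itv_ge (_ : ~~ (BLeft s < BLeft t)%O)) ?(set_itv_ge (_ : ~~ (BRight s < BLeft t)%O)) ?bnd_simp -?leNgt.
have m1 : measurable ([set s] : set (lebT R)).
  by apply: borel_lebT; exact: measurable_set1.
have E : `[s, t[%classic = `]s, t[%classic `|` [set s] by rewrite setUC setU1itv ?bnd_simp.
have moo : measurable (`]s, t[%classic : set (lebT R)) by exact: itv_lebT.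
have sub : `[s, t[%classic `<=` `[s, t]%classic by exact: subset_itv_co_cc.
have mf' : measurable_fun (`[s, t[%classic : set (lebT R)) f.
  by apply: measurable_funS mf => //; exact: itv_lebT.
rewrite E integral_setU_EFin//.
- rewrite [X in (_ + X)%E]null_set_integral ?adde0; [by []|exact: m1| |].
  + apply/measurable_EFinP; apply: measurable_funS mf'; first exact: itv_lebT.
    by rewrite E; exact: subsetUr.
  + exact: lebesgue_measure_set1.
- by rewrite -E.
- apply/disj_setPS => x [] /=; rewrite in_itv/= => /andP[xs _] xs'.
  by move: xs; rewrite xs' ltxx.
Qed.

(** Mesh [n] has [n.+1] cells, half-open so as to be disjoint. They cover [[0, T[]; the point [T]
    has index [n.+1] and is neglected as a null set in the integrals. *)
Definition cell T n j : set R :=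
  `[(j%:R * (T / n.+1%:R)), (j.+1%:R * (T / n.+1%:R))[%classic.

Definition cell_index T n t : nat := Num.truncn (t / (T / n.+1%:R)).

Lemma cellP T n j t : 0 < T -> cell T n j t -> cell_index T n t = j.
Proof.
move=> T0; have h0 : 0 < T / n.+1%:R by rewrite divr_gt0.
rewrite /cell /= in_itv/= => /andP[jt tj]; apply: truncn_def.
by rewrite ler_pdivlMr// ltr_pdivrMr// jt.
Qed.

Lemma cell_index_mem T n t : 0 < T -> 0 <= t -> cell T n (cell_index T n t) t.
Proof.
move=> T0 t0; have h0 : 0 < T / n.+1%:R by rewrite divr_gt0.
have := truncn_itv (divr_ge0 t0 (ltW h0)).
by rewrite /cell /= in_itv/= ler_pdivlMr// ltr_pdivrMr.
Qed.

Lemma cell_bound T n j : 0 < T -> (j < n.+1)%N ->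
  [/\ 0 <= j%:R * (T / n.+1%:R), j%:R * (T / n.+1%:R) < j.+1%:R * (T / n.+1%:R) &
      j.+1%:R * (T / n.+1%:R) <= T].
Proof.
move=> T0 jn; have h0 : 0 < T / n.+1%:R by rewrite divr_gt0.
split; first by rewrite mulr_ge0// ltW.
  by rewrite ltr_pM2r// ltr_nat.
rewrite mulrCA ger_pMr// ler_pdivrMr// mul1r ler_nat//.
Qed.

Lemma cell_index_lt T n t : 0 < T -> 0 <= t -> t < T -> (cell_index T n t < n.+1)%N.
Proof.
move=> T0 t0 tT; have h0 : 0 < T / n.+1%:R by rewrite divr_gt0.
have := cell_index_mem n T0 t0; rewrite /cell/= in_itv/= => /andP[jt _].
rewrite -(ltr_nat R) -(ltr_pM2r h0) (le_lt_trans jt)//.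
by rewrite mulrCA divff ?mulr1// pnatr_eq0.
Qed.

Lemma cell_measurable T n j : measurable (cell T n j : set (lebT R)).
Proof. exact: itv_lebT. Qed.

Lemma bigsetU_cell T n : 0 < T -> \big[setU/set0]_(j < n.+1) cell T n j = `[0, T[%classic.
Proof.
move=> T0; rewrite -bigcup_mkord; apply/seteqP; split => [t [j /= jn]|t /=].
  rewrite /cell/= !in_itv/= => /andP[jt tj]; have [b1 b2 b3] := cell_bound T0 jn.
  by rewrite (le_trans b1)// (lt_le_trans tj).
rewrite in_itv/= => /andP[t0 tT]; exists (cell_index T n t) => /=.
  exact: cell_index_lt.
exact: cell_index_mem.
Qed.

Lemma integral_cells T n f : 0 < T -> meas_0T T f ->
  (\int[mu]_(t in `[0%R, T]) (f t)%:E = \sum_(j < n.+1) \int[mu]_(t in cell T n j) (f t)%:E)%E.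
Proof.
move=> T0 mf; rewrite integral_itv_bndc ?ltW// -(bigsetU_cell n T0).
rewrite -(big_mkord xpredT (cell T n)) -(big_mkord xpredT (fun j => \int[mu]_(t in cell T n j) (f t)%:E)%E).
rewrite integral_bigsetU_EFin//.
- by move=> j; exact: cell_measurable.
- exact: iota_uniq.
- apply/trivIsetP => i j _ _ ij; apply/seteqP; split => // t [/(cellP T0) it /(cellP T0) jt].
  by move: ij; rewrite -it -jt eqxx.
- rewrite big_mkord bigsetU_cell//; apply/measurable_EFinP; apply: measurable_funS mf.
    exact: itv_lebT.
  by apply: subset_itvl; rewrite bnd_simp.
Qed.

Lemma integral_cell_cst T n j (c : R) : 0 < T ->
  (\int[mu]_(t in cell T n j) c%:E = ((T / n.+1%:R) * c)%:E)%E.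
Proof.
move=> T0; have h0 : 0 < T / n.+1%:R by rewrite divr_gt0.
rewrite integral_cst; last exact: cell_measurable.
have -> : mu (cell T n j) = (T / n.+1%:R)%:E.
  rewrite /cell leb_itv [LHS]lebesgue_measure_itv/= lte_fin ltr_pM2r// ltr_nat ltnSn.
  by rewrite -EFinB -mulrBl -natrB// subSnn mul1r.
by rewrite -EFinM mulrC.
Qed.

Lemma measurable_cell_index_fun T n d' (Y : sigmaRingType d') (g : nat -> R -> Y) : 0 < T ->
  (forall j, measurable_fun (`[0, T]%classic : set (lebT R)) (g j)) ->
  measurable_fun (`[0, T]%classic : set (lebT R)) (fun t => g (cell_index T n t) t).
Proof.
move=> T0 mg mD B mB.
rewrite (_ : _ `&` _ = \bigcup_j (cell T n j `&` (`[0, T]%classic `&` g j @^-1` B))).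
  apply: bigcup_measurable => j _; apply: measurableI; first exact: cell_measurable.
  exact: mg.
apply/seteqP; split => t /=.
  move=> [tT Bt]; exists (cell_index T n t) => //; split => //; apply: cell_index_mem => //.
  by move: tT; rewrite in_itv/= => /andP[].
by move=> [j _ [/(cellP T0) -> []]].
Qed.

Lemma measurable_cell_index T n d' (Y : sigmaRingType d') (g : nat -> Y) : 0 < T ->
  measurable_fun (`[0, T]%classic : set (lebT R)) (fun t => g (cell_index T n t)).
Proof.
move=> T0; apply: (@measurable_cell_index_fun T n _ Y (fun j _ => g j) T0) => j.
exact: measurable_cst.
Qed.

Lemma cell_left_cvg T t : 0 < T -> 0 <= t ->
  (cell_index T n t)%:R * (T / n.+1%:R) @[n --> \oo] --> t.
Proof.
move=> T0 t0; apply/cvgrPdist_le => e e0; near=> n.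
have h0 : 0 < T / n.+1%:R by rewrite divr_gt0.
have := cell_index_mem n T0 t0; rewrite /cell/= in_itv/= => /andP[jt tj].
have he : T / n.+1%:R <= e.
  rewrite ler_pdivrMr// -ler_pdivrMl// mulrC.
  near: n; exists (Num.bound (T / e)) => // n /= Tn.
  apply: le_trans (ltW (archi_boundP _)) _; first by rewrite divr_ge0// ltW.
  by rewrite ler_nat (leq_trans Tn).
rewrite ger0_norm ?subr_ge0//; apply: le_trans he.
by move: tj; rewrite -natr1 mulrDl mul1r => /ltW; rewrite addrC -lerBlDr.
Unshelve. all: by end_near. Qed.

End cells.

(** * Difference quotients on a mesh *)

Section difference_quotients.
Context {R : realType} {V : normedModType R}.
Implicit Types (T t : R) (u : R -> V) (n j : nat).

Definition slope T n u j : V := (T / n.+1%:R)^-1 *: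
  (u (j.+1%:R * (T / n.+1%:R)) - u (j%:R * (T / n.+1%:R))).

Definition dq T n u t : V := slope T n u (cell_index T n t).

(** The mesh cell containing [t] seldom has [t] as an end point. The first-order errors at [x] and
    [y] are at most [e (t - x)] and [e (y - t)], whose sum is exactly [e (y - x)]. *)
Lemma derivable_straddle u t : derivable u t 1 -> forall e : R, 0 < e ->
  exists2 eta : R, 0 < eta & forall x y, x <= t -> t <= y -> x < y -> y - x < eta ->
    `|(y - x)^-1 *: (u y - u x) - derive1 u t| <= e.
Proof.
move=> du e e0.
have key : exists2 eta : R, 0 < eta &
    forall s, `|s - t| < eta -> `|u s - u t - (s - t) *: derive1 u t| <= e * `|s - t|.
  move: du; rewrite /derivable => du; have := du.
  move=> /cvgrPdist_le/(_ e e0)/nbhs_ballP[eta /= eta0 H]; exists eta => // s st.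
  have [->|st0] := eqVneq s t; first by rewrite !subrr scale0r subr0 !normr0 mulr0.
  have st0' : s - t != 0 by rewrite subr_eq0.
  have := H (s - t); rewrite /ball/= sub0r normrN => /(_ st st0').
  rewrite -[lim _]/('D_1 u t) -derive1E [(s - t) *: 1]mulr1 subrK => {}H.
  rewrite -ler_pdivrMr ?normr_gt0//; apply: le_trans H.
  rewrite mulrC -normfV -normrZ scalerBr scalerA mulVf// scale1r distrC//.
have [eta eta0 H] := key; exists eta => // x y xt ty xy yx.
have yx0 : 0 < y - x by rewrite subr_gt0.
have E : (y - x)^-1 *: (u y - u x) - derive1 u t = (y - x)^-1 *:
    ((u y - u t - (y - t) *: derive1 u t) - (u x - u t - (x - t) *: derive1 u t)).
  rewrite -[X in _ - X = _](scale1r (derive1 u t)) -(mulVf (lt0r_neq0 yx0)) -scalerA -scalerBr.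
  congr (_ *: _); rewrite (_ : y - x = (y - t) - (x - t)); last by ring.
  rewrite scalerBl; move: ((y - t) *: _) ((x - t) *: _) => p q.
  by rewrite [in RHS]opprD [RHS]addrACA -!opprD [in RHS]opprB [in RHS]addrA [in RHS]subrK.
rewrite E normrZ gtr0_norm ?invr_gt0// ler_pdivrMl//.
apply: le_trans (ler_normB _ _) _.
have h1 : `|y - t| = y - t by rewrite ger0_norm// subr_ge0.
have h2 : `|x - t| = t - x by rewrite distrC ger0_norm// subr_ge0.
have k1 := H y; have k2 := H x; rewrite h1 in k1; rewrite h2 in k2.
have yt : y - t < eta by lra.
have tx : t - x < eta by lra.
apply: le_trans (lerD (k1 yt) (k2 tx)) _; rewrite -mulrDr [leRHS]mulrC.
by rewrite (_ : y - t + (t - x) = y - x)//; ring.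
Qed.

Lemma dq_cvg T u t : 0 < T -> 0 <= t -> t < T -> derivable u t 1 ->
  dq T n u t @[n --> \oo] --> derive1 u t.
Proof.
move=> T0 t0 tT /derivable_straddle du; apply/cvgrPdist_le => e /du[eta eta0 H].
near=> n; rewrite distrC.
have h0 : 0 < T / n.+1%:R by rewrite divr_gt0.
have := cell_index_mem n T0 t0; rewrite /cell/= in_itv/= => /andP[jt tj].
have := H _ _ jt (ltW tj); rewrite -mulrBl -natrB// subSnn mul1r; apply.
  by rewrite ltr_pM2r// ltr_nat.
rewrite ltr_pdivrMr// -ltr_pdivrMl// mulrC.
near: n; exists (Num.bound (T / eta)) => // n /= Tn.
apply: lt_le_trans (archi_boundP _) _; first by rewrite divr_ge0// ltW.
by rewrite ler_nat (leq_trans Tn).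
Unshelve. all: by end_near. Qed.

End difference_quotients.

(** * Jensen's inequality and sums of slopes *)

Section ac_vector_functions.
Context {R : realType} {d : nat}.
Implicit Types (u v : R -> 'rV[R]_d) (T s t : R).

Local Notation mu := (leb R).

Lemma derive1_coord u t i : derivable u t 1 ->
  derive1 u t ord0 i = derive1 (fun s => u s ord0 i) t.
Proof. by move=> du; rewrite !derive1E derive_mx// mxE. Qed.

Lemma ac_ae_derivable T u : 0 < T -> abs_continuous T u ->
  ae_0T T (fun t => derivable u t 1).
Proof.
move=> T0 acu.
have : {ae mu, forall t : R, forall i : 'I_d, t \in `[0, T] -> derivable (fun s => u s ord0 i) t 1}.
  by apply: filter_forall => i; have [] := ac_derivable_leb T0 (ac_fun_coord i acu).
apply: filterS => t H tT; apply/derivable_mxP => i j; rewrite ord1; exact: H.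
Qed.

Lemma ac_derive1_ae_coord T u i : 0 < T -> abs_continuous T u ->
  {ae mu, forall t, `[0, T]%classic t -> derive1 (fun s => u s ord0 i) t = derive1 u t ord0 i}.
Proof.
by move=> T0 /(ac_ae_derivable T0); rewrite /ae_0T; apply: filterS => t H /H /derive1_coord ->.
Qed.

Lemma ac_vmeas_derive1 T u : 0 < T -> abs_continuous T u -> vmeas_0T T (derive1 u).
Proof.
move=> T0 acu i; apply: (lebT_ae_measurable (ac_derive1_ae_coord i T0 acu)).
have [_ /measurable_int/measurable_EFinP//] := ac_derivable_leb T0 (ac_fun_coord i acu).
Qed.

Lemma ac_Lone_derive1 T u i : 0 < T -> abs_continuous T u ->
  Lone T (fun t => derive1 u t ord0 i).
Proof.
move=> T0 acu; have [_ ig _] := ac_derivable_leb T0 (ac_fun_coord i acu).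
have := ac_vmeas_derive1 T0 acu i => mu'.
apply/integrableP; split; first exact/measurable_EFinP.
move/integrableP : ig => [mg]; congr (_ < _)%E; apply: ae_eq_integral.
- exact: itv_lebT.
- exact: measurableT_comp.
- by apply: measurableT_comp => //; exact/measurable_EFinP.
- by apply: filterS (ac_derive1_ae_coord i T0 acu) => t H /H /= ->.
Qed.

Lemma ac_increment T u s t : 0 < T -> abs_continuous T u -> 0 <= s -> s <= t -> t <= T ->
  u t - u s = \row_i Rintegral mu `[s, t]%classic (fun x => derive1 u x ord0 i).
Proof.
move=> T0 acu s0 st tT; apply/rowP => i; rewrite !mxE.
have [_ ig /(_ s t s0 st tT) H] := ac_derivable_leb T0 (ac_fun_coord i acu).
have sub : `[s, t]%classic `<=` `[0, T]%classic by apply: subset_itvScc.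
transitivity (fine (u t ord0 i - u s ord0 i)%:E) => //; rewrite H; congr fine.
apply: ae_eq_integral.
- exact: itv_lebT.
- by apply: measurable_funS (measurable_int _ ig) => //; exact: itv_lebT.
- apply/measurable_EFinP; apply: measurable_funS (ac_vmeas_derive1 T0 acu i) => //.
  exact: itv_lebT.
- by apply: filterS (ac_derive1_ae_coord i T0 acu) => x H' /sub/H' /= ->.
Qed.

Lemma ac_integral_dotp T u s t z : 0 < T -> abs_continuous T u -> 0 <= s -> s <= t -> t <= T ->
  mu.-integrable `[s, t] (fun x => (dotp (derive1 u x) z)%:E) /\
  Rintegral mu `[s, t]%classic (fun x => dotp (derive1 u x) z) = dotp (u t - u s) z.
Proof.
move=> T0 acu s0 st tT; rewrite (ac_increment T0 acu s0 st tT).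
apply: Rintegral_dotp; first exact: itv_lebT.
move=> i; apply: integrableS (ac_Lone_derive1 i T0 acu); try exact: itv_lebT.
by apply: subset_itvScc.
Qed.

(** The affine minorant of [Psi] at the mean slope [p] is integrated over the interval; an infinite
    right-hand side leaves nothing to prove. *)
Lemma Jensen T (Psi : 'rV[R]_d -> R) u s t : 0 < T -> is_Ninfty Psi -> abs_continuous T u ->
  0 <= s -> s < t -> t <= T ->
  (((t - s) * Psi ((t - s)^-1 *: (u t - u s)))%:E <= \int[mu]_(x in `[s, t]) (Psi (derive1 u x))%:E)%E.
Proof.
move=> T0 NPsi acu s0 st tT; set p := _ *: _.
have sub : `[s, t]%classic `<=` `[0, T]%classic by apply: subset_itvScc.
have mI : measurable (`[s, t]%classic : set (lebT R)) by exact: itv_lebT.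
have [zeta Hz] := Ninfty_subgradient NPsi p.
have [id Hd] := ac_integral_dotp zeta T0 acu s0 (ltW st) tT.
have mPsi : measurable_fun (`[s, t]%classic : set (lebT R)) (fun x => Psi (derive1 u x)).
  apply: measurable_funS (vmeas_continuous (ac_vmeas_derive1 T0 acu) (Ninfty_continuous NPsi)) => //.
  exact: itv_lebT.
have mu_st : mu `[s, t]%classic = (t - s)%:E by rewrite leb_itvcc ?ltW.
set c := Psi p - dotp p zeta.
have ic : mu.-integrable `[s, t] (EFin \o cst c).
  apply: measurable_bounded_integrable => //; first by rewrite mu_st ltry.
  by exists `|c|; split; rewrite ?num_real// => M cM x _ /=; rewrite ltW.
have [foo|] := ltP (\int[mu]_(x in `[s, t]) (Psi (derive1 u x))%:E)%E +oo%E; last first.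
  by rewrite leye_eq => /eqP ->; rewrite leey.
have iPsi : mu.-integrable `[s, t] (fun x => (Psi (derive1 u x))%:E).
  apply/integrableP; split; first exact/measurable_EFinP.
  by under eq_integral do rewrite gee0_abs ?lee_fin ?Ninfty_ge0//.
have il : mu.-integrable `[s, t] (fun x => (dotp (derive1 u x) zeta)%:E + (cst c x)%:E)%E.
  exact: integrableD.
have /(le_integral mI il iPsi) : {in `[s, t]%classic, forall x, (dotp (derive1 u x) zeta)%:E + (cst c x)%:E <= (Psi (derive1 u x))%:E}%E.
  move=> x _; rewrite -EFinD lee_fin /c /=; have := Hz (derive1 u x).
  by rewrite dotpBl; lra.
apply: le_trans; rewrite integralD//=.
have -> : (\int[mu]_(x in `[s, t]) (dotp (derive1 u x) zeta)%:E = (dotp (u t - u s) zeta)%:E)%E.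
  by rewrite -Hd /Rintegral fineK//; exact: integrable_fin_num.
rewrite integral_cst// [X in (_ + _ * X)%E]mu_st -EFinM -EFinD lee_fin.
have -> : dotp (u t - u s) zeta = (t - s) * dotp p zeta.
  by rewrite /p dotpZl mulVKf// subr_eq0 gt_eqF.
by rewrite /c; lra.
Qed.

Lemma modular_dq T n (Psi : 'rV[R]_d -> R) u : 0 < T ->
  modular T Psi (dq T n u) = (\sum_(j < n.+1) (T / n.+1%:R) * Psi (slope T n u j))%:E.
Proof.
move=> T0; rewrite /modular (integral_cells n T0); last first.
  exact: (measurable_cell_index n (fun j => Psi (slope T n u j)) T0).
rewrite -sumEFin; apply: eq_bigr => j _; rewrite -(integral_cell_cst n j _ T0).
by apply: eq_integral => t; rewrite inE => /(cellP T0); rewrite /dq => ->.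
Qed.

(* The bound on the increments over disjoint intervals passes to pointwise
   limits, and implies absolute continuity by superlinearity. *)
Definition bounded_slopes T (Psi : 'rV[R]_d -> R) (c : R) u :=
  forall (n : nat) (a b : 'I_n -> R),
    (forall i, [/\ 0 <= a i, a i <= b i & b i <= T]) ->
    trivIset [set: 'I_n] (fun i => `]a i, b i[%classic) ->
    \sum_(i < n) (b i - a i) * Psi ((b i - a i)^-1 *: (u (b i) - u (a i))) <= c.

Lemma modular_bounded_slopes T (Psi : 'rV[R]_d -> R) (c : R) u : 0 < T ->
  is_Ninfty Psi -> abs_continuous T u -> (modular T Psi (derive1 u) <= c%:E)%E ->
  bounded_slopes T Psi c u.
Proof.
move=> T0 NPsi acu uc n a b ab tab; rewrite -lee_fin; apply: le_trans uc.
have mPsi := vmeas_continuous (ac_vmeas_derive1 T0 acu) (Ninfty_continuous NPsi).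
have moo i : measurable (`]a i, b i[%classic : set (lebT R)) by exact: itv_lebT.
pose D := \big[setU/set0]_(i < n) `]a i, b i[%classic.
have sub : D `<=` `[0, T]%classic.
  rewrite /D -bigcup_seq => x [i _] /=; rewrite !in_itv/= => /andP[ax xb].
  by have [a0 _ bT] := ab i; rewrite (le_trans a0 (ltW ax)) (le_trans (ltW xb)).
have mD : measurable (D : set (lebT R)) by apply: bigsetU_measurable.
apply: (@le_trans _ _ (\int[mu]_(x in D) (Psi (derive1 u x))%:E)%E); last first.
  apply: ge0_subset_integral; [exact: mD|exact: itv_lebT|exact/measurable_EFinP| |exact: sub].
  by move=> x _; rewrite lee_fin Ninfty_ge0.
rewrite /D ge0_integral_bigsetU.
- rewrite -sumEFin; apply: lee_sum => i _; have [a0 aibi bT] := ab i.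
  have [abi|abi] := eqVneq (b i) (a i).
    by rewrite abi subrr mul0r integral_ge0// => x _; rewrite lee_fin Ninfty_ge0.
  have {abi} abi : a i < b i by rewrite lt_neqAle eq_sym abi.
  rewrite -integral_itv_oo ?(ltW abi); [exact: (Jensen T0 NPsi acu a0 abi bT)|by []|].
  by apply: measurable_funS mPsi; [exact: itv_lebT|apply: subset_itvScc].
- exact: moo.
- exact: index_enum_uniq.
- by move: tab; apply: sub_trivIset.
- by apply/measurable_EFinP; apply: measurable_funS mPsi => //; exact: itv_lebT.
- by move=> x _; rewrite lee_fin Ninfty_ge0.
Qed.

(** The superlinear bound is applied to each slope and multiplied by the length of its interval. The
    first term then depends on the total length alone, and the second is at most [e * c] for any
    family; absolute continuity and equicontinuity both follow. *)
Lemma bounded_slopes_increment T (Psi : 'rV[R]_d -> R) (c K e : R) u :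
  is_Ninfty Psi -> 0 <= e -> (forall y, enorm y <= K + e * Psi y) ->
  bounded_slopes T Psi c u ->
  forall (n : nat) (a b : 'I_n -> R),
    (forall i, [/\ 0 <= a i, a i <= b i & b i <= T]) ->
    trivIset [set: 'I_n] (fun i => `]a i, b i[%classic) ->
    \sum_(i < n) enorm (u (b i) - u (a i)) <= K * \sum_(i < n) (b i - a i) + e * c.
Proof.
move=> NPsi e0 HK Hu n a b ab tab.
apply: (@le_trans _ _ (\sum_(i < n) (K * (b i - a i) + e * ((b i - a i) * Psi ((b i - a i)^-1 *: (u (b i) - u (a i))))))).
  apply: ler_sum => i _; have [_ aibi _] := ab i.
  have [->|abi] := eqVneq (b i) (a i); first by rewrite !subrr enorm0 mulr0 mul0r mulr0 addr0.
  have p0 : 0 < b i - a i by rewrite subr_gt0 lt_neqAle eq_sym abi.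
  rewrite -[u (b i) - _](scalerKV (lt0r_neq0 p0)) enormZ gtr0_norm//.
  apply: le_trans (ler_wpM2l (ltW p0) (HK _)) _.
  by rewrite scalerK ?lt0r_neq0//; lra.
by rewrite big_split/= -!mulr_sumr lerD2l ler_wpM2l//; exact: Hu.
Qed.

Lemma bounded_slopes_ac T (Psi : 'rV[R]_d -> R) (c : R) u :
  is_Ninfty Psi -> bounded_slopes T Psi c u -> abs_continuous T u.
Proof.
(* Each of the two terms receives half of [e]; [c1] and [K + 1] stand for [c] and [K] as divisors
   because they are positive. *)
move=> NPsi Hu e e0; pose c1 := Num.max c 1.
have c10 : 0 < c1 by rewrite lt_max ltr01 orbT.
have e10 : 0 < e / 2 / c1 by rewrite !divr_gt0.
have [K K0 HK] := Ninfty_superlinear NPsi e10.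
exists (e / 2 / (K + 1)); first by rewrite !divr_gt0// ltr_wpDl.
move=> n a b ab tab lab.
apply: le_lt_trans (bounded_slopes_increment NPsi (ltW e10) HK Hu ab tab) _.
have h1 : e / 2 / c1 * c <= e / 2.
  have e20 : 0 <= e / 2 by lra.
  have cc : c1^-1 * c <= 1 by rewrite ler_pdivrMl// mulr1 le_max lexx.
  by rewrite -mulrA ler_piMr.
have s0 : 0 <= \sum_(i < n) (b i - a i).
  by apply: sumr_ge0 => i _; have [_ h _] := ab i; rewrite subr_ge0.
have h2 : K * \sum_(i < n) (b i - a i) < e / 2.
  apply: (@le_lt_trans _ _ ((K + 1) * \sum_(i < n) (b i - a i))).
    by rewrite ler_wpM2r// lerDl.
  by rewrite -ltr_pdivlMl// ?ltr_wpDl// mulrC.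
by rewrite [ltRHS]splitr; apply: ltr_leD.
Qed.

(** For a fixed family the sum depends continuously on finitely many values of the function. The
    bound is asked for large [n] only, which is what the lower semicontinuity argument can
    supply. *)
Lemma bounded_slopes_lim T (Psi : 'rV[R]_d -> R) (c : R) (w : nat -> R -> 'rV[R]_d) u :
  is_Ninfty Psi -> (forall t, 0 <= t <= T -> w n t @[n --> \oo] --> u t) ->
  (\forall n \near \oo, bounded_slopes T Psi c (w n)) -> bounded_slopes T Psi c u.
Proof.
move=> NPsi wu Hw n a b ab tab.
have cv : (fun k => \sum_(i < n) (b i - a i) * Psi ((b i - a i)^-1 *: (w k (b i) - w k (a i)))) @ \oo
   --> \sum_(i < n) (b i - a i) * Psi ((b i - a i)^-1 *: (u (b i) - u (a i))).
  apply: (cvg_big (U := R)) => [|i _]; first exact: add_continuous.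
  apply: cvgMr; apply: continuous_cvg; first exact: Ninfty_continuous.
  have [a0 aibi bT] := ab i.
  apply: cvgZr; apply: cvgB; apply: wu.
    by rewrite bT (le_trans a0).
  by rewrite a0 (le_trans aibi).
by apply: (cvgr_to_le cv); apply: filterS Hw => k; exact.
Qed.

Lemma bounded_slopes_modular_dq T n (Psi : 'rV[R]_d -> R) (c : R) u : 0 < T ->
  bounded_slopes T Psi c u -> (modular T Psi (dq T n u) <= c%:E)%E.
Proof.
move=> T0 Hu; rewrite modular_dq// lee_fin.
have := Hu n.+1 (fun j : 'I_n.+1 => j%:R * (T / n.+1%:R)) (fun j : 'I_n.+1 => j.+1%:R * (T / n.+1%:R)).
have E (j : 'I_n.+1) : j.+1%:R * (T / n.+1%:R) - j%:R * (T / n.+1%:R) = T / n.+1%:R.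
  by rewrite -mulrBl -natrB// subSnn mul1r.
under eq_bigr do rewrite E.
apply.
  by move=> j; have [b1 b2 b3] := cell_bound T0 (ltn_ord j); split => //; exact: ltW.
apply/trivIsetP => i j _ _ ij; apply/seteqP; split => // t [] h1 h2; exfalso.
have sub (k : 'I_n.+1) : `]k%:R * (T / n.+1%:R), k.+1%:R * (T / n.+1%:R)[%classic `<=` cell T n k.
  exact: subset_itv_oo_co.
by move/eqP : ij; apply; apply: val_inj => /=; have := cellP T0 (sub _ _ h1); rewrite (cellP T0 (sub _ _ h2)).
Qed.

Lemma bounded_slopes_modular T (Psi : 'rV[R]_d -> R) (c : R) u : 0 < T ->
  is_Ninfty Psi -> bounded_slopes T Psi c u -> (modular T Psi (derive1 u) <= c%:E)%E.
Proof.
move=> T0 NPsi Hu; have acu := bounded_slopes_ac NPsi Hu.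
have mI : measurable (`[0, T]%classic : set (lebT R)) by exact: itv_lebT.
have mdq n : measurable_fun (`[0, T]%classic : set (lebT R)) (fun t => (Psi (dq T n u t))%:E).
  exact: (measurable_cell_index n (fun j => (Psi (slope T n u j))%:E) T0).
have mPsi := vmeas_continuous (ac_vmeas_derive1 T0 acu) (Ninfty_continuous NPsi).
have aedq : {ae mu, forall t, t \in `[0, T] -> (Psi (dq T n u t))%:E @[n --> \oo] --> (Psi (derive1 u t))%:E}.
  apply: ae_itvoo_cc; have := ac_ae_derivable T0 acu; rewrite /ae_0T.
  apply: filterS => t H /andP[t0 tT].
  have dut : derivable u t 1 by apply: H; rewrite in_itv/= !ltW.
  apply: cvg_EFin; first by near=> n.
  apply: continuous_cvg; first exact: Ninfty_continuous.
  by apply: dq_cvg => //; exact: ltW.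
apply: (@le_trans _ _ (\int[mu]_(t in `[0%R, T]) limn_einf (fun n => (Psi (dq T n u t))%:E))%E).
  rewrite /modular; apply: ae_ge0_le_integral.
  - exact: mI.
  - by move=> x _; rewrite lee_fin Ninfty_ge0.
  - exact/measurable_EFinP.
  - by move=> x _; rewrite limn_einf_lim; apply: lime_ge; [exact: is_cvg_einfs|];
      apply: nearW => n; apply: le_ereal_inf_tmp => _ [m _ <-]; rewrite lee_fin Ninfty_ge0.
  - apply: (measurableT_comp (@oppe_measurable R setT)); apply: measurable_fun_limn_esup => n.
    exact: (measurableT_comp (@oppe_measurable R setT) (mdq n)).
  - by apply: filterS aedq => t H tT; have [-> _] := cvg_limn_einf_sup (H tT).
apply: le_trans (fatou _ _ _ _) _ => //.
  by move=> n x _; rewrite lee_fin Ninfty_ge0.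
rewrite limn_einf_lim; apply: lime_le; first exact: is_cvg_einfs.
apply: nearW => n; apply: (@le_trans _ _ (modular T Psi (dq T n u))).
  by apply: ereal_inf_lbound; exists n => /=.
exact: bounded_slopes_modular_dq.
Unshelve. all: by end_near. Qed.

End ac_vector_functions.

(** * The potential and coercivity *)

Section bounded_sets.
Context {R : realType} {d : nat}.
Implicit Types (x y : 'rV[R]_d) (u : R -> 'rV[R]_d) (T : R).

Lemma compact_coord_box (r : R) : compact [set x : 'rV[R]_d | forall i, x ord0 i \in `[- r, r]].
Proof.
apply: (@rV_compact _ _ (fun=> `[- r, r]%classic)) => _; exact: segment_compact.
Qed.

Lemma continuous_enorm_bounded (f : 'rV[R]_d -> R) (r : R) : continuous f ->
  exists2 C : R, 0 <= C & forall x, enorm x <= r -> `|f x| <= C.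
Proof.
move=> cf.
have cK := @continuous_compact _ _ f _ (continuous_subspaceT cf) (@compact_coord_box r).
have [M [_ HM]] := compact_bounded cK.
exists (`|M| + 1) => [|x xr]; first by rewrite addr_ge0.
apply: (HM (`|M| + 1)); first by rewrite (le_lt_trans (ler_norm _))// ltrDl.
exists x => // i; rewrite in_itv/= -ler_norml.
by apply: le_trans xr; exact: coord_le_enorm.
Qed.

(** Each coordinate departs from its value at 0 by at most its total variation, which is finite. *)
Lemma ac_bounded T u : 0 < T -> abs_continuous T u ->
  exists2 r : R, 0 <= r & forall t, 0 <= t <= T -> enorm (u t) <= r.
Proof.
move=> T0 acu.
pose c i := fine (total_variation 0 T (fun t => u t ord0 i)).
have Hc i t : 0 <= t <= T -> `|u t ord0 i - u 0 ord0 i| <= c i.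
  move=> /andP[t0 tT]; have := ac_fun_tv_fin T0 (ac_fun_coord i acu).
  rewrite /c (total_variationD _ t0 tT) fin_numD => /andP[f1 f2].
  rewrite fineD// -[leLHS]addr0 lerD// ?fine_ge0 ?total_variation_ge0//.
  by rewrite -lee_fin fineK// total_variation_ge.
exists (\sum_(i < d) (`|u 0 ord0 i| + `|c i|)); first by apply: sumr_ge0 => i _; rewrite addr_ge0.
move=> t tT; apply: le_trans (enorm_le_sum_coord _) _; apply: ler_sum => i _.
have -> : u t ord0 i = u 0 ord0 i + (u t ord0 i - u 0 ord0 i) by ring.
apply: le_trans (ler_normD _ _) _; rewrite lerD2l.
by apply: le_trans (Hc i t tT) _; exact: ler_norm.
Qed.

Lemma ac_modulus T u : abs_continuous T u -> forall e : R, 0 < e ->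
  exists2 eta : R, 0 < eta & forall s t, 0 <= s -> s <= t -> t <= T -> t - s < eta ->
    enorm (u t - u s) < e.
Proof.
move=> acu e /acu[eta eta0 H]; exists eta => // s t s0 st tT ts.
have := H 1%N (fun=> s) (fun=> t); rewrite !big_ord_recl !big_ord0 !addr0; apply => //.
by apply/trivIsetP => i j _ _; rewrite !ord1 eqxx.
Qed.

End bounded_sets.

(** * The potential along a curve and along a segment *)

Section potential.
Context {R : realType} {d : nat}.
Implicit Types (x y : 'rV[R]_d) (u : R -> 'rV[R]_d) (T : R) (F : R -> 'rV[R]_d -> R).

Local Notation mu := (leb R).

Lemma ac_cell_left_cvg T u t : 0 < T -> abs_continuous T u -> 0 <= t -> t <= T ->
  u ((cell_index T n t)%:R * (T / n.+1%:R)) @[n --> \oo] --> u t.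
Proof.
move=> T0 acu t0 tT; apply/cvgrPdist_le => e e0.
have [eta eta0 H] := ac_modulus acu e0.
have := cell_left_cvg T0 t0 => /cvgrPdist_lt/(_ _ eta0); apply: filterS => n.
have := cell_index_mem n T0 t0; rewrite /cell/= in_itv/= => /andP[jt _].
rewrite ger0_norm ?subr_ge0// => /(H _ _ _ jt tT) h; apply: le_trans (norm_le_enorm _) _.
by apply/ltW/h; rewrite mulr_ge0// divr_ge0// ltW.
Qed.

(** With [u] frozen at the left end of each cell the composite is measurable cell by cell; as the
    mesh is refined it converges wherever [F t] is continuous. The upper limit is measurable
    everywhere, and completeness allows for the exceptional null set. *)
Lemma caratheodory_measurable T F u : 0 < T -> caratheodory_fun T F -> abs_continuous T u ->
  meas_0T T (fun t => F t (u t)).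
Proof.
move=> T0 [mF cF] acu.
pose f n t := F t (u ((cell_index T n t)%:R * (T / n.+1%:R))).
have mf n : meas_0T T (f n).
  apply: (@measurable_cell_index_fun R T n _ _ (fun j t => F t (u (j%:R * (T / n.+1%:R)))) T0) => j.
  exact: mF.
have aef : {ae mu, forall t, `[0, T]%classic t -> limn_esup (fun n => (f n t)%:E) = (F t (u t))%:E}.
  move: cF; rewrite /ae_0T; apply: filterS => t H tT.
  have : (f n t)%:E @[n --> \oo] --> (F t (u t))%:E.
    apply: cvg_EFin; first by near=> n.
    apply: continuous_cvg; first exact: H.
    by move: tT; rewrite /= in_itv/= => /andP[t0 tT]; exact: ac_cell_left_cvg.
  by move=> /cvg_limn_einf_sup[].
apply/measurable_EFinP.
apply: (ae_measurable_fun (@completed_lebesgue_measure_is_complete R) aef).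
by apply: measurable_fun_limn_esup => n; apply/measurable_EFinP; exact: mf.
Unshelve. all: by end_near. Qed.

Lemma ae_le_Lone T (f b : R -> R) (A : R) : meas_0T T f -> Lone T b ->
  ae_0T T (fun t => `|f t| <= A * b t) -> Lone T f.
Proof.
move=> mf ib fb.
have iAb : mu.-integrable `[0, T] (fun t => (A%:E * (b t)%:E)%E).
  by apply: integrableZl => //; exact: itv_lebT.
have := integrable_abse iAb => /integrableP[mAb Aboo].
apply/integrableP; split; first exact/measurable_EFinP.
apply: le_lt_trans Aboo; apply: ae_ge0_le_integral.
- exact: itv_lebT.
- by move=> t _; exact: abse_ge0.
- by apply: (measurableT_comp (@abse_measurable R setT)); exact/measurable_EFinP.
- by move=> t _; exact: abse_ge0.
- exact: (measurableT_comp (@abse_measurable R setT) mAb).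
- move: fb; rewrite /ae_0T; apply: filterS => t H tT /=.
  by rewrite !lee_fin normr_id (le_trans (H tT))// ler_norm.
Qed.

Lemma potential_Lone T F (a : 'rV[R]_d -> R) (b : R -> R) u (A : R) : 0 < T ->
  caratheodory_fun T F -> Lone T b -> ae_0T T (fun t => 0 <= b t) ->
  ae_0T T (fun t => forall x, `|F t x| <= a x * b t) ->
  abs_continuous T u -> (forall t, 0 <= t <= T -> a (u t) <= A) ->
  Lone T (fun t => F t (u t)).
Proof.
move=> T0 cF ib b0 Fab acu aA.
apply: (ae_le_Lone (A := A) _ ib); first exact: caratheodory_measurable.
move: b0 Fab; rewrite /ae_0T; apply: filterS2 => t b0 H tT.
apply: le_trans (H tT (u t)) _; apply: ler_wpM2r; first exact: b0.
by apply: aA; move: tT; rewrite in_itv.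
Qed.

(** The case to settle is an infinite modular. The negative part of the integrand is at most |F|,
    hence has a finite integral; if the positive part had one too, the modular would be finite,
    because [Phi] is at most that part plus |F|. *)
Lemma action_decomp T F (Phi : 'rV[R]_d -> R) u : 0 < T -> is_Ninfty Phi -> abs_continuous T u ->
  Lone T (fun t => F t (u t)) ->
  action T Phi F u = (modular T Phi (derive1 u) + (Rintegral mu `[0, T]%classic (fun t => F t (u t)))%:E)%E.
Proof.
move=> T0 NPhi acu iF; rewrite /action /modular.
have mPhi := vmeas_continuous (ac_vmeas_derive1 T0 acu) (Ninfty_continuous NPhi).
have mI : measurable (`[0, T]%classic : set (lebT R)) by exact: itv_lebT.
have FE : ((Rintegral mu `[0, T]%classic (fun t => F t (u t)))%:E =
    \int[mu]_(t in `[0%R, T]) (F t (u t))%:E)%E.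
  by rewrite /Rintegral fineK//; exact: integrable_fin_num.
have [foo|] := ltP (\int[mu]_(t in `[0%R, T]) (Phi (derive1 u t))%:E)%E +oo%E.
  have iPhi : mu.-integrable `[0, T] (fun t => (Phi (derive1 u t))%:E).
    apply/integrableP; split; first exact/measurable_EFinP.
    by under eq_integral do rewrite gee0_abs ?lee_fin ?Ninfty_ge0//.
  by under eq_integral do rewrite EFinD; rewrite integralD// FE.
rewrite leye_eq => /eqP Phioo; rewrite Phioo addye//.
have [mF absFoo] := integrableP _ _ _ iF.
pose f t := (Phi (derive1 u t) + F t (u t))%:E.
have mf : measurable_fun (`[0, T]%classic : set (lebT R)) f.
  by apply/measurable_EFinP; apply: measurable_funD; [exact: mPhi|exact/measurable_EFinP].
have mabsF : measurable_fun (`[0, T]%classic : set (lebT R)) (fun t => `|(F t (u t))%:E|%E).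
  exact: (measurableT_comp (@abse_measurable R setT) mF).
have fneg : (\int[mu]_(t in `[0%R, T]) f^\- t < +oo)%E.
  apply: le_lt_trans absFoo; apply: ge0_le_integral.
  - exact: mI.
  - by move=> t _; exact: funeneg_ge0.
  - exact: measurable_funeneg.
  - exact: mabsF.
  - move=> t _; rewrite funenegE /f -EFinN -EFin_max lee_fin ge_max normr_ge0 andbT.
    have := Ninfty_ge0 NPhi (derive1 u t); have := ler_norm (- F t (u t)).
    by rewrite normrN; lra.
have fpos : (\int[mu]_(t in `[0%R, T]) f^\+ t = +oo)%E.
  apply/eqP; rewrite -leye_eq -Phioo leNgt; apply/negP => fposlt.
  suff : (\int[mu]_(t in `[0%R, T]) (Phi (derive1 u t))%:E < +oo)%E by rewrite Phioo ltxx.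
  apply: (@le_lt_trans _ _ (\int[mu]_(t in `[0%R, T]) (f^\+ t + `|(F t (u t))%:E|))%E).
    apply: ge0_le_integral.
    - exact: mI.
    - by move=> t _; rewrite lee_fin Ninfty_ge0.
    - exact/measurable_EFinP.
    - by apply: emeasurable_funD; [exact: measurable_funepos|exact: mabsF].
    - move=> t _; rewrite funeposE /f -EFin_max -EFinD lee_fin.
      have h1 : Phi (derive1 u t) + F t (u t) <= Num.max (Phi (derive1 u t) + F t (u t)) 0.
        by rewrite le_max lexx.
      by have := ler_norm (- F t (u t)); rewrite normrN; lra.
  rewrite ge0_integralD.
  - by apply: lte_add_pinfty; [rewrite -Phioo|exact: absFoo].
  - exact: mI.
  - by move=> t _; exact: funepos_ge0.
  - exact: measurable_funepos.
  - by move=> t _; exact: abse_ge0.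
  - exact: mabsF.
rewrite -[LHS]/(\int[mu]_(t in `[0%R, T]) f t)%E integralE fpos addye// eqe_oppLR/= .
by rewrite lt_eqF.
Qed.

Lemma mean_value_line (G : 'rV[R]_d -> R) x y : (forall z, differentiable G z) ->
  exists2 s : R, 0 <= s <= 1 & G (x + y) - G x = dotp y (grad G (x + s *: y)).
Proof.
move=> dG.
have dg (s : R) : is_derive s 1 (fun s : R => G (x + s *: y)) (dotp y (grad G (x + s *: y))).
  by apply: is_derive_line; exact: dG.
have cg : {within `[0, 1], continuous (fun s : R => G (x + s *: y))}.
  apply: continuous_subspaceT => s; apply: differentiable_continuous.
  by apply/derivable1_diffP; case: (dg s).
have [s] := @MVT_segment R (fun s : R => G (x + s *: y)) (fun s => dotp y (grad G (x + s *: y))) 0 1 ler01 (fun s _ => dg s) cg.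
rewrite in_itv/= scale1r scale0r addr0 subr0 mulr1 => s01 H; by exists s.
Qed.

(** Here [y] stands for [u t - u 0], [delta] for its value at [t], and [m] for the modular. Young's
    inequality is applied to [y / (lam T)] and the gradient divided by [delta]: the factor [T]
    matches the pointwise bound on [Phi (y / T)], and [lam] the contraction of [Phi]. *)
Lemma potential_lower_bound (Phi Phi0 G : 'rV[R]_d -> R) (T delta lam e D k C m : R) x0 y :
  is_Ninfty Phi -> is_Ninfty Phi0 -> 0 < T -> 0 < delta -> 0 < lam -> 0 <= e ->
  (forall z, differentiable G z) ->
  (forall z, conjugate Phi (delta^-1 *: grad G z) <= Phi0 z + 1) ->
  (forall z, lam * Phi (lam^-1 *: z) <= e * Phi z + D) ->
  0 < k -> 2 * k * T <= 1 -> (forall z, Phi0 z <= C + Phi (k *: z)) ->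
  Phi (T^-1 *: y) <= m / T ->
  G x0 - delta * (lam * T * (2^-1 * Phi0 (2 *: x0) + 2^-1 * (C + 2 * k * m) + 1) + (e * m + T * D))
    <= G (x0 + y).
Proof.
move=> NPhi NPhi0 T0 delta0 lam0 e0 dG HG Hlam k0 kT Hk Hy.
have [s s01 Hs] := mean_value_line x0 y dG.
set z := x0 + s *: y in Hs.
have lT0 : 0 < lam * T by rewrite mulr_gt0.
have E : dotp y (grad G z) = delta * (lam * T) * dotp ((lam * T)^-1 *: y) (delta^-1 *: grad G z).
  by rewrite dotpZl dotpZr; field; rewrite !gt_eqF.
have h1 : - (Phi ((lam * T)^-1 *: y) + (Phi0 z + 1)) <= dotp ((lam * T)^-1 *: y) (delta^-1 *: grad G z).
  have := norm_Young NPhi ((lam * T)^-1 *: y) (delta^-1 *: grad G z); rewrite ler_norml => /andP[h _].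
  by apply: le_trans h; rewrite lerN2 lerD2l; exact: HG.
have h2 : lam * T * Phi ((lam * T)^-1 *: y) <= e * m + T * D.
  have := Hlam (T^-1 *: y); rewrite scalerA -invfM => h.
  rewrite mulrAC mulrC; apply: le_trans (ler_wpM2l (ltW T0) h) _.
  rewrite mulrDr lerD2r mulrCA ler_wpM2l//.
  by rewrite mulrC -ler_pdivlMr.
have h3 : Phi0 z <= 2^-1 * Phi0 (2 *: x0) + 2^-1 * (C + 2 * k * m).
  apply: le_trans (Ninfty_half NPhi0 _ _) _; rewrite lerD2l ler_wpM2l ?invr_ge0//.
  rewrite scalerA mulrC -scalerA; apply: le_trans (Ninfty_scale NPhi0 _ s01) _.
  have /andP[s0 s1] := s01.
  apply: (@le_trans _ _ (Phi0 (2 *: y))); first by rewrite ler_piMl// Ninfty_ge0.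
  apply: le_trans (Hk _) _; rewrite lerD2l.
  (* As [2 k T <= 1], convexity brings [Phi (k (2 y))] below [2 k T Phi (y / T)], hence below
     [2 k m]. *)
  have -> : k *: (2 *: y) = (2 * k * T) *: (T^-1 *: y).
    by rewrite !scalerA mulfK ?gt_eqF// mulrC.
  have kT01 : 0 <= 2 * k * T <= 1 by rewrite kT andbT !mulr_ge0// ltW.
  apply: le_trans (Ninfty_scale NPhi _ kT01) _.
  have /andP[kT0 _] := kT01.
  apply: le_trans (ler_wpM2l kT0 Hy) _.
  have -> : 2 * k * T * (m / T) = 2 * k * m by field; rewrite gt_eqF.
  by [].
have : delta * (lam * T) * - (Phi ((lam * T)^-1 *: y) + (Phi0 z + 1)) <= G (x0 + y) - G x0.
  by rewrite Hs E ler_pM2l// mulr_gt0.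
have h4 := ler_wpM2l (ltW lT0) h3.
have := ler_wpM2l (ltW delta0) (lerD h2 h4).
lra.
Qed.

End potential.

(** * Coercivity of the functional *)

Section coercivity.
Context {R : realType} {d : nat}.
Implicit Types (x y : 'rV[R]_d) (u : R -> 'rV[R]_d) (T : R) (F : R -> 'rV[R]_d -> R).

Local Notation mu := (leb R).

Lemma ae_le_Rintegral T (f g : R -> R) : Lone T f -> Lone T g ->
  ae_0T T (fun t => f t <= g t) ->
  Rintegral mu `[0, T]%classic f <= Rintegral mu `[0, T]%classic g.
Proof.
move=> iF ig fg.
have mI : measurable (`[0, T]%classic : set (lebT R)) by exact: itv_lebT.
have mf : meas_0T T f by apply/measurable_EFinP; exact: measurable_int iF.
have mg : meas_0T T g by apply/measurable_EFinP; exact: measurable_int ig.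
(* The minimum equals [f] almost everywhere and is below [g] everywhere, so the pointwise comparison
   of integrals applies to it. *)
pose h t := Num.min (f t) (g t).
have mh : meas_0T T h by exact: measurable_minr.
have hf : {ae mu, forall t, `[0, T]%classic t -> (f t)%:E = (h t)%:E}.
  by move: fg; rewrite /ae_0T; apply: filterS => t H tT; rewrite /h min_l// H.
have ih : Lone T h.
  apply/integrableP; split; first exact/measurable_EFinP.
  have [_] := integrableP _ _ _ iF; congr (_ < _)%E; apply: ae_eq_integral.
  - exact: mI.
  - by apply: (measurableT_comp (@abse_measurable R setT)); exact/measurable_EFinP.
  - by apply: (measurableT_comp (@abse_measurable R setT)); exact/measurable_EFinP.
  - by apply: filterS hf => t H tT /=; have [->] := H tT.
have -> : Rintegral mu `[0, T]%classic f = Rintegral mu `[0, T]%classic h.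
  by congr fine; apply: ae_eq_integral; [exact: mI|exact/measurable_EFinP..|exact: hf].
by apply: le_Rintegral => // t _; rewrite /h ge_min lexx orbT.
Qed.

Lemma abs_continuous_cst T x : abs_continuous T (cst x).
Proof.
move=> e e0; exists 1 => // n a b _ _ _.
by rewrite big1// => i _; rewrite subrr enorm0.
Qed.

Lemma LoneZ T (c : R) (f : R -> R) : Lone T f -> Lone T (fun t => c * f t).
Proof.
by move=> iF; have := integrableZl (itv_lebT `[0, T]) c iF.
Qed.

Lemma LoneB T (f g : R -> R) : Lone T f -> Lone T g -> Lone T (fun t => f t - g t).
Proof.
by move=> iF ig; have := integrableB (itv_lebT `[0, T]) iF ig.
Qed.

Section fixed_potential.
Context {T : R} {F : R -> 'rV[R]_d -> R} {a : 'rV[R]_d -> R} {b : R -> R}.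
Hypothesis T0 : 0 < T.
Hypothesis cF : caratheodory_fun T F.
Hypothesis ca : continuous a.
Hypothesis a0 : forall x, 0 <= a x.
Hypothesis ib : Lone T b.
Hypothesis b0 : ae_0T T (fun t => 0 <= b t).
Hypothesis Fab : ae_0T T (fun t => forall x, `|F t x| <= a x * b t).

Lemma ac_potential_Lone u : abs_continuous T u -> Lone T (fun t => F t (u t)).
Proof.
move=> acu; have [r r0 Hr] := ac_bounded T0 acu.
have [A A0 HA] := continuous_enorm_bounded r ca.
apply: (potential_Lone (A := A) T0 cF ib b0 Fab acu) => t tT.
by apply: le_trans (ler_norm _) _; apply: HA; exact: Hr.
Qed.

Lemma potential_dominated_bounded (A : R) : 0 <= A -> exists B : R, forall x, enorm x <= A ->
  - B <= Rintegral mu `[0, T]%classic (fun t => F t x).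
Proof.
move=> A0; have [C C0 HC] := continuous_enorm_bounded A ca.
exists (C * Rintegral mu `[0, T]%classic b) => x /HC; rewrite ger0_norm// => axC.
have mI := @itv_lebT R `[0, T].
rewrite -mulNr -RintegralZl//.
apply: ae_le_Rintegral.
- exact: LoneZ.
- exact: ac_potential_Lone (abs_continuous_cst T x).
- move: b0 Fab; rewrite /ae_0T; apply: filterS2 => t b0' H tT.
  have := H tT x; rewrite ler_norml => /andP[h _]; apply: le_trans h.
  by rewrite mulNr lerN2 ler_wpM2r// b0'.
Qed.

Lemma potential_mean_coercive (Phi0 : 'rV[R]_d -> R) (A : R) : is_Ninfty Phi0 ->
  cvg_infty_pinfty (fun x =>
    Rintegral mu `[0, T]%classic (fun t => F t x) / Phi0 (2 *: x)) -> 0 <= A ->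
  exists B : R, forall x,
    A * Phi0 (2 *: x) - B <= Rintegral mu `[0, T]%classic (fun t => F t x).
Proof.
move=> NPhi0 /(_ A)[r Hr] A0.
have r0 : 0 <= Num.max r 0 by rewrite le_max lexx orbT.
have [B HB] := potential_dominated_bounded r0.
have [C C0 HC] := continuous_enorm_bounded (2 * Num.max r 0) (Ninfty_continuous NPhi0).
(* The term |B| makes the constant nonnegative whatever the sign of [B], as needed outside the ball,
   where the limit (iv) acts. *)
exists (B + A * C + `|B|) => x.
have [xr|xr] := leP (enorm x) (Num.max r 0).
  have : Phi0 (2 *: x) <= C.
    apply: le_trans (ler_norm _) _; apply: HC.
    by rewrite enormZ ger0_norm// ler_wpM2l.
  by move=> /(ler_wpM2l A0); have := HB _ xr; have := normr_ge0 B; lra.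
move: xr; rewrite gt_max => /andP[/Hr h x0].
have x20 : 0 < Phi0 (2 *: x).
  case: NPhi0 => _ _ [_ +] _ _; apply; rewrite scaler_eq0 pnatr_eq0/=.
  by apply/eqP => x00; move: x0; rewrite x00 enorm0 ltxx.
move: h; rewrite ltr_pdivlMr// => /ltW h.
have := ler_norm (- B); rewrite normrN => B1.
have AC : 0 <= A * C by rewrite mulr_ge0.
lra.
Qed.

Lemma coercive (Phi Phi0 : 'rV[R]_d -> R) (delta : R -> R) :
  is_Ninfty Phi -> Delta2 (conjugate Phi) ->
  ae_0T T (fun t => forall x, differentiable (F t) x) ->
  is_Ninfty Phi0 ->
  (forall k : R, 0 < k ->
    exists2 C : R, 0 < C & forall x, Phi0 x <= C + Phi (k *: x)) ->
  Lone T delta -> ae_0T T (fun t => 1 <= delta t) ->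
  ae_0T T (fun t => forall x,
    conjugate Phi ((delta t)^-1 *: grad (F t) x) <= Phi0 x + 1) ->
  cvg_infty_pinfty (fun x =>
    Rintegral mu `[0, T]%classic (fun t => F t x) / Phi0 (2 *: x)) ->
  exists B : R, forall u (m : R), abs_continuous T u ->
    modular T Phi (derive1 u) = m%:E ->
    m / 2 + Phi0 (2 *: u 0) - B <= m + Rintegral mu `[0, T]%classic (fun t => F t (u t)).
Proof.
move=> NPhi D2 dF NPhi0 growth idelta delta1 cdelta cinf.
set L := Rintegral mu `[0, T]%classic delta.
pose L1 := `|L| + 1.
have L10 : 0 < L1 by rewrite /L1 ltr_wpDl.
have LL1 : L <= L1 by rewrite /L1 (le_trans (ler_norm _))// lerDl.
(* This coefficient, once multiplied by the integral of [delta], costs at most [m / 4]. *)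
have e0 : 0 < (4 * L1)^-1 by rewrite invr_gt0 mulr_gt0.
have [lam lam0 [D D0 HD]] := Delta2_conjugate_contract NPhi D2 e0.
have lL0 : 0 < 4 * (lam * L1 * T) by rewrite !mulr_gt0.
(* The first entry gives [2 k T <= 1]; the second keeps the share of [m] coming from [Phi0] of the
   increment, which is [lam T L1 k m], below the other [m / 4]. *)
pose k := Num.min (2 * T)^-1 (4 * (lam * L1 * T))^-1.
have k0 : 0 < k by rewrite lt_min !invr_gt0 lL0 mulr_gt0.
have kT : 2 * k * T <= 1.
  have : k <= (2 * T)^-1 by rewrite ge_min lexx.
  by rewrite -div1r ler_pdivlMr ?mulr_gt0//; lra.
have kL : k * (4 * (lam * L1 * T)) <= 1.
  by rewrite -ler_pdivlMr// div1r ge_min lexx orbT.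
have [C C0 HC] := growth k k0.
(* The estimate loses [L1 lam T / 2] times [Phi0 (2 u 0)]; the added 1 leaves one copy of it in the
   conclusion. *)
pose A := L1 * (lam * T) / 2 + 1.
have lT0 : 0 < lam * T by rewrite mulr_gt0.
have A0 : 0 <= A by rewrite /A addr_ge0// divr_ge0// mulr_ge0// ltW.
have [B HB] := potential_mean_coercive NPhi0 cinf A0.
exists (B + L1 * (lam * T * (2^-1 * C + 1) + T * D)) => u m acu um.
have m0 : 0 <= m.
  by rewrite -lee_fin -um integral_ge0// => t _; rewrite lee_fin Ninfty_ge0.
set Q := lam * T * (2^-1 * Phi0 (2 *: u 0) + 2^-1 * (C + 2 * k * m) + 1) + ((4 * L1)^-1 * m + T * D).
have Q0 : 0 <= Q.
  rewrite /Q; have := Ninfty_ge0 NPhi0 (2 *: u 0) => P0.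
  by rewrite !(addr_ge0, mulr_ge0)// ?invr_ge0 ?mulr_ge0// ltW.
have key : ae_0T T (fun t => F t (u 0) - Q * delta t <= F t (u t)).
  move: dF delta1 cdelta; rewrite /ae_0T; apply: filterS3 => t H1 H2 H3 tT.
  have d0 : 0 < delta t by rewrite (lt_le_trans ltr01)// H2.
  rewrite [Q * _]mulrC -[u t](subrKC (u 0)).
  apply: (@potential_lower_bound _ _ Phi Phi0 (F t)) => //; [by rewrite ltW|exact: H1|exact: H3|].
  have /andP[t0 tT'] : 0 <= t <= T by move: tT; rewrite in_itv.
  have [->|tn0] := eqVneq t 0; first by rewrite subrr scaler0 Ninfty0// divr_ge0// ltW.
  have {tn0} t0' : 0 < t by rewrite lt_neqAle eq_sym tn0.
  have J := Jensen T0 NPhi acu (lexx 0) t0' tT'.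
  rewrite subr0 in J.
  have J' : t * Phi (t^-1 *: (u t - u 0)) <= m.
    rewrite -lee_fin -um; apply: le_trans J _.
    apply: ge0_subset_integral; [exact: itv_lebT|exact: itv_lebT| | |].
    - by apply/measurable_EFinP; exact: (vmeas_continuous (ac_vmeas_derive1 T0 acu) (Ninfty_continuous NPhi)).
    - by move=> x _; rewrite lee_fin Ninfty_ge0.
    - by apply: subset_itvScc.
  have tT1 : 0 <= t / T <= 1 by rewrite divr_ge0 ?(ltW T0)//= ler_pdivrMr// mul1r.
  rewrite ler_pdivlMr//.
  (* Convexity replaces division by [t] with division by the fixed length [T], which makes the bound
     uniform in [t]. *)
  have -> : T^-1 *: (u t - u 0) = (t / T) *: (t^-1 *: (u t - u 0)).
    by rewrite scalerA mulrAC divff ?gt_eqF// mul1r.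
  apply: le_trans J'; apply: le_trans (ler_wpM2r (ltW T0) (Ninfty_scale NPhi _ tT1)) _.
  by rewrite mulrAC divfK// gt_eqF.
have iF0 := ac_potential_Lone (abs_continuous_cst T (u 0)).
have := ae_le_Rintegral (LoneB iF0 (LoneZ Q idelta)) (ac_potential_Lone acu) key.
have mI := @itv_lebT R `[0, T].
rewrite RintegralB//; last exact: LoneZ.
rewrite RintegralZl// -/L.
have QL : Q * L <= Q * L1 by rewrite ler_wpM2l.
have QE : Q * L1 = (A - 1) * Phi0 (2 *: u 0) + (k * (4 * (lam * L1 * T))) / 4 * m + m / 4 +
    L1 * (lam * T * (2^-1 * C + 1) + T * D).
  by rewrite /Q /A; field; rewrite gt_eqF.
have kLm : (k * (4 * (lam * L1 * T))) / 4 * m <= m / 4.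
  rewrite mulrAC ler_pM2r ?invr_gt0// ler_piMl//.
have := HB (u 0).
move: QE; set X := Q * L1; set Y := L1 * (lam * T * (2^-1 * C + 1) + T * D).
set Z := k * (4 * (lam * L1 * T)) / 4 * m in kLm *.
set P := Phi0 (2 *: u 0); set J := Rintegral _ _ _ => QE h1 h2.
rewrite -/X in QL. rewrite mulrBl mul1r in QE. lra.
Qed.

End fixed_potential.

End coercivity.

(** * Compactness and weak convergence *)

Section compactness.
Context {R : realType} {d : nat}.
Implicit Types (u : R -> 'rV[R]_d) (T : R) (w : nat -> R -> 'rV[R]_d).

(** Tychonoff's theorem yields a cluster point for pointwise convergence. The product is
    uncountable, so no subsequence is claimed, only approximation on finite sets at arbitrarily
    large indices. *)
Lemma pointwise_cluster (r : R) w : (forall n t i, `|w n t ord0 i| <= r) ->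
  exists u : R -> 'rV[R]_d, forall (s : seq R) (e : R) (k : nat), 0 < e ->
    exists2 n, (k <= n)%N & forall t, t \in s -> `|w n t - u t| < e.
Proof.
move=> wr.
have cK : @compact (prod_topology (fun _ : R => 'rV[R]_d))
    [set f | forall t, [set x : 'rV[R]_d | forall i, x ord0 i \in `[- r, r]] (f t)].
  exact: (@tychonoff R (fun=> 'rV[R]_d) (fun=> [set x : 'rV[R]_d | forall i, x ord0 i \in `[- r, r]]) (fun=> @compact_coord_box R d r)).
have [|u [_ clu]] := cK (w n @[n --> \oo]) _.
  by exists 0%N => // n _ t i; rewrite /= in_itv/= -ler_norml; exact: wr.
exists u => s e k e0.
have nu : @nbhs _ (prod_topology (fun _ : R => 'rV[R]_d)) u
    [set f | forall t, t \in s -> `|f t - u t| < e].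
  have Fu := @nbhs_filter (prod_topology (fun _ : R => 'rV[R]_d)) u.
  elim: s => [|t s ih]; first by apply: (@filterS _ _ Fu _ _ _ filterT) => f _ t; rewrite in_nil.
  have pt : @nbhs _ (prod_topology (fun _ : R => 'rV[R]_d)) u [set f | `|f t - u t| < e].
    have := @proj_continuous R (fun=> 'rV[R]_d) t u.
    move=> /cvgrPdist_lt/(_ _ e0); apply: (@filterS _ _ Fu) => f /=.
    by rewrite distrC.
  apply: (@filterS2 _ _ Fu _ _ _ _ pt ih) => f /= h1 h2 t'; rewrite inE => /predU1P[->//|].
  exact: h2.
have nw : (w n @[n --> \oo]) [set f | exists2 n, (k <= n)%N & f = w n].
  by exists k => // n /= kn; exists n.
have [f [[n kn ->] H]] := clu _ _ nw nu.
by exists n.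
Qed.

(** A form of the Arzela-Ascoli theorem: the pointwise cluster point inherits the modulus of
    continuity, so closeness on a fine mesh extends to the whole interval, at the price of three
    errors [e / 3]. *)
Lemma equicontinuous_cluster T w (r : R) : 0 < T ->
  (forall n t, 0 <= t <= T -> enorm (w n t) <= r) ->
  (forall e : R, 0 < e -> exists2 eta : R, 0 < eta & forall n s t,
    0 <= s -> s <= t -> t <= T -> t - s < eta -> `|w n t - w n s| <= e) ->
  exists u : R -> 'rV[R]_d, forall k : nat,
    exists2 n, (k <= n)%N & forall t, 0 <= t <= T -> `|w n t - u t| <= k.+1%:R^-1.
Proof.
move=> T0 wr weq.
(* The compact box must contain the values at every real argument, while [w] is bounded on [[0, T]]
   only. *)
pose f n t := w n (clamp T t).
have cl t : 0 <= clamp T t <= T by rewrite clamp_ge0 ?clamp_le// ltW.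
have fr n t i : `|f n t ord0 i| <= r.
  by apply: le_trans (coord_le_enorm _ _) _; exact: wr.
have [u Hu] := pointwise_cluster fr.
have fE n t : 0 <= t <= T -> f n t = w n t by move=> /andP[t0 tT]; rewrite /f clamp_id.
exists u => k; have e0 : 0 < k.+1%:R^-1 / 3 :> R by rewrite !divr_gt0.
move: (k.+1%:R^-1) e0 => e e30; have e0 : 0 < e by lra.
have [eta eta0 H] := weq _ e30.
have ueq s t : 0 <= s -> s <= t -> t <= T -> t - s < eta -> `|u t - u s| <= e / 3.
  move=> s0 st tT ts; apply/ler_addgt0Pr => e' e'0.
  have e'20 : 0 < e' / 2 by lra.
  have [n _ Hn] := Hu [:: s; t] _ 0%N e'20.
  have := Hn s; rewrite !inE eqxx => /(_ isT) h1.
  have := Hn t; rewrite !inE eqxx orbT => /(_ isT) h2.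
  have h3 := H n s t s0 st tT ts.
  rewrite fE ?s0 ?(le_trans st)// in h1; rewrite fE ?tT ?(le_trans s0)// in h2.
  have -> : u t - u s = (w n t - w n s) - ((w n t - u t) - (w n s - u s)).
    by apply/rowP => i; rewrite !mxE; ring.
  apply: le_trans (ler_normB _ _) _; apply: lerD => //.
  apply: le_trans (ler_normB _ _) _; lra.
have [N TN] : exists N : nat, T / N.+1%:R < eta.
  exists (Num.bound (T / eta)); rewrite ltr_pdivrMr// -ltr_pdivrMl// mulrC.
  apply: (lt_le_trans (archi_boundP _)); first by rewrite divr_ge0// ltW.
  by rewrite ler_nat.
(* There are [N.+2] mesh points: the index of [t = T] is [N.+1]. *)
have [n kn Hn] := Hu [seq j%:R * (T / N.+1%:R) | j <- iota 0 N.+2] _ k e30.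
exists n => // t /andP[t0 tT].
have := cell_index_mem N T0 t0; rewrite /cell/= in_itv/=.
set j := cell_index T N t; set x := j%:R * (T / N.+1%:R) => /andP[xt tx].
have h0 : 0 < T / N.+1%:R by rewrite divr_gt0.
have x0 : 0 <= x by rewrite mulr_ge0// ltW.
have jN : (j < N.+2)%N.
  rewrite ltnS -(ler_nat R) -(ler_pM2r h0) (le_trans (le_trans xt tT))//.
  by rewrite mulrCA divff ?mulr1// pnatr_eq0.
have txe : t - x < eta.
  by move: tx; rewrite -[j.+1%:R]natr1 mulrDl mul1r -/x => tx; rewrite ltrBlDl (lt_trans tx)// ltrD2l.
have h1 := H n x t x0 xt tT txe.
have h2 := ueq x t x0 xt tT txe.
have h3 : `|w n x - u x| < e / 3.
  rewrite -(fE n x) ?x0 ?(le_trans xt)//; apply: Hn.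
  by apply/mapP; exists j => //; rewrite mem_iota.
have -> : w n t - u t = (w n t - w n x) + ((w n x - u x) - (u t - u x)).
  by apply/rowP => i; rewrite !mxE; ring.
apply: le_trans (ler_normD _ _) _.
have := ler_normB (w n x - u x) (u t - u x); lra.
Qed.

(** The [eta] found for absolute continuity depends on [Psi], [c] and [e] only, so it serves all [u]
    at once. *)
Lemma Ninfty_equicontinuous T (Psi : 'rV[R]_d -> R) (c : R) : is_Ninfty Psi ->
  forall e : R, 0 < e -> exists2 eta : R, 0 < eta &
    forall u, bounded_slopes T Psi c u -> forall s t,
      0 <= s -> s <= t -> t <= T -> t - s < eta -> `|u t - u s| <= e.
Proof.
move=> NPsi e e0; pose c1 := Num.max c 1.
have c10 : 0 < c1 by rewrite lt_max ltr01 orbT.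
have e10 : 0 < e / 2 / c1 by rewrite !divr_gt0.
have [K K0 HK] := Ninfty_superlinear NPsi e10.
exists (e / 2 / (K + 1)); first by rewrite !divr_gt0// ltr_wpDl.
move=> u Hu s t s0 st tT ts.
have h1 : e / 2 / c1 * c <= e / 2.
  have e20 : 0 <= e / 2 by lra.
  have cc : c1^-1 * c <= 1 by rewrite ler_pdivrMl// mulr1 le_max lexx.
  by rewrite -mulrA ler_piMr.
have h2 : K * (t - s) <= e / 2.
  apply: (@le_trans _ _ ((K + 1) * (t - s))); first by rewrite ler_wpM2r ?subr_ge0// lerDl.
  by rewrite -ler_pdivlMl ?ltr_wpDl// mulrC ltW.
have := bounded_slopes_increment NPsi (ltW e10) HK Hu (n := 1) (a := fun=> s) (b := fun=> t).
rewrite !big_ord_recl !big_ord0 !addr0 => H.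
apply: le_trans (norm_le_enorm _) _; apply: le_trans (H _ _) _ => //.
  by apply/trivIsetP => i j _ _; rewrite !ord1 eqxx.
lra.
Qed.

Lemma bounded_slopes_cluster T (Psi : 'rV[R]_d -> R) (c r : R) w : 0 < T -> is_Ninfty Psi ->
  (forall n, bounded_slopes T Psi c (w n)) -> (forall n, enorm (w n 0) <= r) ->
  exists u : R -> 'rV[R]_d, forall k : nat,
    exists2 n, (k <= n)%N & forall t, 0 <= t <= T -> `|w n t - u t| <= k.+1%:R^-1.
Proof.
move=> T0 NPsi Hw wr.
have [K K0 HK] := Ninfty_superlinear NPsi ltr01.
apply: (@equicontinuous_cluster _ _ (d%:R * (r + (K * T + `|c|))) T0).
  move=> n t /andP[t0 tT]; apply: le_trans (enorm_le_norm _) _; rewrite ler_wpM2l//.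
  have -> : w n t = w n 0 + (w n t - w n 0) by rewrite subrKC.
  apply: le_trans (ler_normD _ _) _; apply: lerD.
    by apply: le_trans (norm_le_enorm _) _; exact: wr.
  have := bounded_slopes_increment NPsi ler01 HK (Hw n) (n := 1) (a := fun=> 0) (b := fun=> t).
  rewrite !big_ord_recl !big_ord0 !addr0 subr0 mul1r => H.
  apply: le_trans (norm_le_enorm _) _; apply: le_trans (H _ _) _ => //.
    by apply/trivIsetP => i j _ _; rewrite !ord1 eqxx.
  by rewrite lerD ?ler_wpM2l// ler_norm.
move=> e /(Ninfty_equicontinuous T c NPsi)[eta eta0 H]; exists eta => // n; exact: H.
Qed.

End compactness.

(** * Domination and convergence of integrals *)

Section domination.
Context {R : realType}.
Implicit Types (f g h : R -> R) (T : R).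

Local Notation mu := (leb R).

Lemma Lone_measurable T f : Lone T f -> meas_0T T f.
Proof. by move=> iF; apply/measurable_EFinP; exact: measurable_int iF. Qed.

Lemma meas_norm T f : meas_0T T f -> meas_0T T (fun t => `|f t|).
Proof. by move=> mf; apply: measurableT_comp. Qed.

Lemma ae_norm_le_Lone T f g : meas_0T T f -> Lone T g -> ae_0T T (fun t => `|f t| <= g t) ->
  Lone T f.
Proof.
move=> mf ig fg; apply: (ae_le_Lone (A := 1) mf ig).
by move: fg; rewrite /ae_0T; apply: filterS => t H tT; rewrite mul1r; exact: H.
Qed.

Lemma Lone_norm T f : Lone T f -> Lone T (fun t => `|f t|).
Proof. by move=> /integrable_norm. Qed.

Lemma LoneD T f g : Lone T f -> Lone T g -> Lone T (fun t => f t + g t).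
Proof. by move=> iF ig; have := integrableD (itv_lebT `[0, T]) iF ig. Qed.

Lemma ae_norm_Rintegral_le T f g : Lone T f -> Lone T g -> ae_0T T (fun t => `|f t| <= g t) ->
  `|Rintegral mu `[0, T]%classic f| <= Rintegral mu `[0, T]%classic g.
Proof.
move=> iF ig fg; apply: le_trans (le_normr_Rintegral (itv_lebT _) iF) _.
exact: ae_le_Rintegral (Lone_norm iF) ig fg.
Qed.

Lemma Rintegral_dominated T (f_ : nat -> R -> R) f g :
  (forall n, meas_0T T (f_ n)) -> meas_0T T f ->
  ae_0T T (fun t => f_ n t @[n --> \oo] --> f t) -> Lone T g ->
  ae_0T T (fun t => forall n, `|f_ n t| <= g t) ->
  (fun n => Rintegral mu `[0, T]%classic (f_ n)) @ \oo --> Rintegral mu `[0, T]%classic f.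
Proof.
move=> mf_ mf f_f ig f_g.
have [] := @dominated_convergence _ _ _ mu `[0, T]%classic (itv_lebT _)
  (fun n t => (f_ n t)%:E) (EFin \o f) (EFin \o g) _ _ _ ig _.
- by move=> n; apply/measurable_EFinP; exact: mf_.
- exact/measurable_EFinP.
- move: f_f; rewrite /ae_0T; apply: filterS => t H tT.
  by apply: cvg_EFin; [near=> n|exact: H].
- by move: f_g; rewrite /ae_0T; apply: filterS => t H n tT; rewrite lee_fin; exact: H.
move=> iF _ cv; rewrite /Rintegral; apply: fine_cvg.
by rewrite fineK//; apply: integrable_fin_num iF; exact: itv_lebT.
Unshelve. all: by end_near. Qed.

End domination.

(** Shared by the two approximation arguments: [A] and [B] are pairings with the approximant, [A']
    and [B'] the errors. *)
Lemma ler_dist_split (R : realFieldType) (e A A' B B' : R) :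
  `|A - B| <= e / 2 -> `|A'| <= e / 4 -> `|B'| <= e / 4 ->
  `|A' + A - (B' + B)| <= e.
Proof.
move=> h1 h2 h3; have -> : A' + A - (B' + B) = (A - B) + (A' - B') by ring.
by apply: le_trans (ler_normD _ _) _; have := ler_normB A' B'; lra.
Qed.

(** * Pairings with bounded functions *)

Section pairings.
Context {R : realType} {d : nat}.
Implicit Types (g v w z : R -> 'rV[R]_d) (T : R) (Psi : 'rV[R]_d -> R).

Local Notation mu := (leb R).

Lemma modular_Lone T Psi v (c : R) : (forall x, 0 <= Psi x) -> meas_0T T (Psi \o v) ->
  (modular T Psi v <= c%:E)%E ->
  Lone T (Psi \o v) /\ Rintegral mu `[0, T]%classic (Psi \o v) <= c.
Proof.
move=> P0 mP Pc.
have iP : Lone T (Psi \o v).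
  apply/integrableP; split; first exact/measurable_EFinP.
  apply: le_lt_trans (ltry c); apply: le_trans Pc; rewrite /modular.
  by under eq_integral do rewrite /= ger0_norm//.
split => //; rewrite -lee_fin /Rintegral fineK//.
by apply: integrable_fin_num iP; exact: itv_lebT.
Qed.

(** Young's inequality at [g / lam] makes the pairing small with [lam], uniformly over all [v] of
    modular at most [c2]. *)
Lemma Young_pairing T Psi (lam c1 c2 : R) g v : is_Ninfty Psi -> 0 < lam ->
  vmeas_0T T g -> vmeas_0T T v ->
  (modular T (conjugate Psi) (fun t => lam^-1 *: g t) <= c1%:E)%E ->
  (modular T Psi v <= c2%:E)%E ->
  Lone T (fun t => dotp (g t) (v t)) /\
  `|Rintegral mu `[0, T]%classic (fun t => dotp (g t) (v t))| <= lam * (c1 + c2).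
Proof.
move=> NPsi lam0 mg mv gc vc.
have mgv := vmeas_dotp mg mv.
have [i1 r1] := modular_Lone (conjugate_ge0 NPsi) (vmeas_conjugate NPsi (vmeasZ _ mg)) gc.
have [i2 r2] := modular_Lone (Ninfty_ge0 NPsi) (vmeas_continuous mv (Ninfty_continuous NPsi)) vc.
have i12 := LoneD i1 i2.
have il := LoneZ lam i12.
have bd : ae_0T T (fun t => `|dotp (g t) (v t)| <= lam * (conjugate Psi (lam^-1 *: g t) + Psi (v t))).
  apply: nearW => t _.
  have -> : dotp (g t) (v t) = lam * dotp (v t) (lam^-1 *: g t).
    by rewrite dotpZr mulVKf ?gt_eqF// dotpC.
  by rewrite normrM gtr0_norm// ler_pM2l// addrC norm_Young.
have iL := ae_norm_le_Lone mgv il bd.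
split => //; apply: le_trans (ae_norm_Rintegral_le iL il bd) _.
have mI := @itv_lebT R `[0, T].
by rewrite RintegralZl// RintegralD// ler_pM2l// lerD.
Qed.

(** A form of uniform integrability: the first term is small when [h] is small in L^1, the second
    when [e] is small, uniformly over all [v] of modular at most [c]. *)
Lemma coord_mul_bound T Psi (h : R -> R) v (i : 'I_d) (B K e c : R) : is_Ninfty Psi ->
  0 <= B -> 0 <= e -> (forall y, enorm y <= K + e * Psi y) -> Lone T h ->
  ae_0T T (fun t => `|h t| <= B) -> vmeas_0T T v -> (modular T Psi v <= c%:E)%E ->
  Lone T (fun t => h t * v t ord0 i) /\
  `|Rintegral mu `[0, T]%classic (fun t => h t * v t ord0 i)| <=
     K * Rintegral mu `[0, T]%classic (fun t => `|h t|) + B * e * c.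
Proof.
move=> NPsi B0 e0 HK ih hB mv vc.
have [i2 r2] := modular_Lone (Ninfty_ge0 NPsi) (vmeas_continuous mv (Ninfty_continuous NPsi)) vc.
have mhv : meas_0T T (fun t => h t * v t ord0 i).
  by apply: measurable_funM; [exact: Lone_measurable|exact: mv].
have iR := LoneD (LoneZ K (Lone_norm ih)) (LoneZ (B * e) i2).
have bd : ae_0T T (fun t => `|h t * v t ord0 i| <= K * `|h t| + B * e * Psi (v t)).
  move: hB; rewrite /ae_0T; apply: filterS => t H tT; rewrite normrM.
  apply: le_trans (ler_wpM2l (normr_ge0 _) (le_trans (coord_le_enorm _ _) (HK _))) _.
  rewrite mulrDr [_ * K]mulrC lerD2l mulrA ler_wpM2r ?Ninfty_ge0//.
  by rewrite ler_wpM2r// H.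
have iL := ae_norm_le_Lone mhv iR bd.
split => //; apply: le_trans (ae_norm_Rintegral_le iL iR bd) _.
have mI := @itv_lebT R `[0, T].
rewrite RintegralD//; [|exact: LoneZ (Lone_norm ih)|exact: LoneZ i2].
rewrite RintegralZl//; last exact: Lone_norm.
rewrite RintegralZl// lerD2l ler_wpM2l// mulr_ge0//.
Qed.

Lemma Rintegral_step T n (c : nat -> R) z (i : 'I_d) : 0 < T -> abs_continuous T z ->
  Rintegral mu `[0, T]%classic (fun t => c (cell_index T n t) * derive1 z t ord0 i) =
  \sum_(j < n.+1) c j * (z (j.+1%:R * (T / n.+1%:R)) ord0 i - z (j%:R * (T / n.+1%:R)) ord0 i).
Proof.
move=> T0 acz; rewrite /Rintegral (integral_cells n T0); last first.
  apply: measurable_funM; last exact: ac_vmeas_derive1.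
  exact: (measurable_cell_index n c T0).
rewrite (eq_bigr (fun j : 'I_n.+1 => (c j * (z (j.+1%:R * (T / n.+1%:R)) ord0 i - z (j%:R * (T / n.+1%:R)) ord0 i))%:E)).
  by rewrite sumEFin.
move=> j _; have [b1 b2 b3] := cell_bound T0 (ltn_ord j).
have sub : `[j%:R * (T / n.+1%:R), j.+1%:R * (T / n.+1%:R)]%classic `<=` `[0, T]%classic.
  by apply: subset_itvScc.
have iz : mu.-integrable `[j%:R * (T / n.+1%:R), j.+1%:R * (T / n.+1%:R)] (fun t => (derive1 z t ord0 i)%:E).
  by apply: integrableS (ac_Lone_derive1 i T0 acz) => //; exact: itv_lebT.
transitivity (\int[mu]_(t in cell T n j) ((c j)%:E * (derive1 z t ord0 i)%:E))%E.
  by apply: eq_integral => t; rewrite inE => /(cellP T0) ->; rewrite EFinM.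
have sub' : cell T n j `<=` `[j%:R * (T / n.+1%:R), j.+1%:R * (T / n.+1%:R)]%classic.
  exact: subset_itv_co_cc.
rewrite integralZl; [|exact: cell_measurable|]; last first.
  by apply: integrableS iz => //; [exact: itv_lebT|exact: cell_measurable].
have mz := (measurable_EFinP _ _).1 (measurable_int _ iz).
have Ecc := integral_itv_bndc (ltW b2) mz.
rewrite EFinM; congr (_ * _)%E; apply: (etrans (esym Ecc)).
have := ac_increment T0 acz b1 (ltW b2) b3 => /rowP/(_ i); rewrite !mxE => ->.
by rewrite /Rintegral fineK//; apply: integrable_fin_num iz; exact: itv_lebT.
Qed.

Lemma bounded_coord_weak_cvg T Psi (h : R -> R) (C c : R) (w : nat -> R -> 'rV[R]_d) u (i : 'I_d) :
  0 < T -> is_Ninfty Psi -> 0 <= C -> meas_0T T h -> ae_0T T (fun t => `|h t| <= C) ->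
  (forall n, abs_continuous T (w n)) -> abs_continuous T u ->
  (forall n, modular T Psi (derive1 (w n)) <= c%:E)%E -> (modular T Psi (derive1 u) <= c%:E)%E ->
  (forall t, 0 <= t <= T -> w n t @[n --> \oo] --> u t) ->
  (fun n => Rintegral mu `[0, T]%classic (fun t => h t * derive1 (w n) t ord0 i)) @ \oo -->
    Rintegral mu `[0, T]%classic (fun t => h t * derive1 u t ord0 i).
Proof.
move=> T0 NPsi C0 mh hC acw acu wc uc wu.
have mI := @itv_lebT R `[0, T].
have [W [Wlip dW]] := bounded_primitive T0 C0 mh hC.
(* The step functions approximating [h] are the difference quotients of its primitive: bounded by
   [C] on [[0, T[] and convergent almost everywhere, hence in L^1. *)
pose s N t := dq T N W t.
have ms N : meas_0T T (s N) by exact: (measurable_cell_index N (slope T N W) T0).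
have sC N t : 0 <= t < T -> `|s N t| <= C.
  move=> /andP[t0 tT]; have h0 : 0 < T / N.+1%:R by rewrite divr_gt0.
  have [b1 b2 b3] := cell_bound T0 (cell_index_lt N T0 t0 tT).
  have := Wlip _ _ b1 (ltW b2) b3; rewrite -mulrBl -natrB// subSnn mul1r.
  by rewrite /s /dq /slope normrM gtr0_norm ?invr_gt0// ler_pdivrMl// [leRHS]mulrC.
have aesC : ae_0T T (fun t => forall N, `|h t - s N t| <= 2 * C).
  apply: ae_itvoo_cc; move: hC; rewrite /ae_0T; apply: filterS => t H /andP[t0 tT] N.
  have h1 : `|s N t| <= C by apply: sC; rewrite ltW.
  have h2 : `|h t| <= C by apply: H; rewrite in_itv/= !ltW.
  by apply: le_trans (ler_normB _ _) _; lra.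
have icst (B : R) : Lone T (cst B).
  apply: measurable_bounded_integrable => //; first by rewrite leb_itvcc ?ltry// ltW.
  by exists `|B|; split; rewrite ?num_real// => M cM x _ /=; rewrite ltW.
have ihs N : Lone T (fun t => h t - s N t).
  apply: (ae_norm_le_Lone _ (icst (2 * C))); first exact: measurable_funB mh (ms _).
  by move: aesC; rewrite /ae_0T; apply: filterS => t H tT; exact: H.
have aeN N : ae_0T T (fun t => `|h t - s N t| <= 2 * C).
  by move: aesC; rewrite /ae_0T; apply: filterS => t H tT; exact: H.
have L1 : (fun N => Rintegral mu `[0, T]%classic (fun t => `|h t - s N t|)) @ \oo --> (0 : R).
  rewrite -[X in _ --> X](_ : Rintegral mu `[0, T]%classic (cst 0) = 0); last first.
    by rewrite Rintegral_cst// mul0r.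
  apply: (Rintegral_dominated _ _ _ (icst (2 * C))).
  - by move=> N; exact/meas_norm/(measurable_funB mh (ms N)).
  - exact: measurable_cst.
  - apply: ae_itvoo_cc; move: dW; rewrite /ae_0T; apply: filterS => t H /andP[t0 tT].
    have [d1 d2] : derivable W t 1 /\ derive1 W t = h t by apply: H; rewrite in_itv/= !ltW.
    have := dq_cvg T0 (ltW t0) tT d1; rewrite d2 => cv.
    rewrite -(normr0 R) -(subrr (h t)); apply: cvg_norm; apply: cvgB => //; exact: cvg_cst.
  - by move: aesC; rewrite /ae_0T; apply: filterS => t H tT N; rewrite normr_id; exact: H.
have split_ N z : abs_continuous T z -> (modular T Psi (derive1 z) <= c%:E)%E ->
    Rintegral mu `[0, T]%classic (fun t => h t * derive1 z t ord0 i) =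
    Rintegral mu `[0, T]%classic (fun t => (h t - s N t) * derive1 z t ord0 i) +
    Rintegral mu `[0, T]%classic (fun t => s N t * derive1 z t ord0 i).
  move=> acz zc; have mz := ac_vmeas_derive1 T0 acz.
  have C20 : 0 <= 2 * C by rewrite mulr_ge0.
  have [K K0 HK] := Ninfty_superlinear NPsi ltr01.
  have [i1 _] := coord_mul_bound i NPsi C20 ler01 HK (ihs N) (aeN N) mz zc.
  have ih : Lone T h := ae_norm_le_Lone mh (icst C) hC.
  have [i2 _] := coord_mul_bound i NPsi C0 ler01 HK ih hC mz zc.
  have i3 : Lone T (fun t => s N t * derive1 z t ord0 i).
    rewrite (_ : (fun t => _) = fun t => h t * derive1 z t ord0 i - (h t - s N t) * derive1 z t ord0 i).
      exact: LoneB.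
    by apply/funext => t; ring.
  rewrite -RintegralD//; congr fine; apply: eq_integral => t _; congr EFin; ring.
apply/cvgrPdist_le => e e0.
have c0 : 0 <= c.
  by rewrite -lee_fin; apply: le_trans uc; rewrite integral_ge0// => t _; rewrite lee_fin Ninfty_ge0.
(* [e1] is fixed before the mesh since [K] depends on it: the term [2 C e1 c] takes [e / 8], then
   [N] makes the term with [K] at most [e / 8]. *)
pose e1 := e / 8 / (2 * C * c + 1).
have Cc0 : 0 < 2 * C * c + 1 by rewrite ltr_wpDl// !mulr_ge0.
have e10 : 0 < e1 by rewrite /e1 !divr_gt0.
have [K K0 HK] := Ninfty_superlinear NPsi e10.
have [N HN] : exists N, K * Rintegral mu `[0, T]%classic (fun t => `|h t - s N t|) <= e / 8.
  have e2 : 0 < e / 8 / (K + 1) by rewrite !divr_gt0// ltr_wpDl.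
  move/cvgrPdist_le : L1 => /(_ _ e2)[N _ /(_ N (leqnn _))]; rewrite sub0r normrN.
  rewrite ger0_norm ?Rintegral_ge0// => h1; exists N.
  apply: (@le_trans _ _ ((K + 1) * (e / 8 / (K + 1)))).
    apply: ler_pM => //; first exact: Rintegral_ge0.
    by rewrite lerDl.
  by rewrite mulrC divfK// gt_eqF// ltr_wpDl.
have err z : abs_continuous T z -> (modular T Psi (derive1 z) <= c%:E)%E ->
    `|Rintegral mu `[0, T]%classic (fun t => (h t - s N t) * derive1 z t ord0 i)| <= e / 4.
  move=> acz zc; have mz := ac_vmeas_derive1 T0 acz.
  have C20 : 0 <= 2 * C by rewrite mulr_ge0.
  have [_] := coord_mul_bound i NPsi C20 (ltW e10) HK (ihs N) (aeN N) mz zc.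
  move=> /le_trans; apply.
  have h1 : 2 * C * e1 * c <= e / 8.
    rewrite mulrAC /e1 mulrA ler_pdivrMr// mulrC ler_pM2l ?divr_gt0//.
    by rewrite lerDl.
  by lra.
have stepcv : (fun n => Rintegral mu `[0, T]%classic (fun t => s N t * derive1 (w n) t ord0 i)) @ \oo -->
    Rintegral mu `[0, T]%classic (fun t => s N t * derive1 u t ord0 i).
  rewrite (Rintegral_step N (slope T N W) i T0 acu).
  have -> : (fun n => Rintegral mu `[0, T]%classic (fun t => s N t * derive1 (w n) t ord0 i)) =
    (fun n => \sum_(j < N.+1) slope T N W j *
      (w n (j.+1%:R * (T / N.+1%:R)) ord0 i - w n (j%:R * (T / N.+1%:R)) ord0 i)).
    by apply/funext => n; exact: (Rintegral_step N (slope T N W) i T0 (acw n)).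
  apply: (cvg_big (U := R)) => [|j _]; first exact: add_continuous.
  have [b1 b2 b3] := cell_bound T0 (ltn_ord j).
  apply: cvgMr; apply: cvgB.
    apply: (cvg_comp _ (fun x : 'rV[R]_d => x ord0 i)); last exact: coord_continuous.
    by apply: wu; rewrite b3 (le_trans b1)// ltW.
  apply: (cvg_comp _ (fun x : 'rV[R]_d => x ord0 i)); last exact: coord_continuous.
  by apply: wu; rewrite b1 (le_trans (ltW b2)).
have e20 : 0 < e / 2 by lra.
move/cvgrPdist_le : stepcv => /(_ _ e20); apply: filterS => n Hn.
rewrite (split_ N _ acu uc) (split_ N _ (acw n) (wc n)).
have k1 := err _ acu uc; have k2 := err _ (acw n) (wc n).
exact (ler_dist_split Hn k1 k2).
Qed.

End pairings.

Lemma enorm_distC (R : realType) d (x y : 'rV[R]_d) : enorm (x - y) = enorm (y - x).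
Proof. by rewrite -opprB -scaleN1r enormZ normrN1 mul1r. Qed.

(** * Passage to the limit in the constraints *)

Section weak_star.
Context {R : realType} {d : nat}.
Implicit Types (g v w z u : R -> 'rV[R]_d) (T : R) (Phi : 'rV[R]_d -> R).

Local Notation mu := (leb R).

(** Open sets of the initial topology are preimages of open sets of the product, where convergence
    is componentwise; convergence of every pairing is therefore enough. *)
Lemma weak_star_closed_limit T Phi (M : set (R -> 'rV[R]_d)) (v : nat -> R -> 'rV[R]_d) u :
  weak_star_closed_subspace T Phi M -> (forall n, M (v n)) -> orlicz T Phi u ->
  (forall g, orlicz_heart T (conjugate Phi) g -> pairing T g (v n) @[n --> \oo] --> pairing T g u) ->
  M u.
Proof.
move=> [MO _ /closed_subspaceP[V cV VM]] Mv Ou Hg.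
suff Vu : V u by have : (V `&` orlicz T Phi) u by []; rewrite VM => -[].
have Vv n : V (v n).
  have : (M `&` orlicz T Phi) (v n) by split; [exact: Mv|exact: MO (Mv n)].
  by rewrite -VM => -[].
apply: contrapT => nVu.
have : open (~` V : set (weak_star T Phi)) by exact: closed_openC.
move=> [B oB BV].
pose f (x : R -> 'rV[R]_d) : prod_topology (fun _ : set_type (orlicz_heart T (conjugate Phi)) => R) :=
  fun k => pairing T (set_val k) x.
have fcv : f (v n) @[n --> \oo] --> f u.
  (* The product topology is a supremum of initial topologies, one per component; constant families
     witness surjectivity of each projection. *)
  apply/cvg_sup => g; apply/cvg_image.
    by rewrite eqEsubset; split => // x _; exists (cst x).
  move=> A /(Hg _ (set_valP g)) [N _ HN]; exists [set h | A (h g)].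
    by exists N => // n; exact: HN.
  rewrite eqEsubset; split => [x [h Ah <-//]|x Ax]; by exists (cst x).
have Bfu : B (f u) by rewrite -[B (f u)]/((f @^-1` B) u) BV.
have : nbhs (f u) B by exact: open_nbhs_nbhs.
move=> /fcv [N _ /(_ N (leqnn _))] BN.
have : (~` V) (v N) by rewrite -BV.
by apply; exact: Vv.
Qed.

Lemma uniform_closed_limit T (V : set (R -> 'rV[R]_d)) (w : nat -> R -> 'rV[R]_d) u :
  closed_in_C0T T V -> (forall n, V (w n)) -> C0T T u ->
  (forall k : nat, exists n, forall t, 0 <= t <= T -> `|w n t - u t| <= k.+1%:R^-1) -> V u.
Proof.
move=> [VC /closed_subspaceP[W cW WV]] Vw Cu wu.
suff Wu : W u by have : (W `&` C0T T) u by []; rewrite WV => -[].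
have Ww n : W (w n).
  have : (V `&` C0T T) (w n) by split; [exact: Vw|exact: VC (Vw n)].
  by rewrite -WV => -[].
apply: cW => A /uniform_nbhs[E [entE EA]].
move: entE; rewrite -entourage_ballE => -[e /= e0 He].
have [k ke] : exists k : nat, k.+1%:R^-1 < e.
  exists (Num.bound e^-1); rewrite invf_plt ?posrE//.
  apply: lt_le_trans (archi_boundP _) _; first by rewrite invr_ge0 ltW.
  by rewrite ler_nat.
have [n Hn] := wu k.
exists (w n); split => //; apply: EA => t; rewrite /= in_itv/= => tT.
apply: He; rewrite /= -ball_normE /= distrC.
by apply: le_lt_trans ke; exact: Hn.
Qed.

Lemma ac_C0T T u : abs_continuous T u -> C0T T u.
Proof.
move=> acu; apply/subspace_continuousP => t; rewrite /= in_itv/= => /andP[t0 tT].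
apply/cvgrPdist_le => e e0; have [eta eta0 H] := ac_modulus acu e0.
exists eta => //= s; rewrite /= distrC => st.
rewrite in_itv/= => /andP[s0 sT].
apply: le_trans (norm_le_enorm _) _; apply: ltW.
have [ts|st'] := leP t s.
  by rewrite enorm_distC; apply: H => //; apply: le_lt_trans st; exact: ler_norm.
by apply: H => //; [exact: ltW|apply: le_lt_trans st; rewrite distrC; exact: ler_norm].
Qed.

(** The real infimum of the empty set is 0, so a small Luxemburg norm gives an admissible [lam] only
    once the set is known to be nonempty. For [g - w] this holds because a multiple of [g] has
    finite modular and [w] is bounded. *)
Lemma heart_approx T Phi g (e : R) : 0 < T -> is_Ninfty Phi ->
  orlicz_heart T (conjugate Phi) g -> 0 < e ->
  exists2 w, Linfty T w & exists2 lam : R, 0 < lam < e &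
    (modular T (conjugate Phi) (fun t => lam^-1 *: (g t - w t)) <= 1)%E.
Proof.
move=> T0 NPhi [[mg [lam lam0 glam]] Hg] e0.
have [w Lw we] := Hg e e0; exists w => //.
have [mw [C wC]] := Lw.
have [] := inf_lt _ we; last by move=> l [l0 lmod] le; exists l => //; rewrite l0.
have C0 : 0 <= `|C| by [].
have lC0 : 0 <= lam * `|C| by rewrite mulr_ge0// ltW.
have [K K0 HK] := conjugate_bounded NPhi lC0.
(* Halving [lam] leaves room for convexity, which separates [lam g] from [lam w]. *)
pose h t := (lam / 2) *: (g t - w t).
have mgw := vmeasB mg mw.
have mh : vmeas_0T T h := vmeasZ _ mgw.
have mch := vmeas_conjugate NPhi mh.
have hoo : (modular T (conjugate Phi) h < +oo)%E.
  have mI := @itv_lebT R `[0, T].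
  have mcg := vmeas_conjugate NPhi (vmeasZ lam mg).
  apply: (@le_lt_trans _ _ (\int[mu]_(t in `[0%R, T]) ((conjugate Phi (lam *: g t))%:E + K%:E))%E).
    apply: ae_ge0_le_integral.
    - exact: mI.
    - by move=> t _; rewrite lee_fin conjugate_ge0.
    - exact/measurable_EFinP.
    - by move=> t _; rewrite -EFinD lee_fin addr_ge0// conjugate_ge0.
    - by apply: emeasurable_funD; [exact/measurable_EFinP|exact: measurable_cst].
    - move: wC; rewrite /ae_0T; apply: filterS => t H tT; rewrite -EFinD lee_fin.
      rewrite /h scalerBr -scaleNr; apply: le_trans (conjugate_half NPhi _ _) _.
      rewrite !scalerA mulrN [2 * (lam / 2)]mulrC divfK ?pnatr_eq0// scaleNr conjugateN//.
      have h1 : conjugate Phi (lam *: w t) <= K.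
        apply: HK => i; rewrite mxE normrM gtr0_norm// ler_pM2l//.
        apply: le_trans (coord_le_enorm _ _) _; apply: le_trans (H tT) _; exact: ler_norm.
      have := conjugate_ge0 NPhi (lam *: g t); lra.
  rewrite ge0_integralD.
  - rewrite integral_cst// lte_add_pinfty//.
    by rewrite (leb_itvcc (ltW T0)) -EFinM ltry.
  - exact: mI.
  - by move=> t _; rewrite lee_fin conjugate_ge0.
  - exact/measurable_EFinP.
  - by move=> t _; rewrite lee_fin.
  - exact: measurable_cst.
have h0 : (0 <= modular T (conjugate Phi) h)%E.
  by apply: integral_ge0 => t _; rewrite lee_fin conjugate_ge0.
have hfin : modular T (conjugate Phi) h \is a fin_num by rewrite ge0_fin_numE.
pose Q := fine (modular T (conjugate Phi) h).
have Q0 : 0 <= Q by rewrite fine_ge0.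
have Q1 : 0 < Q + 1 by rewrite ltr_wpDl.
have l20 : 0 < lam / 2 by rewrite divr_gt0.
(* Dividing [h] by [Q + 1], with [Q] its modular, lowers the modular to at most [Q / (Q + 1)]. *)
exists ((Q + 1) / (lam / 2)) => /=; split; first by rewrite divr_gt0.
apply: (@le_trans _ _ (((Q + 1)^-1)%:E * modular T (conjugate Phi) h)%E).
  rewrite /modular -ge0_integralZl; last 4 first.
  - exact: itv_lebT.
  - exact/measurable_EFinP.
  - by move=> t _; rewrite lee_fin conjugate_ge0.
  - by rewrite lee_fin invr_ge0 ltW.
  apply: ge0_le_integral.
  - exact: itv_lebT.
  - by move=> t _; rewrite lee_fin conjugate_ge0.
  - by apply/measurable_EFinP; exact: (vmeas_conjugate NPhi (vmeasZ _ mgw)).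
  - by apply/measurable_EFinP; apply: measurable_funM => //; exact: measurable_cst.
  - move=> t _; rewrite -EFinM lee_fin.
    rewrite invf_div [_ / (Q + 1)]mulrC -scalerA; apply: conjugate_scale => //.
    by rewrite invr_ge0 (ltW Q1)/= invf_le1// lerDr.
by rewrite -(fineK hfin) -EFinM lee_fin ler_pdivrMl// mulr1 -/Q lerDl.
Qed.

Lemma Rintegral_dotp_sum T g v : (forall i, Lone T (fun t => g t ord0 i * v t ord0 i)) ->
  Lone T (fun t => dotp (g t) (v t)) /\
  pairing T g v = \sum_(i < d) Rintegral mu `[0, T]%classic (fun t => g t ord0 i * v t ord0 i).
Proof.
move=> igv; have mI := @itv_lebT R `[0, T].
have E : (fun t => (dotp (g t) (v t))%:E) = (fun t => \sum_(i < d) (g t ord0 i * v t ord0 i)%:E)%E.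
  by apply/funext => t; rewrite /dotp -sumEFin.
split.
  rewrite /Lone [X in _.-integrable _ X]E; apply: integrable_sum => // i _; exact: igv.
rewrite /pairing /Rintegral E integral_sum//.
rewrite [X in fine X](eq_bigr (fun i => (Rintegral mu `[0, T]%classic (fun t => g t ord0 i * v t ord0 i))%:E)).
  by rewrite sumEFin.
by move=> i _; rewrite /Rintegral fineK//; apply: integrable_fin_num (igv i).
Qed.

Lemma bounded_pairing_cvg T Phi g (c : R) (w : nat -> R -> 'rV[R]_d) u :
  0 < T -> is_Ninfty Phi -> Linfty T g ->
  (forall n, abs_continuous T (w n)) -> abs_continuous T u ->
  (forall n, modular T Phi (derive1 (w n)) <= c%:E)%E -> (modular T Phi (derive1 u) <= c%:E)%E ->
  (forall t, 0 <= t <= T -> w n t @[n --> \oo] --> u t) ->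
  [/\ forall z, abs_continuous T z -> (modular T Phi (derive1 z) <= c%:E)%E ->
        Lone T (fun t => dotp (g t) (derive1 z t)) &
      pairing T g (derive1 (w n)) @[n --> \oo] --> pairing T g (derive1 u)].
Proof.
move=> T0 NPhi [mg [C gC]] acw acu wc uc wu.
have giC i : ae_0T T (fun t => `|g t ord0 i| <= `|C|).
  move: gC; rewrite /ae_0T; apply: filterS => t H tT.
  by apply: le_trans (coord_le_enorm _ _) _; apply: le_trans (H tT) _; exact: ler_norm.
have mI := @itv_lebT R `[0, T].
have icst : Lone T (cst `|C|).
  apply: measurable_bounded_integrable => //; first by rewrite leb_itvcc ?ltry// ltW.
  by exists `|C|; split; rewrite ?num_real// => M cM x _ /=; rewrite normr_id ltW.
have igi i : Lone T (fun t => g t ord0 i) by exact: ae_norm_le_Lone (mg i) icst (giC i).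
have [K K0 HK] := Ninfty_superlinear NPhi ltr01.
have igz z : abs_continuous T z -> (modular T Phi (derive1 z) <= c%:E)%E ->
    forall i, Lone T (fun t => g t ord0 i * derive1 z t ord0 i).
  move=> acz zc i.
  by have [] := coord_mul_bound i NPhi (normr_ge0 C) ler01 HK (igi i) (giC i) (ac_vmeas_derive1 T0 acz) zc.
split; first by move=> z acz zc; have [] := Rintegral_dotp_sum (igz z acz zc).
have [_ ->] := Rintegral_dotp_sum (igz u acu uc).
have -> : (fun n => pairing T g (derive1 (w n))) = (fun n => \sum_(i < d)
    Rintegral mu `[0, T]%classic (fun t => g t ord0 i * derive1 (w n) t ord0 i)).
  by apply/funext => n; have [_ ->] := Rintegral_dotp_sum (igz _ (acw n) (wc n)).
apply: (cvg_big (U := R)) => [|i _]; first exact: add_continuous.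
exact: (bounded_coord_weak_cvg T0 NPhi (normr_ge0 C) (mg i) (giC i) acw acu wc uc wu).
Qed.

Lemma heart_pairing_cvg T Phi g (c : R) (w : nat -> R -> 'rV[R]_d) u :
  0 < T -> is_Ninfty Phi -> orlicz_heart T (conjugate Phi) g ->
  (forall n, abs_continuous T (w n)) -> abs_continuous T u ->
  (forall n, modular T Phi (derive1 (w n)) <= c%:E)%E -> (modular T Phi (derive1 u) <= c%:E)%E ->
  (forall t, 0 <= t <= T -> w n t @[n --> \oo] --> u t) ->
  pairing T g (derive1 (w n)) @[n --> \oo] --> pairing T g (derive1 u).
Proof.
move=> T0 NPhi Hg acw acu wc uc wu.
have mI := @itv_lebT R `[0, T].
have c0 : 0 <= c.
  by rewrite -lee_fin; apply: le_trans uc; rewrite integral_ge0// => t _; rewrite lee_fin Ninfty_ge0.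
apply/cvgrPdist_le => e e0.
(* With [lam < e1], Young's inequality bounds the error by [e1 (1 + c)], that is [e / 4], for the
   limit and the whole sequence alike. *)
pose e1 := e / 4 / (1 + c).
have e10 : 0 < e1 by rewrite /e1 !divr_gt0// ltr_pwDl.
have [h Lh [lam /andP[lam0 lame] hl]] := heart_approx T0 NPhi Hg e10.
have [ih hcv] := bounded_pairing_cvg T0 NPhi Lh acw acu wc uc wu.
have mg : vmeas_0T T g by case: Hg => -[].
have mgh := vmeasB mg Lh.1.
have split_ z : abs_continuous T z -> (modular T Phi (derive1 z) <= c%:E)%E ->
    `|Rintegral mu `[0, T]%classic (fun t => dotp (g t - h t) (derive1 z t))| <= e / 4 /\
    pairing T g (derive1 z) =
      Rintegral mu `[0, T]%classic (fun t => dotp (g t - h t) (derive1 z t)) + pairing T h (derive1 z).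
  move=> acz zc; have [igh rgh] := Young_pairing NPhi lam0 mgh (ac_vmeas_derive1 T0 acz) hl zc.
  split.
    apply: le_trans rgh _; apply: (@le_trans _ _ (e1 * (1 + c))).
      by apply: ler_wpM2r; [rewrite addr_ge0|exact: ltW].
    by rewrite /e1 divfK// gt_eqF// ltr_pwDl.
  rewrite /pairing -RintegralD//; last exact: ih.
  by apply: eq_Rintegral => t _; rewrite dotpBl subrK.
have e20 : 0 < e / 2 by rewrite divr_gt0.
move/cvgrPdist_le : hcv => /(_ _ e20); apply: filterS => n Hn.
have [k1 ->] := split_ _ acu uc; have [k2 ->] := split_ _ (acw n) (wc n).
exact (ler_dist_split Hn k1 k2).
Qed.

End weak_star.

(** * Existence of a minimizer *)

Section minimizing_sequence.
Context {R : realType} {d : nat}.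
Implicit Types (w : nat -> R -> 'rV[R]_d) (u : R -> 'rV[R]_d) (T : R).

Local Notation mu := (leb R).

Lemma natSinv_cvg0 : (fun k : nat => k.+1%:R^-1 : R) @ \oo --> (0 : R).
Proof. exact: cvg_harmonic. Qed.

Lemma potential_cvg T (F : R -> 'rV[R]_d -> R) (a : 'rV[R]_d -> R) (b : R -> R) w u :
  0 < T -> caratheodory_fun T F -> continuous a ->
  Lone T b -> ae_0T T (fun t => 0 <= b t) ->
  ae_0T T (fun t => forall x, `|F t x| <= a x * b t) ->
  (forall n, abs_continuous T (w n)) -> abs_continuous T u ->
  (forall k t, 0 <= t <= T -> `|w k t - u t| <= k.+1%:R^-1) ->
  (fun k => Rintegral mu `[0, T]%classic (fun t => F t (w k t))) @ \oo -->
    Rintegral mu `[0, T]%classic (fun t => F t (u t)).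
Proof.
move=> T0 cF ca ib b0 Fab acw acu wu.
have wcvg t : 0 <= t <= T -> w n t @[n --> \oo] --> u t.
  move=> tT; apply/cvgrPdist_le => e e0.
  have := natSinv_cvg0 => /cvgrPdist_le/(_ _ e0); apply: filterS => n.
  rewrite sub0r normrN ger0_norm// => ne; rewrite distrC; exact: le_trans (wu n t tT) ne.
have [r r0 Hr] := ac_bounded T0 acu.
(* The sequence stays within 1 of [u] in the sup norm; the factor [d] converts that norm into the
   Euclidean one. *)
have [A A0 HA] := continuous_enorm_bounded (d%:R * (r + 1)) ca.
have wr n t : 0 <= t <= T -> `|a (w n t)| <= A.
  move=> tT; apply: HA; apply: le_trans (enorm_le_norm _) _; rewrite ler_wpM2l//.
  rewrite -(subrKC (u t) (w n t)); apply: le_trans (ler_normD _ _) _; apply: lerD.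
    by apply: le_trans (norm_le_enorm _) _; exact: Hr.
  by apply: le_trans (wu n t tT) _; rewrite invf_le1// ler1n.
apply: (Rintegral_dominated (g := fun t => A * b t)).
- by move=> n; exact: caratheodory_measurable.
- exact: caratheodory_measurable.
- have [_ cF'] := cF; move: cF'; rewrite /ae_0T; apply: filterS => t H tT.
  apply: continuous_cvg; first exact: H.
  by apply: wcvg; move: tT; rewrite in_itv.
- exact: LoneZ.
- move: b0 Fab; rewrite /ae_0T; apply: filterS2 => t b0 H tT n.
  apply: le_trans (H tT (w n t)) _; apply: ler_wpM2r; first exact: b0.
  by apply: le_trans (ler_norm _) (wr n t _); move: tT; rewrite in_itv.
Qed.

(** The indices [phi k] need not increase: [k <= phi k] is all that the passage to the limit
    requires. *)
Lemma sequence_subconvergent T (Psi : 'rV[R]_d -> R) (c r : R) w : 0 < T -> is_Ninfty Psi ->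
  (forall n, bounded_slopes T Psi c (w n)) -> (forall n, enorm (w n 0) <= r) ->
  exists (u : R -> 'rV[R]_d) (phi : nat -> nat), forall k, (k <= phi k)%N /\
    forall t, 0 <= t <= T -> `|w (phi k) t - u t| <= k.+1%:R^-1.
Proof.
move=> T0 NPsi Hw wr; have [u Hu] := bounded_slopes_cluster T0 NPsi Hw wr.
have /choice[phi Hphi] k : exists n, (k <= n)%N /\
    forall t, 0 <= t <= T -> `|w n t - u t| <= k.+1%:R^-1.
  by have [n kn Hn] := Hu k; exists n.
by exists u, phi.
Qed.

End minimizing_sequence.

Unset Implicit Arguments.

Theorem theorem3p2 (R : realType) (d : nat) (T : R)
    (Phi Phi0 : 'rV[R]_d -> R) (F : R -> 'rV[R]_d -> R)
    (a : 'rV[R]_d -> R) (b delta : R -> R)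
    (M V H : set (R -> 'rV[R]_d)) :
  0 < T ->
  is_Ninfty Phi ->
  Delta2 (conjugate Phi) ->
  ae_0T T (fun t => forall x, differentiable (F t) x) ->
  caratheodory_fun T F ->
  vcaratheodory_fun T (fun t => grad (F t)) ->
  continuous a -> (forall x, 0 <= a x) ->
  Lone T b -> ae_0T T (fun t => 0 <= b t) ->
  ae_0T T (fun t => forall x,
    `|F t x| + enorm (grad (F t) x) <= a x * b t) ->
  is_Ninfty Phi0 ->
  (forall k : R, 0 < k ->
    exists2 C : R, 0 < C & forall x, Phi0 x <= C + Phi (k *: x)) ->
  Lone T delta -> ae_0T T (fun t => 1 <= delta t) ->
  ae_0T T (fun t => forall x,
    conjugate Phi ((delta t)^-1 *: grad (F t) x) <= Phi0 x + 1) ->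
  cvg_infty_pinfty (fun x =>
    Rintegral (leb R) `[0, T]%classic (fun t => F t x) / Phi0 (2 *: x)) ->
  weak_star_closed_subspace T Phi M ->
  closed_in_C0T T V ->
  H = [set u | [/\ W1L T Phi u, V u & M (derive1 u)]] ->
  H !=set0 ->
  exists2 u, H u & forall w, H w -> (action T Phi F u <= action T Phi F w)%E.
Proof.
move=> T0 NPhi D2 dF cF _ ca a0 ib b0 Fgab NPhi0 growth idelta delta1 cdelta cinf MC VC HE [w0 Hw0].
have Fab : ae_0T T (fun t => forall x, `|F t x| <= a x * b t).
  move: Fgab; rewrite /ae_0T; apply: filterS => t Ht tT x.
  by apply: le_trans (Ht tT x); rewrite lerDl enorm_ge0.
have [B HB] := coercive T0 cF ca a0 ib b0 Fab NPhi D2 dF NPhi0 growth idelta delta1 cdelta cinf.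
pose J u := Rintegral (leb R) `[0, T]%classic (fun t => F t (u t)).
have acH u : H u -> abs_continuous T u by rewrite HE => -[[]].
have actE u : abs_continuous T u -> action T Phi F u = (modular T Phi (derive1 u) + (J u)%:E)%E.
  move=> acu; apply: action_decomp => //.
  exact: (ac_potential_Lone T0 cF ca ib b0 Fab acu).
have mod0 u : (0 <= modular T Phi (derive1 u))%E.
  by apply: integral_ge0 => t _; rewrite lee_fin Ninfty_ge0.
have actfin u : abs_continuous T u -> (action T Phi F u < +oo)%E ->
    exists m : R, modular T Phi (derive1 u) = m%:E /\ action T Phi F u = (m + J u)%:E.
  move=> acu; rewrite (actE u acu); have := mod0 u.
  case: (modular T Phi (derive1 u)) => [m _ _| | ]//.
  by exists m.
(* If the functional is infinite on all of [H], every element is a minimizer; otherwise the infimum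
   is finite. *)
have [[w1 [Hw1 w1oo]]|allinf] := pselect (exists w, H w /\ (action T Phi F w < +oo)%E); last first.
  exists w0 => // w Hw; have : ~ (action T Phi F w < +oo)%E by move=> h; apply: allinf; exists w.
  by move/negP; rewrite -leNgt leye_eq => /eqP ->; rewrite leey.
pose S := [set action T Phi F w | w in H].
have Slb : (- B)%:E%E \in [set x | lbound S x].
  rewrite inE => _ [w Hw <-].
  have [woo|] := ltP (action T Phi F w) +oo%E; last first.
    by rewrite leye_eq => /eqP ->; rewrite leey.
  have [m [wm ->]] := actfin w (acH w Hw) woo; rewrite lee_fin.
  have m0 : 0 <= m by rewrite -lee_fin -wm.
  have := HB w m (acH w Hw) wm; have := Ninfty_ge0 NPhi0 (2 *: w 0).
  rewrite -/(J w); lra.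
have infS : ereal_inf S \is a fin_num.
  rewrite fin_numElt; apply/andP; split.
    apply: (@lt_le_trans _ _ (- B)%:E); first exact: ltNyr.
    by apply: le_ereal_inf_tmp; move: Slb; rewrite inE.
  by apply: le_lt_trans w1oo; apply: ereal_inf_lbound; exists w1.
set l := fine (ereal_inf S).
have lE : ereal_inf S = l%:E by rewrite fineK.
have /choice[w Hw] (n : nat) : exists w, H w /\ (action T Phi F w < (l + n.+1%:R^-1)%:E)%E.
  have n0 : 0 < n.+1%:R^-1 :> R by rewrite invr_gt0.
  by have [_ [w Hw <-] wl] := lb_ereal_inf_adherent n0 infS; exists w; rewrite lE in wl.
have acw n : abs_continuous T (w n) by apply: acH; exact: (Hw n).1.
have /choice[m Hm] n : exists m : R, modular T Phi (derive1 (w n)) = m%:E /\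
    m + J (w n) < l + n.+1%:R^-1.
  have [m [wm wE]] := actfin (w n) (acw n) (lt_trans (Hw n).2 (ltry _)).
  by exists m; split => //; rewrite -lte_fin -wE; exact: (Hw n).2.
(* Coercivity and action at most [l + 1] give [m / 2 + Phi0 (2 w(0)) <= l + 1 + B]; both terms on
   the left are nonnegative. *)
pose c := 2 * (l + 1 + B).
have wbound n : m n <= c /\ Phi0 (2 *: w n 0) <= l + 1 + B.
  have [wm wl] := Hm n.
  have m0 : 0 <= m n by rewrite -lee_fin -wm.
  have n1 : n.+1%:R^-1 <= 1 :> R by rewrite invf_le1// ler1n.
  have := HB (w n) (m n) (acw n) wm; have := Ninfty_ge0 NPhi0 (2 *: w n 0).
  rewrite -/(J (w n)) /c => p0 HBn.
  have H1 : m n / 2 + Phi0 (2 *: w n 0) - B <= l + 1.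
    by apply: le_trans HBn _; apply: ltW; apply: lt_le_trans wl _; rewrite lerD2l.
  move: (Phi0 _) (m n) (l) p0 m0 H1 => p mn l0 p0 m0 H1; clear -p0 m0 H1.
  by split; lra.
have wmod n : (modular T Phi (derive1 (w n)) <= c%:E)%E.
  by rewrite (Hm n).1 lee_fin (wbound n).1.
have wslopes n : bounded_slopes T Phi c (w n) := modular_bounded_slopes T0 NPhi (acw n) (wmod n).
(* Superlinearity of [Phi0] turns the bound on [Phi0 (2 w(0))] into one on the initial values. *)
have [K K0 HK] := Ninfty_superlinear NPhi0 ltr01.
have w0r n : enorm (w n 0) <= K + (l + 1 + B).
  apply: (@le_trans _ _ (enorm (2 *: w n 0))).
    by rewrite enormZ ger0_norm// ler_peMl ?enorm_ge0// ler1n.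
  by apply: le_trans (HK _) _; rewrite mul1r lerD2l (wbound n).2.
have [u [phi Hphi]] := sequence_subconvergent T0 NPhi wslopes w0r.
pose z k := w (phi k).
have zu k t : 0 <= t <= T -> `|z k t - u t| <= k.+1%:R^-1 by exact: (Hphi k).2.
have zcvg t : 0 <= t <= T -> z n t @[n --> \oo] --> u t.
  move=> tT; apply/cvgrPdist_le => e e0.
  have := @natSinv_cvg0 R => /cvgrPdist_le/(_ _ e0); apply: filterS => n.
  rewrite sub0r normrN ger0_norm// => ne; rewrite distrC; exact: le_trans (zu n t tT) ne.
have uslopes : bounded_slopes T Phi c u.
  by apply: (bounded_slopes_lim NPhi zcvg); apply: nearW => n; exact: wslopes.
have acu := bounded_slopes_ac NPhi uslopes.
have umod := bounded_slopes_modular T0 NPhi uslopes.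
have Jcvg : J (z k) @[k --> \oo] --> J u.
  exact: (potential_cvg T0 cF ca ib b0 Fab (fun k => acw (phi k)) acu zu).
have Hu : H u.
  rewrite HE; split.
  - split => //; split; first exact: ac_vmeas_derive1.
    exists 1 => //; apply: le_lt_trans (ltry c); apply: le_trans umod.
    by rewrite (_ : (fun t => 1 *: derive1 u t) = derive1 u)//; apply/funext => t; rewrite scale1r.
  - apply: (uniform_closed_limit VC (w := z) _ (ac_C0T acu)).
      by move=> n; have := (Hw (phi n)).1; rewrite HE => -[].
    by move=> k; exists k => t; exact: zu.
  - apply: (weak_star_closed_limit MC (v := fun n => derive1 (z n))).
    + by move=> n; have := (Hw (phi n)).1; rewrite HE => -[].
    + split; first exact: ac_vmeas_derive1.
      exists 1 => //; apply: le_lt_trans (ltry c); apply: le_trans umod.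
      by rewrite (_ : (fun t => 1 *: derive1 u t) = derive1 u)//; apply/funext => t; rewrite scale1r.
    + move=> g Hg.
      exact: (heart_pairing_cvg T0 NPhi Hg (fun k => acw (phi k)) acu (fun k => wmod (phi k)) umod zcvg).
exists u => // w' Hw'.
apply: (@le_trans _ _ l%:E); last by rewrite -lE; apply: ereal_inf_lbound; exists w'.
rewrite actE//; apply/lee_addgt0Pr => e e0.
have e20 : 0 < e / 2 by rewrite divr_gt0.
(* The slope bound is used a second time, with the sharper constant [l - J u + e]: for large [n] it
   bounds the modular of [z n], because the action of [z n] approaches [l] while [J (z n)] tends to
   [J u]. *)
suff : (modular T Phi (derive1 u) <= (l - J u + e)%:E)%E.
  move=> h; apply: (@le_trans _ _ ((l - J u + e)%:E + (J u)%:E)%E); first by rewrite leeD2r.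
  by rewrite -!EFinD lee_fin; lra.
apply: bounded_slopes_modular => //.
apply: (bounded_slopes_lim NPhi zcvg).
have := Jcvg => /cvgrPdist_le/(_ _ e20); have := @natSinv_cvg0 R => /cvgrPdist_le/(_ _ e20).
apply: filterS2 => n n1 n2; apply: modular_bounded_slopes => //; first exact: acw.
have [zm zl] := Hm (phi n); rewrite /z zm lee_fin.
have n3 : (phi n).+1%:R^-1 <= n.+1%:R^-1 :> R.
  by rewrite lef_pV2 ?posrE// ler_nat ltnS; exact: (Hphi n).1.
move: n1; rewrite sub0r normrN ger0_norm// => n1.
move: n2; rewrite ler_norml /z => /andP[_ n2].
move: (m (phi n)) (J (w _)) (J u) (l) (_^-1) zl n3 n1 n2 => mn Jn Ju l0 q zl n3 n1 n2.
move: (le_trans n3 n1) => n4; clear -zl n4 n2; lra.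
Qed.
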